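(* Let $\Omega\subset\mathbb{C}$ be a region whose boundary is an analytic Jordan curve $\Gamma$. Let $\Omega$ contain a finger of length $L>1$, and let $a\in\Omega$ be a point outside the finger on one end. Then the harmonic measure $\omega$ at $a$, with respect to $\Omega$, of the portion $\Gamma_{\mathrm{exit}}$ of $\Gamma$ beyond the other end $B$ of the finger satisfies $$\omega<\frac{C}{2\pi}\,d\,e^{-\pi L},$$ where $C$ is a constant independent of $\Omega$ and $L$, and $d$ is the (total) length of the segment(s) $B\cap\Omega$. Numerical computations indicate that a suitable value is $C\approx 14.7$.
   Context: Setting. $\Omega$ is the image of the open unit disk under a conformal map, and its boundary is an analytic Jordan curve $\Gamma$. Finger. $\Omega$ contains a finger of length $L>0$ if there is a rectangular channel of width $1$ defined by a pair of parallel line segments of length $L$, disjoint from $\Omega$, such that $\Omega$ extends all the way through the channel with parts of $\Omega$ lying outside both ends. The two ends of the channel (the sides of length $1$ of the rectangle) are denoted $A$ and $B$. The point $a\in\Omega$ lies outside the channel at one end (the end $A$), and $\Gamma_{\mathrm{exit}}$, the ''exit arc'', is the nonempty portion of $\Gamma$ lying outside the channel at the other end, i.e. beyond $B$. ''Beyond $B$'' is interpreted topologically: if a part of $\Omega$ extends beyond $B$ and then bends around to cross $B$ again and reenter the rectangle, that part and its portion of the boundary $\Gamma$ still count as beyond $B$. Harmonic measure. The harmonic measure $\omega\in(0,1)$ of $\Gamma_{\mathrm{exit}}$ at $a$ with respect to $\Omega$ is the value $u(a)$ of the (bounded) harmonic function $u$ in $\Omega$ that takes boundary values $1$ along $\Gamma_{\mathrm{exit}}$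 and $0$ elsewhere on $\Gamma$; equivalently, it is the probability that a Brownian path starting at $a$ first hits $\Gamma$ somewhere along $\Gamma_{\mathrm{exit}}$. The existence of a constant $C$ is what is proved; the value $C\approx 14.7$ is a numerical estimate, obtained from Schwarz–Christoffel computations. *)

(* Defs.v *)
(* MathComp-Analysis; the plane is R[i] over an arbitrary R : realType, with the
   topology of its norm (carried by the alias R[i]^o). *)
From HB Require Import structures.
From mathcomp Require Export all_boot all_order all_algebra.
From mathcomp Require Export all_classical all_reals all_analysis.
From mathcomp Require Export complex.

Set Implicit Arguments.
Unset Strict Implicit.
Unset Printing Implicit Defensive.

Export Order.TTheory GRing.Theory Num.Theory numFieldNormedType.Exports.

Local Open Scope classical_set_scope.
Local Open Scope ring_scope.
Local Open Scope complex_scope.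

Section Defs.
Context {R : realType}.
Local Notation C := (R[i]^o).

Definition boundary (Omega : set C) : set C := closure Omega `\` Omega°.

(* As f is a function C -> C, the derivative along 1 is the complex one. *)
Definition holomorphic_on (U : set C) (f : C -> C) : Prop :=
  forall z, U z -> derivable f z 1.

Definition conformal_on (U : set C) (f : C -> C) : Prop :=
  holomorphic_on U f /\ {in U &, injective f}.

Definition unit_disk : set C := [set z | `|z| < 1].
Definition unit_circle : set C := [set z | `|z| = 1].

Definition conformal_image_of_disk (Omega : set C) : Prop :=
  exists2 f : C -> C, conformal_on unit_disk f & Omega = f @` unit_disk.

Definition analytic_Jordan_curve (Gamma : set C) : Prop :=
  exists (V : set C) (phi : C -> C),
    [/\ open V, unit_circle `<=` V, conformal_on V phi
      & Gamma = phi @` unit_circle].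

Definition directional (v : C) (u : C -> R) (z : C) : R -> R :=
  fun t => u (z + t%:C * v).
Definition has_partial (v : C) (u : C -> R) (z : C) : Prop :=
  derivable (directional v u z) 0 1.
Definition partial (v : C) (u : C -> R) (z : C) : R :=
  derive1 (directional v u z) 0.

Definition harmonic_on (Omega : set C) (u : C -> R) : Prop :=
  (forall v w : C, [set 1; 'i] v -> [set 1; 'i] w -> forall z, Omega z ->
     [/\ has_partial v u z, has_partial w (partial v u) z
       & {for z, continuous (partial w (partial v u))}]) /\
  (forall z, Omega z ->
     partial 1 (partial 1 u) z + partial 'i (partial 'i u) z = 0).

(* w is the harmonic measure at a of E with respect to Omega, for E a part of
   the boundary Gamma.  The boundary value 1 (resp. 0) is required at the points
   of Gamma near which Gamma lies inside (resp. outside) E; nothing is required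
   at the end points of the arcs of E, where u has no limit.  When there are
   finitely many end points, these conditions determine u. *)
Definition is_harmonic_measure
    (Omega E : set C) (a : C) (w : R) : Prop :=
  exists u : C -> R,
    [/\ harmonic_on Omega u,
        exists M : R, forall z, Omega z -> `|u z| <= M,
        forall zeta, boundary Omega zeta ->
          ~ closure (boundary Omega `\` E) zeta ->
          u z @[z --> within Omega (nbhs zeta)] --> (1 : R),
        forall zeta, boundary Omega zeta -> ~ closure (boundary Omega `&` E) zeta ->
          u z @[z --> within Omega (nbhs zeta)] --> (0 : R)
      & w = u a].

(* The channel with corner p, direction e (of modulus 1) and length L, in
   coordinates 0 <= x <= L along the channel and 0 <= y <= 1 across it.  The end
   A is x = 0 and the end B is x = L; since e is arbitrary, either end of a
   given channel can be taken as A. *)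
Definition chan_pt (p e : C) (x y : R) : C := p + e * (x +i* y).

Definition channel (p e : C) (L : R) : set C :=
  [set z | exists x y, [/\ 0 <= x <= L, 0 <= y <= 1 & z = chan_pt p e x y]].

Definition channel_walls (p e : C) (L : R) : set C :=
  [set z | exists x y, [/\ 0 <= x <= L, y = 0 \/ y = 1 & z = chan_pt p e x y]].

Definition end_A (p e : C) : set C :=
  [set chan_pt p e 0 y | y in [set y : R | 0 <= y <= 1]].

Definition end_B (p e : C) (L : R) : set C :=
  [set chan_pt p e L y | y in [set y : R | 0 <= y <= 1]].

Definition path_in (Omega : set C) (g : R -> C) : Prop :=
  {within [set t : R | 0 <= t <= 1], continuous g} /\
  (forall t, 0 <= t <= 1 -> Omega (g t)).

Definition traverses (p e : C) (L : R) (g : R -> C) : Prop :=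
  exists s t : R,
    [/\ 0 <= s, s <= t, t <= 1, end_A p e (g s) /\ end_B p e L (g t)
      & forall r, s <= r <= t -> channel p e L (g r)].

(* For open Omega, a path of Omega through the channel meets A and B at points
   of Omega off the walls, so that Omega does extend outside both ends. *)
Definition contains_finger (Omega : set C) (p e : C) (L : R) : Prop :=
  [/\ `|e| = 1, 0 < L, channel_walls p e L `&` Omega = set0
    & exists2 g, path_in Omega g & traverses p e L g].

(* From a one can enter the channel at A and go through it to B, without meeting
   B before that. *)
Definition outside_at_A (Omega : set C) (p e : C) (L : R) (a : C) : Prop :=
  [/\ Omega a, ~ channel p e L a
    & exists g, [/\ path_in Omega g, g 0 = a,
        forall t, 0 <= t < 1 -> ~ end_B p e L (g t) & traverses p e L g]].

(* The part of Omega beyond B is understood topologically: its points are those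
   reached from a, within Omega, only by going through the channel from A to B.
   They may lie geometrically inside the channel, if Omega bends back after B. *)
Definition beyond_B (Omega : set C) (p e : C) (L : R) (a : C) : set C :=
  [set z | Omega z /\ forall g, path_in Omega g -> g 0 = a -> g 1 = z ->
                        traverses p e L g].

Definition exit_arc (Omega : set C) (p e : C) (L : R) (a : C) : set C :=
  boundary Omega `&` closure (beyond_B Omega p e L a).

(* The coordinate y is arc length along B, since e has modulus 1. *)
Definition exit_width (Omega : set C) (p e : C) (L : R) : R :=
  fine (lebesgue_measure [set y : R | 0 <= y <= 1 /\ Omega (chan_pt p e L y)]).

End Defs.

(* Main.v *)
Require Import Defs.
From mathcomp Require Import ring lra.

(* Let m be the supremum of u over the points of the slice x = 1/2 of the channel
   that lie before B.  By the maximum principle u(a) <= m, as u vanishes on the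
   rest of the boundary on this side of B.  In the channel before B, put
   P = m e^{-x} cos(y - 1/2) / cos(1/2), which dominates u on the end A.  Then
   u - P is at most 1/pi times the angle under which B inside Omega is seen, hence
   O(d) at a distance 1/8 from B; a quadratic harmonic barrier turns this into
   O(d y(1 - y)) on x = L - 1/4, and e^{pi x} sin(pi y) carries it back to x = 1/2
   with the factor e^{-pi L}.  So m <= K d e^{-pi L} + kappa m, where
   kappa = e^{-1/2} / cos(1/2) < 1.
   The maximum principle has to ignore the boundary points where u has no limit.
   They lie on the line x = L, which an analytic Jordan curve bounding Omega meets
   in finitely many points; a logarithmic barrier disposes of these.  The
   necessary complex analysis (isolated zeros, open mapping of injective maps) is
   derived from Goursat's theorem on squares. *)

Set Implicit Arguments.
Unset Strict Implicit.
Unset Printing Implicit Defensive.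

Local Open Scope classical_set_scope.
Local Open Scope ring_scope.
Local Open Scope complex_scope.

Local Notation Re := (@complex.Re _).
Local Notation Im := (@complex.Im _).

(** * Goursat's theorem on squares *)

Section Bisection.
Context {R : realType}.
Implicit Types (x y l : R).

(** On the end A the only bound for u is the unknown m, which does not decay with L. Hence the
    argument is self-referential: this term cannot be estimated away, it has to contract and then be
    absorbed. The distance 1/2 between A and the slice is what makes it contract, and L > 1 leaves
    room for it beside the layers of width 1/4 and 3/8 next to B. Since Omega may bend back into the
    rectangle, the comparisons take place on a set defined by paths, the near side. Boundary values
    are prescribed only at points away from the ends of the arcs, so it must be known that near a
    boundary point off B all of Omega belongs to one and the same side of the finger. This local
    connectedness holds because Gamma is the image of a circle under an injective holomorphic map of
    a neighbourhood, once Omega is known not to lie on both sides of Gamma. Any Cauchy estimate with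
    a fixed constant is enough, so no contour integral has to be evaluated. Likewise the maximum
    principle uses strict superharmonicity and the second derivative test instead of mean values. *)

Lemma bisection_principle (A nu : R -> R -> R -> R) (x0 y0 l0 : R) :
  0 < l0 ->
  (forall x y l, 0 < l -> A x y l = A x y (l / 2) + A (x + l / 2) y (l / 2)
     + A x (y + l / 2) (l / 2) + A (x + l / 2) (y + l / 2) (l / 2)) ->
  (forall x y l, 0 < l -> nu x y l = nu x y (l / 2) + nu (x + l / 2) y (l / 2)
     + nu x (y + l / 2) (l / 2) + nu (x + l / 2) (y + l / 2) (l / 2)) ->
  (forall x y, x0 <= x <= x0 + l0 -> y0 <= y <= y0 + l0 ->
    exists2 d : R, 0 < d & forall x1 y1 l, x0 <= x1 -> x1 + l <= x0 + l0 ->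
      y0 <= y1 -> y1 + l <= y0 + l0 -> 0 < l < d ->
      x1 <= x <= x1 + l -> y1 <= y <= y1 + l -> `|A x1 y1 l| <= nu x1 y1 l) ->
  `|A x0 y0 l0| <= nu x0 y0 l0.
Proof.
move=> l0_gt0 addA addnu loc; rewrite leNgt; apply/negP => bad0.
pose bad (s : R * R * R) := nu s.1.1 s.1.2 s.2 < `|A s.1.1 s.1.2 s.2|.
pose sub (s t : R * R * R) := [/\ 0 < t.2,
  s.1.1 <= t.1.1, t.1.1 + t.2 <= s.1.1 + s.2,
  s.1.2 <= t.1.2 & t.1.2 + t.2 <= s.1.2 + s.2 /\ t.2 = s.2 / 2].
have step (s : R * R * R) : exists t, 0 < s.2 -> bad s -> sub s t /\ bad t.
  case: (boolP `[< 0 < s.2 /\ bad s >]) => [/asboolP[s2 bs]|/asboolPn h]; last first.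
    by exists s => a b; case: h.
  apply/not_existsP => noT.
  move: bs; rewrite /bad addA// addnu// => bs.
  have h (a b : bool) : `|A (if a then s.1.1 + s.2 / 2 else s.1.1)
      (if b then s.1.2 + s.2 / 2 else s.1.2) (s.2 / 2)|
      <= nu (if a then s.1.1 + s.2 / 2 else s.1.1)
      (if b then s.1.2 + s.2 / 2 else s.1.2) (s.2 / 2).
    rewrite leNgt; apply/negP => ?.
    apply: (noT (if a then s.1.1 + s.2 / 2 else s.1.1,
      if b then s.1.2 + s.2 / 2 else s.1.2, s.2 / 2)) => _ _.
    by split => //; clear -s2; case: a; case: b; split => //=; lra.
  have h1 := h false false; have h2 := h true false.
  have h3 := h false true; have h4 := h true true.
  move: bs; rewrite ltNge => /negP; apply.
  apply: (le_trans (ler_normD _ _)); apply: lerD => //.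
  apply: (le_trans (ler_normD _ _)); apply: lerD => //.
  by apply: (le_trans (ler_normD _ _)); apply: lerD.
have [f Hf] := choice step.
pose s n := iter n f (x0, y0, l0).
have Hs n : 0 < (s n).2 /\ bad (s n).
  elim: n => [|n [h1 h2]]; first by split.
  by have [[? ? ? ? [? ?]] ?] := Hf _ h1 h2.
have Hsub n : sub (s n) (s n.+1) by have [h1 h2] := Hs n; have [] := Hf _ h1 h2.
have Hl n : (s n).2 = l0 / 2 ^+ n.
  elim: n => [|n IH]; first by rewrite expr0 divr1.
  by have [_ _ _ _ [_ ->]] := Hsub n; rewrite IH exprS invfM; ring.
have mono m n : (m <= n)%N -> [/\ (s m).1.1 <= (s n).1.1,
   (s n).1.1 + (s n).2 <= (s m).1.1 + (s m).2,
   (s m).1.2 <= (s n).1.2 & (s n).1.2 + (s n).2 <= (s m).1.2 + (s m).2].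
  elim: n => [|n IH]; first by rewrite leqn0 => /eqP ->.
  rewrite leq_eqVlt => /predU1P[->//|/IH].
  by have [+ + + + [+ _]] := Hsub n; clear; move=> ? ? ? ? ? [? ? ? ?]; split; lra.
(* Along the nested squares the lower coordinate increases and the upper one decreases, so the
   supremum of the lower ones lies in all the intervals. *)
have limit (g : R * R * R -> R) : (forall m n, (m <= n)%N -> g (s m) <= g (s n) /\
     g (s n) + (s n).2 <= g (s m) + (s m).2) ->
     exists z, forall n, g (s n) <= z <= g (s n) + (s n).2.
  move=> gm; exists (sup (range (g \o s))) => n.
  have ub m : ubound (range (g \o s)) (g (s m) + (s m).2).
    move=> _ [k _ <-] /=; have [mk|/ltnW km] := leqP m k.
      by have [_] := gm _ _ mk; have [] := Hs k => ? _ ?; lra.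
    by have [] := gm _ _ km; have [] := Hs m => ? _ ? ?; lra.
  apply/andP; split.
    by apply: ub_le_sup; [exists (g (s 0%N) + (s 0%N).2); exact: ub|exists n].
  by apply: ge_sup => //; exists (g (s 0%N)), 0%N.
have [x Hx] : exists x, forall n, (s n).1.1 <= x <= (s n).1.1 + (s n).2.
  by apply: (limit (fun t => t.1.1)) => m n /mono[].
have [y Hy] : exists y, forall n, (s n).1.2 <= y <= (s n).1.2 + (s n).2.
  by apply: (limit (fun t => t.1.2)) => m n /mono[].
have [d d0 Hd] := loc x y (Hx 0%N) (Hy 0%N).
have [n Hn] : exists n, (s n).2 < d.
  have : l0 / d < (Num.bound (l0 / d))%:R.
    by rewrite archi_boundP// divr_ge0// ltW.
  set k := Num.bound _ => hk; exists k; rewrite Hl ltr_pdivrMr ?exprn_gt0//.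
  rewrite mulrC -ltr_pdivrMr// (lt_le_trans hk)// -natrX ler_nat.
  by rewrite ltnW// ltn_expl.
have [h1 h2] := Hs n; have [m1 m2 m3 m4] := mono 0%N n (leq0n n).
by move: h2; rewrite /bad ltNge Hd// h1.
Qed.
End Bisection.

(** * Integrals of continuous functions over segments *)

Section Int.
Context {R : realType}.
Local Notation mu := (@lebesgue_measure R).

Definition seg_int (g : R -> R) (a b : R) : R := \int[mu]_(x in `[a, b]) g x.

Lemma seg_integrable (g : R -> R) (a b : R) : continuous g ->
  mu.-integrable `[a, b] (EFin \o g).
Proof.
move=> cg; apply: continuous_compact_integrable; first exact: segment_compact.
exact: continuous_subspaceT.
Qed.

Lemma seg_int_split (g : R -> R) (a b c : R) : continuous g -> a <= b -> b <= c ->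
  seg_int g a c = seg_int g a b + seg_int g b c.
Proof.
move=> cg ab bc; rewrite /seg_int.
have := @Rintegral_itvB R g (BLeft a) (BRight c) b (seg_integrable a c cg).
rewrite /= !bnd_simp => /(_ ab bc) h.
rewrite [X in _ = _ + X](_ : _ = \int[mu]_(x in `]b, c]) g x); last first.
  by rewrite Rintegral_itv_obnd_cbnd//; apply: integrableS (seg_integrable b c cg) => //; exact: subset_itv_oc_cc.
by rewrite -h addrC subrK.
Qed.

Lemma seg_intB (g h : R -> R) (a b : R) : continuous g -> continuous h ->
  seg_int (fun x => g x - h x) a b = seg_int g a b - seg_int h a b.
Proof.
by move=> cg ch; rewrite /seg_int RintegralB//; exact: seg_integrable.
Qed.

Lemma seg_int_bound (g : R -> R) (a b k eps : R) : continuous g -> a <= b ->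
  (forall x, a <= x <= b -> `|g x - k| <= eps) ->
  `|seg_int g a b - k * (b - a)| <= eps * (b - a).
Proof.
move=> cg ab gb.
have cst z : seg_int (cst z) a b = z * (b - a).
  rewrite /seg_int Rintegral_cst//=; congr (_ * _); rewrite lebesgue_measure_itv/= lte_fin.
  by case: ltgtP ab => //= ->; rewrite subrr.
have mem x : x \in `[a, b] -> a <= x <= b by rewrite in_itv.
rewrite ler_distl -mulrBl -mulrDl; apply/andP; split.
  rewrite -cst /seg_int le_Rintegral//; try exact: seg_integrable.
    by apply: seg_integrable => x; exact: cst_continuous.
  by move=> x /mem/gb; rewrite ler_distl => /andP[].
rewrite -cst /seg_int le_Rintegral//; try exact: seg_integrable.
  by apply: seg_integrable => x; exact: cst_continuous.
by move=> x /mem/gb; rewrite ler_distl => /andP[].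
Qed.
End Int.

Section Goursat.
Context {R : realType}.
Implicit Types (P Q : R -> R -> R) (S : seq (R * R)).

(** The circulation of P dx + Q dy, counterclockwise, around the square with lower left corner (x,
    y) and side l. *)
Definition square_int P Q (x y l : R) : R :=
  seg_int (fun t => P t y - P t (y + l)) x (x + l) +
  seg_int (fun t => Q (x + l) t - Q x t) y (y + l).

(** Each interior edge is run through twice, in opposite directions. *)
Lemma square_int_quad P Q (x y l : R) : 0 < l ->
  (forall y, continuous (P^~ y)) -> (forall x, continuous (Q x)) ->
  square_int P Q x y l = square_int P Q x y (l / 2) + square_int P Q (x + l / 2) y (l / 2)
     + square_int P Q x (y + l / 2) (l / 2) + square_int P Q (x + l / 2) (y + l / 2) (l / 2).
Proof.
move=> l0 cP cQ; rewrite /square_int.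
have PI a b c d : seg_int (fun t => P t a - P t b) c d = seg_int (P^~ a) c d - seg_int (P^~ b) c d.
  by rewrite seg_intB.
have QI a b c d : seg_int (fun t => Q a t - Q b t) c d = seg_int (Q a) c d - seg_int (Q b) c d.
  by rewrite seg_intB.
rewrite !PI !QI.
have xh : x + l / 2 + l / 2 = x + l by lra.
have yh : y + l / 2 + l / 2 = y + l by lra.
rewrite !xh !yh.
have x1 : x <= x + l / 2 by lra. have x2 : x + l / 2 <= x + l by lra.
have y1 : y <= y + l / 2 by lra. have y2 : y + l / 2 <= y + l by lra.
rewrite !(seg_int_split (cP _) x1 x2) !(seg_int_split (cQ _) y1 y2).
have alg (a1 a2 b1 b2 c1 c2 d1 d2 e1 e2 f1 f2 : R) :
  a1 + a2 - (b1 + b2) + (c1 + c2 - (d1 + d2)) =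
  a1 - e1 + (f1 - d1) + (a2 - e2 + (c1 - f1)) + (e1 - b1 + (f2 - d2)) + (e2 - b2 + (c2 - f2)).
  by clear; ring.
exact: alg.
Qed.

(** As [Num.sqrt] vanishes on negative numbers, this is the increasing odd function sign(t) sqrt
    |t|. Its increment over an interval of length l around 0 is at least sqrt l, so that the product
    of the increments in x and in y is at least l; and increments add up under subdivision. *)
Definition ssqrt (t : R) : R := Num.sqrt t - Num.sqrt (- t).

Lemma ssqrt_le (a b : R) : a <= b -> ssqrt a <= ssqrt b.
Proof. by move=> ab; apply: lerB; apply: ler_wsqrtr => //; rewrite lerN2. Qed.

Lemma ssqrt_gap (a l : R) : a <= 0 <= a + l -> Num.sqrt l <= ssqrt (a + l) - ssqrt a.
Proof.
move=> /andP[a0 al]; rewrite /ssqrt (ler0_sqrtr a0) (@ler0_sqrtr _ (- (a + l))) ?oppr_le0//.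
rewrite subr0 sub0r opprK.
have s1 := sqrtr_ge0 (a + l); have s2 := sqrtr_ge0 (- a).
rewrite -(@ler_pXn2r _ 2) ?nnegrE ?sqrtr_ge0 ?addr_ge0//.
rewrite sqrrD !sqr_sqrtr ?oppr_ge0//; last by lra.
have := mulr_ge0 s1 s2; lra.
Qed.

(* An additive function of squares that dominates the area, and the side length
   when the square touches S: near S, the integrals need only be o(l). *)
Definition square_weight S (x y l : R) : R :=
  l * l + \sum_(s <- S) (ssqrt (x + l - s.1) - ssqrt (x - s.1)) *
                        (ssqrt (y + l - s.2) - ssqrt (y - s.2)).

Lemma square_weight_quad S (x y l : R) :
  square_weight S x y l = square_weight S x y (l / 2) + square_weight S (x + l / 2) y (l / 2)
     + square_weight S x (y + l / 2) (l / 2) + square_weight S (x + l / 2) (y + l / 2) (l / 2).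
Proof.
rewrite /square_weight.
have xh : x + l / 2 + l / 2 = x + l by lra.
have yh : y + l / 2 + l / 2 = y + l by lra.
rewrite !xh !yh.
rewrite (_ : forall a b1 b2 c d e f g: R, a + b1 + (c + d) + (b2 + e) + (f + g) = (a + c + b2 + f) + (b1 + d + e + g)); last by clear; move=> *; ring.
rewrite -!big_split/=; congr (_ + _); first by field.
apply: eq_bigr => s _; ring.
Qed.

Lemma square_weight_ge S (x y l : R) : 0 <= l -> l * l <= square_weight S x y l.
Proof.
move=> l0; rewrite /square_weight lerDl sumr_ge0// => s _.
by apply: mulr_ge0; rewrite subr_ge0 ssqrt_le// lerB// lerDl.
Qed.

Lemma square_weight_ge_mem S (x y l : R) s : 0 <= l -> s \in S ->
  x <= s.1 <= x + l -> y <= s.2 <= y + l -> l <= square_weight S x y l.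
Proof.
move=> l0 sS hx hy; rewrite /square_weight (big_rem s sS)/=.
have xg : Num.sqrt l <= ssqrt (x + l - s.1) - ssqrt (x - s.1).
  have -> : x + l - s.1 = x - s.1 + l by ring.
  by apply: ssqrt_gap; move: hx; clear; lra.
have yg : Num.sqrt l <= ssqrt (y + l - s.2) - ssqrt (y - s.2).
  have -> : y + l - s.2 = y - s.2 + l by ring.
  by apply: ssqrt_gap; move: hy; clear; lra.
rewrite addrCA -[leLHS]addr0 lerD//.
  by rewrite -[leLHS](sqr_sqrtr l0) expr2 ler_pM// sqrtr_ge0.
rewrite addr_ge0 ?mulr_ge0// sumr_ge0// => t _.
by apply: mulr_ge0; rewrite subr_ge0 ssqrt_le// lerB// lerDl.
Qed.

(* The off-diagonal coefficients agree: dP/dy = dQ/dx at (x, y). *)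
Definition closed_form_at P Q (D : R -> R -> Prop) (x y : R) :=
  exists a b c : R, forall eps : R, 0 < eps -> exists2 d : R, 0 < d & forall x' y', D x' y' ->
    `|x' - x| < d -> `|y' - y| < d ->
    `|P x' y' - P x y - a * (x' - x) - b * (y' - y)| <= eps * (`|x' - x| + `|y' - y|) /\
    `|Q x' y' - Q x y - b * (x' - x) - c * (y' - y)| <= eps * (`|x' - x| + `|y' - y|).

Definition continuous_form_at P Q (D : R -> R -> Prop) (x y : R) :=
  forall eps : R, 0 < eps -> exists2 d : R, 0 < d & forall x' y', D x' y' ->
    `|x' - x| < d -> `|y' - y| < d ->
    `|P x' y' - P x y| <= eps /\ `|Q x' y' - Q x y| <= eps.

(** By bisection it suffices to bound the circulation around small squares at each point. Where the
    form is closed, the affine part has circulation 0 and the error is o(l) on a contour of length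
    4l, hence o(l^2). At the points of [S] only o(l) is available, which is why the weight of a
    square touching [S] is at least l. *)
Lemma goursat P Q S (x0 y0 l0 : R) :
  let D x y := x0 <= x <= x0 + l0 /\ y0 <= y <= y0 + l0 in
  0 < l0 ->
  (forall y, continuous (P^~ y)) -> (forall x, continuous (Q x)) ->
  (forall x y, D x y -> (x, y) \notin S -> closed_form_at P Q D x y) ->
  (forall x y, D x y -> (x, y) \in S -> continuous_form_at P Q D x y) ->
  square_int P Q x0 y0 l0 = 0.
Proof.
move=> D l00 cP cQ hdiff hcont.
have cPB a b : continuous (fun t => P t a - P t b).
  by move=> x; apply: continuousB; apply: cP.
have cQB a b : continuous (fun t => Q a t - Q b t).
  by move=> x; apply: continuousB; apply: cQ.
suff H (eps : R) : 0 < eps -> `|square_int P Q x0 y0 l0| <= eps * square_weight S x0 y0 l0.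
  apply/eqP; rewrite -normr_le0; apply/ler_addgt0Pl => e e0; rewrite addr0.
  have w0 : 0 < square_weight S x0 y0 l0.
    by apply: lt_le_trans (square_weight_ge _ _ _ (ltW l00)); rewrite mulr_gt0.
  have := H (e / square_weight S x0 y0 l0).
  by rewrite divr_gt0// divfK ?gt_eqF// => /(_ isT).
move=> eps0.
apply: (@bisection_principle R (square_int P Q) (fun x y l => eps * square_weight S x y l)) => //.
- by move=> x y l ?; rewrite square_int_quad.
- by move=> x y l ?; rewrite square_weight_quad !mulrDr.
move=> x y Dx Dy; have Dxy : D x y by [].
have [xyS|xyS] := boolP ((x, y) \in S); last first.
  have [a [b [c H]]] := hdiff x y Dxy xyS.
  (* On the square P and Q are within eps/8 * 2l of their affine parts. Opposite sides double this
     error to (eps/2) l, and two pairs of sides of length l give eps l^2 in all. *)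
  have e8 : 0 < eps / 8 by rewrite divr_gt0.
  have [d d0 Hd] := H _ e8.
  exists d => // x1 y1 l hx1 hx2 hy1 hy2 /andP[lp ld] /andP[h1 h2] /andP[h3 h4].
  have key x' y' : x1 <= x' <= x1 + l -> y1 <= y' <= y1 + l ->
    `|P x' y' - P x y - a * (x' - x) - b * (y' - y)| <= (eps/8) * (2 * l) /\
    `|Q x' y' - Q x y - b * (x' - x) - c * (y' - y)| <= (eps/8) * (2 * l).
    move=> /andP[k1 k2] /andP[k3 k4].
    have xx : `|x' - x| <= l by move: k1 k2 h1 h2; clear; rewrite ler_norml; lra.
    have yy : `|y' - y| <= l by move: k3 k4 h3 h4; clear; rewrite ler_norml; lra.
    have [||| u v] := Hd x' y'.
    + by split; [move: k1 k2 hx1 hx2|move: k3 k4 hy1 hy2]; clear; lra.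
    + exact: le_lt_trans ld.
    + exact: le_lt_trans ld.
    have : eps / 8 * (`|x' - x| + `|y' - y|) <= eps / 8 * (2 * l).
      by rewrite ler_pM2l//; move: xx yy; clear; lra.
    by move=> w; split; [exact: le_trans u w|exact: le_trans v w].
  apply: le_trans (_ : eps * (l * l) <= _); last first.
    by rewrite ler_pM2l// square_weight_ge// ltW.
  have mx : x1 <= x1 + l by rewrite lerDl ltW.
  have my : y1 <= y1 + l by rewrite lerDl ltW.
  have xl : x1 + l - x1 = l by clear; ring.
  have yl : y1 + l - y1 = l by clear; ring.
  (* The affine parts contribute - b l^2 and b l^2, which cancel because the coefficient b is common
     to P and Q. *)
  have B1 := @seg_int_bound R _ x1 (x1 + l) (- b * l) (eps / 2 * l) (cPB y1 (y1 + l)) mx.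
  have B2 := @seg_int_bound R _ y1 (y1 + l) (b * l) (eps / 2 * l) (cQB (x1 + l) x1) my.
  have {}B1 : `|seg_int (fun t => P t y1 - P t (y1 + l)) x1 (x1 + l) - - b * l * l| <= eps / 2 * l * l.
    rewrite xl in B1; apply: B1 => t ht.
    have [u _] := key t y1 ht ltac:(by rewrite lexx).
    have [v _] := key t (y1 + l) ht ltac:(by rewrite lexx andbT).
    by move: u v; clear; rewrite !ler_norml; lra.
  have {}B2 : `|seg_int (fun t => Q (x1 + l) t - Q x1 t) y1 (y1 + l) - b * l * l| <= eps / 2 * l * l.
    rewrite yl in B2; apply: B2 => t ht.
    have [_ u] := key x1 t ltac:(by rewrite lexx) ht.
    have [_ v] := key (x1 + l) t ltac:(by rewrite lexx andbT) ht.
    by move: u v; clear; rewrite !ler_norml; lra.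
  by move: B1 B2; rewrite /square_int; clear; rewrite !ler_norml; lra.
have e4 : 0 < eps / 4 by rewrite divr_gt0.
have [d d0 Hd] := hcont x y Dxy xyS _ e4.
exists d => // x1 y1 l hx1 hx2 hy1 hy2 /andP[lp ld] /andP[h1 h2] /andP[h3 h4].
have key x' y' : x1 <= x' <= x1 + l -> y1 <= y' <= y1 + l ->
    `|P x' y' - P x y| <= eps / 4 /\ `|Q x' y' - Q x y| <= eps / 4.
  move=> /andP[k1 k2] /andP[k3 k4]; apply: Hd.
  - by split; [move: k1 k2 hx1 hx2|move: k3 k4 hy1 hy2]; clear; lra.
  - by apply: le_lt_trans ld; move: k1 k2 h1 h2; clear; rewrite ler_norml; lra.
  - by apply: le_lt_trans ld; move: k3 k4 h3 h4; clear; rewrite ler_norml; lra.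
apply: le_trans (_ : eps * l <= _); last first.
  rewrite ler_pM2l//; apply: (square_weight_ge_mem (ltW lp) xyS); by apply/andP.
have mx : x1 <= x1 + l by rewrite lerDl ltW.
have my : y1 <= y1 + l by rewrite lerDl ltW.
have xl : x1 + l - x1 = l by clear; ring.
have yl : y1 + l - y1 = l by clear; ring.
have B1 := @seg_int_bound R _ x1 (x1 + l) 0 (eps / 2) (cPB y1 (y1 + l)) mx.
have B2 := @seg_int_bound R _ y1 (y1 + l) 0 (eps / 2) (cQB (x1 + l) x1) my.
have {}B1 : `|seg_int (fun t => P t y1 - P t (y1 + l)) x1 (x1 + l) - 0 * l| <= eps / 2 * l.
  rewrite xl in B1; apply: B1 => t ht.
  have [u _] := key t y1 ht ltac:(by rewrite lexx).
  have [v _] := key t (y1 + l) ht ltac:(by rewrite lexx andbT).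
  by move: u v; clear; rewrite !ler_norml; lra.
have {}B2 : `|seg_int (fun t => Q (x1 + l) t - Q x1 t) y1 (y1 + l) - 0 * l| <= eps / 2 * l.
  rewrite yl in B2; apply: B2 => t ht.
  have [_ u] := key x1 t ltac:(by rewrite lexx) ht.
  have [_ v] := key (x1 + l) t ltac:(by rewrite lexx andbT) ht.
  by move: u v; clear; rewrite !ler_norml; lra.
by move: B1 B2; rewrite /square_int !mul0r !subr0; clear; rewrite !ler_norml; lra.
Qed.
End Goursat.

(** * Complex differentiability *)

Section Modulus.
Context {R : realType}.
Local Notation C := (R[i]^o).
Implicit Types (z w : C).

(** The norm of [R[i]] has its values in [R[i]]; this is the modulus as an element of R, where real
    linear arithmetic applies. *)
Definition cmod (z : R[i]) : R := Re `|z|.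

Lemma normcmod (z : R[i]) : `|z| = (cmod z)%:C.
Proof. by rewrite /cmod normc_def. Qed.

Lemma cmodE (z : R[i]) : cmod z = Num.sqrt (Re z ^+ 2 + Im z ^+ 2).
Proof. by rewrite /cmod normc_def. Qed.

Lemma cmod_ge0 (z : R[i]) : 0 <= cmod z.
Proof. by rewrite cmodE sqrtr_ge0. Qed.

Lemma cmod0 : cmod 0 = 0. Proof. by rewrite /cmod normr0. Qed.
Lemma cmod1 : cmod 1 = 1. Proof. by rewrite /cmod normr1. Qed.

Lemma cmod_eq0 (z : R[i]) : (cmod z == 0) = (z == 0).
Proof. by rewrite -(inj_eq (@complexI R)) -normcmod normr_eq0. Qed.

Lemma cmod_gt0 (z : R[i]) : (0 < cmod z) = (z != 0).
Proof. by rewrite lt_def cmod_ge0 cmod_eq0 andbT. Qed.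

Lemma cmodM (z w : R[i]) : cmod (z * w) = cmod z * cmod w.
Proof. by apply: (@complexI R); rewrite -normcmod normrM !normcmod rmorphM. Qed.

Lemma cmodV (z : R[i]) : cmod z^-1 = (cmod z)^-1.
Proof. by apply: (@complexI R); rewrite -normcmod normfV normcmod fmorphV. Qed.

Lemma cmodN (z : R[i]) : cmod (- z) = cmod z.
Proof. by rewrite /cmod normrN. Qed.

Lemma cmodB (z w : R[i]) : cmod (z - w) = cmod (w - z).
Proof. by rewrite -cmodN opprB. Qed.

Lemma cmod_conj (z : R[i]) : cmod (z^*)%C = cmod z.
Proof. by rewrite /cmod normcJ. Qed.

Lemma ler_cmodD (z w : R[i]) : cmod (z + w) <= cmod z + cmod w.
Proof. by rewrite -lecR rmorphD -!normcmod ler_normD. Qed.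

Lemma cmod_real (x : R) : cmod x%:C = `|x|.
Proof. by rewrite cmodE /= expr0n/= addr0 sqrtr_sqr. Qed.

Lemma Re_cmod (z : R[i]) : `|Re z| <= cmod z.
Proof. by have := normc_ge_Re z; rewrite normcmod lecR. Qed.

Lemma Im_cmod (z : R[i]) : `|Im z| <= cmod z.
Proof.
rewrite -(@ler_pXn2r _ 2) ?nnegrE ?cmod_ge0//.
by rewrite cmodE sqr_sqrtr ?addr_ge0 ?sqr_ge0// real_normK ?num_real// lerDr sqr_ge0.
Qed.

Lemma cmod_le (z : R[i]) : cmod z <= `|Re z| + `|Im z|.
Proof.
rewrite [z in leLHS]complexE; apply: le_trans (ler_cmodD _ _) _.
by rewrite cmodM !cmod_real [cmod _](_ : _ = 1) ?mul1r// cmodE /= expr0n expr1n add0r sqrtr1.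
Qed.

Lemma nbhs_cmodP (z : C) (A : set C) :
  nbhs z A <-> exists2 r : R, 0 < r & forall w : C, cmod (w - z) < r -> A w.
Proof.
split.
  move=> /nbhs_ballP[e /= e0 H]; exists (Re e).
    by move: e0; rewrite ltcE => /andP[_].
  move=> w wz; apply: H; rewrite /ball/= -normrN opprB normcmod.
  by rewrite ltcE/= wz andbT; move: e0; rewrite ltcE => /andP[].
move=> [r r0 H]; apply/nbhs_ballP; exists r%:C => /=; first by rewrite ltcR.
by move=> w; rewrite /ball/= -normrN opprB normcmod ltcR => /H.
Qed.

Definition ccont (f : C -> C) (z : C) : Prop := forall eps : R, 0 < eps ->
  exists2 d : R, 0 < d & forall w : C, cmod (w - z) < d -> cmod (f w - f z) < eps.

Lemma ccontP (f : C -> C) (z : C) : {for z, continuous f} <-> ccont f z.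
Proof.
split.
  move=> cf eps e0; apply/nbhs_cmodP.
  by apply: (cf [set y | cmod (y - f z) < eps]); apply/nbhs_cmodP; exists eps.
move=> H A /nbhs_cmodP[r r0 HA]; have [d d0 Hd] := H _ r0.
by apply/nbhs_cmodP; exists d => // w /Hd/HA.
Qed.

Lemma ccont_cst (a z : C) : ccont (fun=> a) z.
Proof. by move=> e e0; exists 1 => // w _; rewrite subrr cmod0. Qed.

Lemma ccont_id (z : C) : ccont id z.
Proof. by move=> e e0; exists e. Qed.

Lemma ccontD (f g : C -> C) z : ccont f z -> ccont g z -> ccont (fun w => f w + g w) z.
Proof.
move=> /ccontP cf /ccontP cg; apply/ccontP; exact: (@continuousD _ _ _ f g z cf cg).
Qed.

Lemma ccontN (f : C -> C) z : ccont f z -> ccont (fun w => - f w) z.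
Proof. by move=> /ccontP cf; apply/ccontP; exact: (@continuousN _ _ _ f z cf). Qed.

Lemma ccontM (f g : C -> C) z : ccont f z -> ccont g z -> ccont (fun w => f w * g w) z.
Proof.
move=> /ccontP cf /ccontP cg; apply/ccontP; exact: (@continuousM _ _ f g z cf cg).
Qed.

Lemma ccontV (f : C -> C) z : f z != 0 -> ccont f z -> ccont (fun w => (f w)^-1) z.
Proof.
by move=> fz /ccontP cf; apply/ccontP; exact: (@continuousV _ _ f z fz cf).
Qed.

Lemma ccont_comp (f g : C -> C) z : ccont f z -> ccont g (f z) -> ccont (fun w => g (f w)) z.
Proof.
move=> cf cg e e0; have [d d0 Hd] := cg e e0; have [d' d'0 Hd'] := cf d d0.
by exists d' => // w /Hd'/Hd.
Qed.

Lemma ccont_near (f g : C -> C) z (r : R) : 0 < r ->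
  (forall w, cmod (w - z) < r -> f w = g w) -> ccont f z -> ccont g z.
Proof.
move=> r0 fg cf e e0; have [d d0 Hd] := cf e e0.
exists (Num.min r d); first by rewrite lt_min r0.
move=> w; rewrite lt_min => /andP[wr wd].
by rewrite -!fg ?Hd// subrr cmod0.
Qed.

Lemma open_cmodP (A : set C) : open A <->
  forall z, A z -> exists2 r : R, 0 < r & forall w : C, cmod (w - z) < r -> A w.
Proof.
rewrite openE; split=> H z /H; first by rewrite /interior => /nbhs_cmodP.
by move=> h; apply/nbhs_cmodP.
Qed.

Lemma closure_cmodP (A : set C) (z : C) : closure A z <->
  forall r : R, 0 < r -> exists2 w : C, A w & cmod (w - z) < r.
Proof.
split.
  move=> cA r r0; have [|w [Aw wz]] := cA [set w | cmod (w - z) < r].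
    by apply/nbhs_cmodP; exists r.
  by exists w.
move=> H B /nbhs_cmodP[r r0 HB]; have [w Aw wz] := H r r0.
by exists w; split => //; exact: HB.
Qed.

(* Caratheodory's form of the complex derivative: products, quotients and
   composites reduce to algebra and continuity. *)
Definition cdiff (f : C -> C) (z : C) : Prop :=
  exists q : C -> C, ccont q z /\ forall w, f w = f z + q w * (w - z).

Lemma derivable_cdiff (f : C -> C) (z : C) : derivable f z 1 -> cdiff f z.
Proof.
move=> /cvg_ex[l df]; exists (fun w => if w == z then (l : R[i]) else (f w - f z) / (w - z)).
split; last first.
  move=> w; case: eqP => [->|/eqP wz]; first by rewrite subrr mulr0 addr0.
  by rewrite divfK ?subr_eq0// addrC subrK.
move=> eps e0; rewrite eqxx.
have nl : nbhs (l : C) [set w | cmod (w - l) < eps] by apply/nbhs_cmodP; exists eps.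
have := df _ nl; rewrite nbhs_simpl /= => /nbhs_cmodP[r r0 Hr].
exists r => // w wz /=; case: ifPn => [_|wz0]; first by rewrite subrr cmod0.
have := Hr (w - z); rewrite subr0 subr_eq0 => /(_ wz wz0) /=.
by rewrite [_ *: 1]mulr1 subrK [_ *: _]mulrC.
Qed.

Lemma cdiff_ccont (f : C -> C) z : cdiff f z -> ccont f z.
Proof.
move=> [q [cq fE]].
have -> : f = (fun w => f z + q w * (w - z)) by apply/funext.
apply: ccontD; first exact: ccont_cst.
apply: ccontM => //; apply: ccontD; [exact: ccont_id|exact: ccont_cst].
Qed.

Lemma cdiff_cst (a : C) z : cdiff (fun=> a) z.
Proof.
exists (fun=> 0); split; first exact: ccont_cst.
by move=> w; rewrite mul0r addr0.
Qed.

Lemma cdiff_id z : cdiff id z.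
Proof.
exists (fun=> 1); split; first exact: ccont_cst.
by move=> w; rewrite mul1r addrC subrK.
Qed.

Lemma cdiffD (f g : C -> C) z : cdiff f z -> cdiff g z -> cdiff (fun w => f w + g w) z.
Proof.
move=> [q [cq fE]] [p [cp gE]]; exists (fun w => q w + p w).
split; first exact: ccontD.
by move=> w; rewrite fE gE; ring.
Qed.

Lemma cdiffM (f g : C -> C) z : cdiff f z -> cdiff g z -> cdiff (fun w => f w * g w) z.
Proof.
move=> df dg; have cg := cdiff_ccont dg.
move: df dg => [q [cq fE]] [p [cp gE]].
exists (fun w => q w * g w + f z * p w); split.
  by apply: ccontD; apply: ccontM => //; exact: ccont_cst.
by move=> w; rewrite {1}fE mulrDl {1}gE; ring.
Qed.

Lemma cdiff_comp (f g : C -> C) z : cdiff f z -> cdiff g (f z) -> cdiff (fun w => g (f w)) z.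
Proof.
move=> df; have cf := cdiff_ccont df; move: df => [q [cq fE]] [p [cp gE]].
exists (fun w => p (f w) * q w); split.
  by apply: ccontM => //; exact: (@ccont_comp f p).
move=> w; rewrite {1}gE -mulrA; congr (_ + _ * _).
by rewrite {1}fE addrAC subrr add0r.
Qed.

Lemma cdiff_near (f g : C -> C) z (r : R) : 0 < r ->
  (forall w, cmod (w - z) < r -> f w = g w) -> cdiff f z -> cdiff g z.
Proof.
move=> r0 fg [q [cq fE]]; have fgz : f z = g z by apply: fg; rewrite subrr cmod0.
exists (fun w => if w == z then q z else (g w - g z) / (w - z)); split; last first.
  move=> w; case: eqP => [->|/eqP wz]; first by rewrite subrr mulr0 addr0.
  by rewrite divfK ?subr_eq0// addrC subrK.
apply: (@ccont_near q _ z r) => // w wr.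
have [->//|wz] := eqVneq w z.
by rewrite -fg// -fgz fE addrAC subrr add0r mulfK// subr_eq0.
Qed.

Lemma cdiffV (z : C) : z != 0 -> cdiff (fun w : C => w^-1) z.
Proof.
move=> z0.
have near0 (w : C) : cmod (w - z) < cmod z -> w != 0.
  by apply: contraTneq => ->; rewrite sub0r cmodN ltxx.
exists (fun w => if w == 0 then z^-1 * z^-1 else - (z^-1 * w^-1)); split.
  apply: (@ccont_near (fun w => - (z^-1 * w^-1)) _ z (cmod z)).
  - by rewrite cmod_gt0.
  - by move=> w /near0/negPf ->.
  - by apply: ccontN; apply: ccontM; [exact: ccont_cst|apply: ccontV => //; exact: ccont_id].
move=> w; have [->|w0] := eqVneq w 0; first by rewrite invr0 sub0r; field.
by field; rewrite w0.
Qed.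
End Modulus.

(** * Cauchy estimate on squares *)

Section SquareBound.
Context {R : realType}.
Local Notation C := (R[i]^o).

Lemma ReM (z w : R[i]) : Re (z * w) = Re z * Re w - Im z * Im w.
Proof. by case: z w => [a b] [c d]. Qed.

Lemma ImM (z w : R[i]) : Im (z * w) = Re z * Im w + Im z * Re w.
Proof. by case: z w => [a b] [c d]. Qed.

Lemma ReD (z w : R[i]) : Re (z + w) = Re z + Re w.
Proof. by case: z w => [a b] [c d]. Qed.

Lemma ImD (z w : R[i]) : Im (z + w) = Im z + Im w.
Proof. by case: z w => [a b] [c d]. Qed.

Lemma ReN (z : R[i]) : Re (- z) = - Re z.
Proof. by case: z. Qed.

Lemma ImN (z : R[i]) : Im (- z) = - Im z.
Proof. by case: z. Qed.

Lemma ReV (z : R[i]) : Re z^-1 = Re z / (Re z ^+ 2 + Im z ^+ 2).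
Proof. by case: z. Qed.

Lemma ImV (z : R[i]) : Im z^-1 = - (Im z / (Re z ^+ 2 + Im z ^+ 2)).
Proof. by case: z. Qed.

(** Projection onto the interval [c - r, c + r]. Composed with it, a function known on a square or a
    path known on an interval becomes defined and continuous everywhere. *)
Definition clamp (c r t : R) : R := Num.max (c - r) (Num.min (c + r) t).

Lemma clamp_itv (c r t : R) : 0 < r -> c - r <= clamp c r t <= c + r.
Proof. by move=> r0; rewrite /clamp /Num.max /Num.min; case: ifP; case: ifP; lra. Qed.

Lemma clamp_id (c r t : R) : c - r <= t <= c + r -> clamp c r t = t.
Proof. by rewrite /clamp /Num.max /Num.min; case: ifP; case: ifP; lra. Qed.

Lemma clamp_lip (c r s t : R) : 0 < r -> `|clamp c r s - clamp c r t| <= `|s - t|.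
Proof.
move=> r0; have [st|/ltW ts] := leP s t.
  rewrite [leRHS]ler0_norm ?subr_le0// ler_norml.
  by rewrite /clamp /Num.max /Num.min; do ?case: ifP; lra.
rewrite [leRHS]ger0_norm ?subr_ge0// ler_norml.
by rewrite /clamp /Num.max /Num.min; do ?case: ifP; lra.
Qed.

Lemma seg_int_le (g : R -> R) (a b k : R) : continuous g -> a <= b ->
  (forall x, a <= x <= b -> g x <= k) -> seg_int g a b <= k * (b - a).
Proof.
move=> cg ab gk.
have cc : continuous (cst k : R -> R) by move=> x; exact: cst_continuous.
have := @seg_int_bound R (cst k) a b k 0 cc ab; rewrite mul0r => h0.
have : `|seg_int (cst k) a b - k * (b - a)| <= 0 by apply: h0 => x _; rewrite subrr normr0.
rewrite normr_le0 subr_eq0 => /eqP <-; rewrite /seg_int le_Rintegral//.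
- exact: seg_integrable.
- exact: seg_integrable.
Qed.

Definition in_square (w : C) (r : R) (z : C) := `|Re (z - w)| <= r /\ `|Im (z - w)| <= r.
Definition on_square (w : C) (r : R) (z : C) :=
  in_square w r z /\ (`|Re (z - w)| = r \/ `|Im (z - w)| = r).

(** Goursat's theorem applied to H = (F - F w) / (z - w) equates the integrals of F / (z - w) and R0
    / (z - w) around the square. In imaginary parts the first is at most 8r * M/r. On each side r /
    (s^2 + r^2) >= 1/(2r), so the second is at least 4 R0; this replaces the exact value 2 pi R0. At
    w and on [S] the quotient H is merely continuous. *)
Lemma square_bound_real (F : C -> C) (w : C) (r M R0 : R) (S : seq C) :
  0 < r -> F w = R0%:C -> 0 <= R0 ->
  (forall z, in_square w r z -> ccont F z) ->
  (forall z, in_square w r z -> z \notin S -> cdiff F z) -> w \notin S ->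
  (forall z, on_square w r z -> cmod (F z) <= M) -> R0 <= 2 * M.
Proof.
move=> r0 Fw R00 cF dF wS bF.
have sqw : in_square w r w by split; rewrite subrr /= normr0 ltW.
have [H [cHw FE]] := dF w sqw wS.
have HE z : z != w -> H z = (F z - F w) / (z - w).
  by move=> zw; rewrite FE addrAC subrr add0r mulfK// subr_eq0.
have nearw (z v : C) : z != w -> cmod (v - z) < cmod (z - w) -> (F v - F w) * (v - w)^-1 = H v.
  move=> zw vz; rewrite HE//; apply: contraTneq vz => ->.
  by rewrite cmodB ltxx.
have cH z : in_square w r z -> ccont H z.
  have [->//|zw] := eqVneq z w => sz.
  apply: (ccont_near _ (fun v => nearw z v zw)); first by rewrite cmod_gt0 subr_eq0.
  apply: ccontM; first by apply: ccontD; [exact: cF|exact: ccont_cst].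
  apply: ccontV; first by rewrite subr_eq0.
  by apply: ccontD; [exact: ccont_id|exact: ccont_cst].
have dH z : in_square w r z -> z \notin S -> z != w -> cdiff H z.
  move=> sz zS zw.
  apply: (cdiff_near _ (fun v => nearw z v zw)); first by rewrite cmod_gt0 subr_eq0.
  apply: cdiffM; first by apply: cdiffD; [exact: dF|exact: cdiff_cst].
  have dw : cdiff (fun v => v - w) z by apply: cdiffD; [exact: cdiff_id|exact: cdiff_cst].
  by apply: (cdiff_comp dw); apply: cdiffV; rewrite subr_eq0.
clear cF dF nearw.
set a := Re w; set b := Im w.
pose pt x y : C := clamp a r x +i* clamp b r y.
have pt_sq x y : in_square w r (pt x y).
  have /andP[] := clamp_itv a x r0; have /andP[] := clamp_itv b y r0.
  rewrite /in_square ReD ImD ReN ImN /= -/a -/b !ler_norml.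
  by clear; move=> *; split; apply/andP; split; lra.
have pt_lip x y x' y' : cmod (pt x' y' - pt x y) <= `|x' - x| + `|y' - y|.
  apply: le_trans (cmod_le _) _; rewrite ReD ImD ReN ImN /=.
  by apply: lerD; apply: clamp_lip.
(* With H = Q + iP, the form P dx + Q dy is the imaginary part of H dz. *)
pose P x y := Im (H (pt x y)); pose Q x y := Re (H (pt x y)).
have cP y : continuous (P^~ y).
  move=> x; apply/cvgrPdist_lt => e e0.
  have [d d0 Hd] := cH _ (pt_sq x y) e e0.
  apply: filterS (nbhsx_ballx x d d0) => t; rewrite /ball/= distrC => xt.
  rewrite distrC /P -ImN -ImD; apply: le_lt_trans (Im_cmod _) _.
  apply: Hd; apply: le_lt_trans (pt_lip _ _ _ _) _.
  by rewrite subrr normr0 addr0.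
have cQ x : continuous (Q x).
  move=> y; apply/cvgrPdist_lt => e e0.
  have [d d0 Hd] := cH _ (pt_sq x y) e e0.
  apply: filterS (nbhsx_ballx y d d0) => t; rewrite /ball/= distrC => xt.
  rewrite distrC /Q -ReN -ReD; apply: le_lt_trans (Re_cmod _) _.
  apply: Hd; apply: le_lt_trans (pt_lip _ _ _ _) _.
  by rewrite subrr normr0 add0r.
have l0 : 0 < 2 * r by rewrite mulr_gt0.
have ptE x y : a - r <= x <= a - r + 2 * r /\ b - r <= y <= b - r + 2 * r -> pt x y = x +i* y.
  by move=> [hx hy]; rewrite /pt !clamp_id//; [move: hy|move: hx]; clear; lra.
have G0 : square_int P Q (a - r) (b - r) (2 * r) = 0.
  apply: (@goursat R P Q [seq (Re s, Im s) | s <- w :: S] (a - r) (b - r) (2 * r)) => //.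
  - move=> x y Dxy; rewrite (_ : (x, y) = (Re (x +i* y), Im (x +i* y)))//.
    rewrite mem_map; last by case=> ? ? [? ?] [] /= -> ->.
    rewrite inE negb_or -(ptE _ _ Dxy) => /andP[nw nS].
    have [q [cq HHE]] := dH _ (pt_sq x y) nS nw.
    exists (Im (q (pt x y))), (Re (q (pt x y))), (- Im (q (pt x y))) => eps eps0.
    have [d d0 Hd] := cq eps eps0.
    exists (d / 2); first by rewrite divr_gt0.
    move=> x' y' Dxy' hx hy.
    have key : cmod ((q (pt x' y') - q (pt x y)) * (pt x' y' - pt x y)) <= eps * (`|x' - x| + `|y' - y|).
      rewrite cmodM; apply: ler_pM; rewrite ?cmod_ge0//.
      by apply/ltW/Hd; apply: le_lt_trans (pt_lip _ _ _ _) _; move: hx hy; clear; lra.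
    have HE' : (q (pt x' y') - q (pt x y)) * (pt x' y' - pt x y) =
       H (pt x' y') - H (pt x y) - q (pt x y) * (pt x' y' - pt x y).
      by rewrite (HHE (pt x' y')); ring.
    have dpt : pt x' y' - pt x y = (x' - x) +i* (y' - y) by rewrite !ptE.
    split; [apply: le_trans key; apply: le_trans (Im_cmod _)|
            apply: le_trans key; apply: le_trans (Re_cmod _)].
      rewrite HE' dpt ImD ImD !ImN ImM /=; rewrite /P.
      rewrite [X in `|X| <= _](_ : _ = Im (H (pt x' y')) - Im (H (pt x y)) -
        (Re (q (pt x y)) * (y' - y) + Im (q (pt x y)) * (x' - x)))//; by clear; ring.
    rewrite HE' dpt ReD ReD !ReN ReM /=; rewrite /Q.
    rewrite [X in `|X| <= _](_ : _ = Re (H (pt x' y')) - Re (H (pt x y)) -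
        (Re (q (pt x y)) * (x' - x) - Im (q (pt x y)) * (y' - y)))//; by clear; ring.
  - move=> x y Dxy _ eps eps0; have [d d0 Hd] := cH _ (pt_sq x y) eps eps0.
    exists (d / 2); first by rewrite divr_gt0.
    move=> x' y' _ hx hy.
    have key : cmod (H (pt x' y') - H (pt x y)) <= eps.
      by apply/ltW/Hd; apply: le_lt_trans (pt_lip _ _ _ _) _; move: hx hy; clear; lra.
    split; apply: le_trans key; first by rewrite /P -ImN -ImD; exact: Im_cmod.
    by rewrite /Q -ReN -ReD; exact: Re_cmod.
have lo_r x : a - r <= x <= a - r + 2 * r -> `|x - a| <= r by rewrite ler_norml; lra.
have lo_i x : b - r <= x <= b - r + 2 * r -> `|x - b| <= r by rewrite ler_norml; lra.
have end1 : a - r <= a - r <= a - r + 2 * r by move: r0; clear; lra.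
have end2 : a - r <= a + r <= a - r + 2 * r by move: r0; clear; lra.
have end3 : b - r <= b - r <= b - r + 2 * r by move: r0; clear; lra.
have end4 : b - r <= b + r <= b - r + 2 * r by move: r0; clear; lra.
have ME : a - r + 2 * r = a + r by clear; ring.
have ME' : b - r + 2 * r = b + r by clear; ring.
set K := M / r - R0 / (2 * r).
have invb s t : `|s| <= r -> t = r -> r / (s ^+ 2 + t ^+ 2) >= (2 * r)^-1.
  move=> sr ->; have s2 : s ^+ 2 <= r ^+ 2.
    by rewrite -(real_normK (num_real s)) ler_pXn2r// nnegrE// ltW.
  rewrite ler_pdivlMr; last by apply: ltr_wpDl; rewrite ?sqr_ge0// exprn_gt0.
  rewrite ler_pdivrMl//; move: s2; clear; rewrite !expr2; lra.
have FB z : on_square w r z -> z != w /\ cmod (F z / (z - w)) <= M / r.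
  move=> oz; have rz : r <= cmod (z - w).
    by case: oz => _ [<-|<-]; [exact: Re_cmod|exact: Im_cmod].
  have zw : 0 < cmod (z - w) by exact: lt_le_trans rz.
  split; first by move: zw; rewrite cmod_gt0 subr_eq0.
  rewrite cmodM cmodV; apply: ler_pM; rewrite ?cmod_ge0 ?invr_ge0 ?cmod_ge0//.
    exact: bF.
  by rewrite lef_pV2 ?posrE.
have HS z : z != w -> H z = F z / (z - w) - R0%:C * (z - w)^-1.
  by move=> zw; rewrite HE// Fw mulrBl.
have side1 x : a - r <= x <= a + r -> P x (b - r) - P x (b + r) <= 2 * K.
  rewrite -ME => Hx; rewrite /P !ptE//.
  have o1 : on_square w r (x +i* (b - r)).
    rewrite /on_square /in_square !ReD !ImD !ReN !ImN /= -/a -/b addrAC subrr add0r normrN (gtr0_norm r0).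
    by split; [split => //; exact: lo_r|right].
  have o2 : on_square w r (x +i* (b + r)).
    rewrite /on_square /in_square !ReD !ImD !ReN !ImN /= -/a -/b (addrAC b) subrr add0r (gtr0_norm r0).
    by split; [split => //; exact: lo_r|right].
  have [n1 B1] := FB _ o1; have [n2 B2] := FB _ o2.
  have {}B1 := le_trans (ler_norm _) (le_trans (Im_cmod _) B1).
  have {}B2 := le_trans (ler_norm _) (le_trans (Im_cmod (- _)) (eq_ind_r (fun u => u <= _) B2 (cmodN _))).
  rewrite (HS _ n1) (HS _ n2); move: (F _ / _) (F _ / _) B1 B2 => X Y B1 B2.
  rewrite !ImD !ImN !ImM !ImV !ReD !ImD !ReN !ImN /= -/a -/b.
  rewrite (addrAC b (-r)) (addrAC b r) subrr !add0r !mul0r !addr0 sqrrN.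
  have iv := invb (x - a) r (lo_r _ Hx) erefl.
  have : R0 * (2 * r)^-1 <= R0 * (r / ((x - a) ^+ 2 + r ^+ 2)) by exact: ler_wpM2l.
  move: B1 B2; rewrite /K ImN mulNr; clear; lra.
have side2 y : b - r <= y <= b + r -> Q (a + r) y - Q (a - r) y <= 2 * K.
  rewrite -ME' => Hy; rewrite /Q !ptE//.
  have o1 : on_square w r ((a - r) +i* y).
    rewrite /on_square /in_square !ReD !ImD !ReN !ImN /= -/a -/b (addrAC a) subrr add0r normrN (gtr0_norm r0).
    by split; [split => //; exact: lo_i|left].
  have o2 : on_square w r ((a + r) +i* y).
    rewrite /on_square /in_square !ReD !ImD !ReN !ImN /= -/a -/b (addrAC a) subrr add0r (gtr0_norm r0).
    by split; [split => //; exact: lo_i|left].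
  have [n1 B1] := FB _ o1; have [n2 B2] := FB _ o2.
  have {}B1 := le_trans (ler_norm _) (le_trans (Re_cmod (- _)) (eq_ind_r (fun u => u <= _) B1 (cmodN _))).
  have {}B2 := le_trans (ler_norm _) (le_trans (Re_cmod _) B2).
  rewrite (HS _ n1) (HS _ n2); move: (F _ / _) (F _ / _) B1 B2 => X Y B1 B2.
  rewrite !ReD !ReN !ReM !ReV !ReD !ImD !ReN !ImN /= -/a -/b.
  rewrite (addrAC a (-r)) (addrAC a r) subrr !add0r !mul0r !subr0 sqrrN.
  have iv := invb (y - b) r (lo_i _ Hy) erefl; rewrite addrC in iv.
  have : R0 * (2 * r)^-1 <= R0 * (r / (r ^+ 2 + (y - b) ^+ 2)) by exact: ler_wpM2l.
  move: B1 B2; rewrite /K ReN mulNr; clear; lra.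
move: G0; rewrite /square_int ME ME' => G0.
have I1 := @seg_int_le (fun t => P t (b - r) - P t (b + r)) (a - r) (a + r) (2 * K) _ _ side1.
have I2 := @seg_int_le (fun t => Q (a + r) t - Q (a - r) t) (b - r) (b + r) (2 * K) _ _ side2.
have cPB : continuous (fun t => P t (b - r) - P t (b + r)).
  by move=> x; exact: (@continuousB _ _ _ (P^~ (b - r)) (P^~ (b + r)) x (cP _ x) (cP _ x)).
have cQB : continuous (fun t => Q (a + r) t - Q (a - r) t).
  by move=> x; exact: (@continuousB _ _ _ (Q (a + r)) (Q (a - r)) x (cQ _ x) (cQ _ x)).
have {}I1 := I1 cPB ltac:(move: r0; clear; lra).
have {}I2 := I2 cQB ltac:(move: r0; clear; lra).
have KE : 2 * K * (a + r - (a - r)) = 4 * M - 2 * R0.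
  rewrite /K; field; rewrite gt_eqF//.
have KE' : 2 * K * (b + r - (b - r)) = 4 * M - 2 * R0.
  rewrite /K; field; rewrite gt_eqF//.
move: I1 I2; rewrite KE KE'; move: G0; clear; lra.
Qed.

(** A factor of modulus 1 makes F w real and nonnegative. The 2 in place of the sharp constant 1 is
    harmless: each use below has a geometric factor or a margin of 3 against it. *)
Lemma square_bound (F : C -> C) (w : C) (r M : R) (S : seq C) : 0 < r ->
  (forall z, in_square w r z -> ccont F z) ->
  (forall z, in_square w r z -> z \notin S -> cdiff F z) -> w \notin S ->
  (forall z, on_square w r z -> cmod (F z) <= M) -> cmod (F w) <= 2 * M.
Proof.
move=> r0 cF dF wS bF.
(* In this case the claim is 0 <= 2 M, and any point of the contour gives the sign of M. *)
have [Fw0|Fw0] := eqVneq (F w) 0.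
  have ow : on_square w r (w + r%:C).
    rewrite /on_square /in_square addrAC subrr add0r /= normr0 (gtr0_norm r0).
    by split; [split => //; exact: ltW|left].
  have := le_trans (cmod_ge0 _) (bF _ ow).
  by rewrite Fw0 cmod0; clear; lra.
have nF : cmod (F w) != 0 by rewrite cmod_eq0.
have nF' : (cmod (F w))%:C != 0 by rewrite -normcmod normr_eq0.
pose u : C := (cmod (F w))%:C / F w.
have u1 : cmod u = 1 by rewrite cmodM cmodV cmod_real ger0_norm ?cmod_ge0// divff.
apply: (@square_bound_real (fun z => u * F z) w r M _ S) => //.
- by rewrite /u divfK.
- exact: cmod_ge0.
- by move=> z sz; apply: ccontM; [exact: ccont_cst|exact: cF].
- by move=> z sz zS; apply: cdiffM; [exact: cdiff_cst|exact: dF].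
- by move=> z oz; rewrite cmodM u1 mul1r; exact: bF.
Qed.
End SquareBound.

(** * Zeros of holomorphic functions *)

Section Compactness.
Context {R : realType}.
Local Notation C := (R[i]^o).

Lemma continuous_complex : continuous (fun p : R * R => (p.1 +i* p.2 : C)).
Proof.
move=> [x y] A /nbhs_cmodP[r r0 HA].
have r2 : 0 < r / 2 by rewrite divr_gt0.
exists (ball x (r / 2), ball y (r / 2)) => /=; first by split; exact: nbhsx_ballx.
move=> [x' y'] [/= hx hy]; apply: HA; apply: le_lt_trans (cmod_le _) _ => /=.
by rewrite [ltRHS](splitr r) distrC (distrC y') ltrD.
Qed.

Lemma compact_square (a b r : R) : compact [set z : C | `|Re z - a| <= r /\ `|Im z - b| <= r].
Proof.
have -> : [set z : C | `|Re z - a| <= r /\ `|Im z - b| <= r] =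
    (fun p : R * R => (p.1 +i* p.2 : C)) @` (`[a - r, a + r] `*` `[b - r, b + r]).
  apply/seteqP; split.
    move=> [x y] /= [hx hy]; exists (x, y) => //=.
    by rewrite !in_itv/= -!ler_distl.
  by move=> _ [[x y] /= + <-] /=; rewrite !in_itv/= -!ler_distl.
apply: continuous_compact; first exact/continuous_subspaceT/continuous_complex.
by apply: compact_setX; exact: segment_compact.
Qed.

Lemma compact_cmod (K : set C) (B : R) : (forall z, closure K z -> K z) ->
  (forall z, K z -> cmod z <= B) -> compact K.
Proof.
move=> cK bK; apply: (subclosed_compact _ (@compact_square 0 0 B)) => //.
by move=> z /bK zB /=; rewrite !subr0; split; apply: le_trans zB; [exact: Re_cmod|exact: Im_cmod].
Qed.

Definition rcont (v : C -> R) (z : C) : Prop := forall eps : R, 0 < eps ->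
  exists2 d : R, 0 < d & forall w : C, cmod (w - z) < d -> `|v w - v z| < eps.

Lemma rcontP (v : C -> R) (z : C) : {for z, continuous v} <-> rcont v z.
Proof.
split.
  move=> cf eps e0; apply/nbhs_cmodP.
  apply: (cf [set y | `|y - v z| < eps]).
  by apply: filterS (nbhsx_ballx (v z) eps e0) => t; rewrite /ball/= distrC.
move=> H A /nbhs_ballP[r /= r0 HA]; have [d d0 Hd] := H _ r0.
apply/nbhs_cmodP; exists d => // w /Hd h; apply: HA.
by rewrite /ball/= distrC.
Qed.

Lemma EVT_max_C (K : set C) (B : R) (v : C -> R) : K !=set0 ->
  (forall z, closure K z -> K z) -> (forall z, K z -> cmod z <= B) ->
  (forall z, K z -> rcont v z) -> exists2 z, K z & forall w, K w -> v w <= v z.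
Proof.
move=> K0 cK bK cv.
have [|z] := compact_EVT_max K0 (compact_cmod cK bK) (f := v).
  by apply: continuous_in_subspaceT => z /set_mem/cv/rcontP.
by rewrite inE => Kz H; exists z => // w Kw; apply: H; rewrite inE.
Qed.

(** Without an accumulation point in K, each point of K is the centre of a disk with no other point
    of Z. Finitely many of these disks cover K, and every point of Z is one of their centres. *)
Lemma finite_or_all (K Z : set C) : compact K -> Z `<=` K ->
  (exists s : seq C, forall z, Z z -> z \in s) \/
  (exists2 z, K z & forall r : R, 0 < r -> exists w, [/\ Z w, w != z & cmod (w - z) < r]).
Proof.
move=> cK ZK.
have [H|H] := pselect (exists2 z, K z & forall r : R, 0 < r -> exists w, [/\ Z w, w != z & cmod (w - z) < r]).
  by right.
left.
have iso (z : C) : exists r : R, K z -> 0 < r /\ forall w, Z w -> w != z -> r <= cmod (w - z).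
  have [Kz|nKz] := pselect (K z); last by exists 1.
  apply/not_existsP => h; apply: H; exists z => // r r0.
  apply/not_existsP => h2; apply: (h r) => _; split => // w Zw wz.
  by rewrite leNgt; apply/negP => wr; apply: (h2 w).
have [r Hr] := choice iso.
move: cK; rewrite compact_cover => /(_ C K (fun z => [set w | cmod (w - z) < r z])).
case.
- move=> z Kz; apply/open_cmodP => w /= wz; exists (r z - cmod (w - z)); first by rewrite subr_gt0.
  move=> v vw; have := ler_cmodD (v - w) (w - z); rewrite addrA subrK; move: vw; clear; lra.
- by move=> z Kz; exists z => //=; rewrite subrr cmod0; have [] := Hr z Kz.
move=> D DK cov; exists (finmap.enum_fset D) => z Zz.
have [w wD /= zw] := cov z (ZK _ Zz).
have Kw : K w by have := DK w wD; rewrite inE.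
have [r0 Hw] := Hr w Kw.
have [-> //|zw'] := eqVneq z w.
by have := Hw z Zz zw'; rewrite leNgt zw.
Qed.
End Compactness.

Section Holomorphic.
Context {R : realType}.
Local Notation C := (R[i]^o).

(** The slope of f at a zero is continuous there, but its differentiability at that zero is not yet
    known. This is the reason for the exceptional points in Goursat's theorem and in
    [square_bound]. *)
Lemma divide_zeros (f : C -> C) (U : set C) (S : seq C) : (forall z, U z -> cdiff f z) ->
  uniq S -> (forall s, s \in S -> U s /\ f s = 0) ->
  exists g : C -> C, [/\ forall z, f z = g z * \prod_(s <- S) (z - s),
    forall z, U z -> ccont g z & forall z, U z -> z \notin S -> cdiff g z].
Proof.
move=> df; elim: S => [_ _|s S IH /= /andP[sS uS] HS].
  exists f; split => [z|z Uz|z Uz _]; first by rewrite big_nil mulr1.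
  - exact/cdiff_ccont/df.
  - exact/df.
have [|g [fg cg dg]] := IH uS; first by move=> t tS; apply: HS; rewrite inE tS orbT.
have [Us fs] := HS s (mem_head _ _).
have gs : g s = 0.
  have := fg s; rewrite fs => /esym/eqP; rewrite mulf_eq0 => /orP[/eqP//|].
  rewrite big_seq prodf_seq_eq0 => /hasP[t tS /andP[_]].
  by rewrite subr_eq0 => /eqP st; move: sS; rewrite st tS.
have [q [cq gq]] := dg s Us sS.
have qE z : z != s -> q z = g z * (z - s)^-1.
  by move=> zs; rewrite gq gs add0r mulfK// subr_eq0.
have nears z : z != s -> forall v, cmod (v - z) < cmod (z - s) -> g v * (v - s)^-1 = q v.
  move=> zs v vz; rewrite qE//; apply: contraTneq vz => ->.
  by rewrite cmodB ltxx.
exists q; split.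
- by move=> z; rewrite big_cons mulrA fg {1}gq gs add0r.
- move=> z Uz; have [->//|zs] := eqVneq z s.
  apply: (ccont_near _ (nears z zs)); first by rewrite cmod_gt0 subr_eq0.
  apply: ccontM; first exact: cg.
  apply: ccontV; first by rewrite subr_eq0.
  by apply: ccontD; [exact: ccont_id|exact: ccont_cst].
- move=> z Uz; rewrite inE negb_or => /andP[zs zS].
  apply: (cdiff_near _ (nears z zs)); first by rewrite cmod_gt0 subr_eq0.
  apply: cdiffM; first exact: dg.
  have dw : cdiff (fun v => v - s) z by apply: cdiffD; [exact: cdiff_id|exact: cdiff_cst].
  by apply: (cdiff_comp dw); apply: cdiffV; rewrite subr_eq0.
Qed.

Lemma many_accumulating (Z : set C) (z0 w : C) (d : R) (n : nat) : 0 < d ->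
  (forall r : R, 0 < r -> exists z, [/\ Z z, z != z0 & cmod (z - z0) < r]) ->
  exists S : seq C, [/\ size S = n, uniq S, w \notin S &
    forall s, s \in S -> Z s /\ cmod (s - z0) < d].
Proof.
move=> d0 acc.
suff [S [sS uS wS HS]] : exists S : seq C, [/\ size S = n, uniq S, w \notin S &
    forall s, s \in S -> [/\ Z s, s != z0 & cmod (s - z0) < d]].
  by exists S; split => // s /HS[].
elim: n => [|n [S [sS uS wS HS]]]; first by exists [::].
have far (S' : seq C) : exists2 e : R, 0 < e & forall s, s \in S' -> s != z0 -> e <= cmod (s - z0).
  elim: S' => [|s S' [e e0 He]]; first by exists 1.
  have [->|sz] := eqVneq s z0.
    by exists e => // t; rewrite inE => /predU1P[->|/He//]; rewrite eqxx.
  exists (Num.min e (cmod (s - z0))); first by rewrite lt_min e0 cmod_gt0 subr_eq0.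
  move=> t; rewrite inE ge_min => /predU1P[->|/He h /h ->//].
  by rewrite lexx orbT.
have [e e0 He] := far (w :: S).
have [|z [Zz zz zd]] := acc (Num.min e d); first by rewrite lt_min e0.
move: zd; rewrite lt_min => /andP[ze zd].
have zn : z \notin w :: S by apply/negP => /He /(_ zz); rewrite leNgt ze.
exists (z :: S); split => /=.
- by rewrite sS.
- by rewrite uS andbT; apply: contra zn => zS; rewrite inE zS orbT.
- by rewrite inE negb_or wS andbT; apply: contra zn => /eqP ->; rewrite inE eqxx.
- by move=> s; rewrite inE => /predU1P[->|/HS].
Qed.

(* After division by n of the zeros, the Cauchy estimate gives
   |f w| <= 2 M / 3^n for w near z0. *)
Lemma isolated_zeros (f : C -> C) (z0 : C) (rho : R) : 0 < rho ->
  (forall z, cmod (z - z0) < rho -> cdiff f z) ->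
  (forall r : R, 0 < r -> exists z, [/\ f z = 0, z != z0 & cmod (z - z0) < r]) ->
  exists2 r : R, 0 < r & forall z, cmod (z - z0) < r -> f z = 0.
Proof.
move=> rho0 df acc.
have z0in : cmod (z0 - z0) < rho by rewrite subrr cmod0.
have [rho1 rho10 bf] := cdiff_ccont (df _ z0in) ltr01.
pose M := cmod (f z0) + 1.
pose rh := Num.min rho rho1.
have rh0 : 0 < rh by rewrite lt_min rho0.
have {}bf z : cmod (z - z0) < rh -> cmod (f z) <= M.
  rewrite lt_min => /andP[_ /bf h]; have := ler_cmodD (f z - f z0) (f z0).
  rewrite subrK /M; move: h; clear; lra.
have {}df z : cmod (z - z0) < rh -> cdiff f z.
  by rewrite lt_min => /andP[/df].
(* The zeros s used and the point w lie within r/8 of z0. So |w - s| <= r/4, whereas |z - s| >= 3r/4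
   on the square of half side r about w: each zero divided out gains a factor 3. *)
pose r := rh / 4; have r0 : 0 < r by rewrite divr_gt0.
have r8 : 0 < r / 8 by rewrite divr_gt0.
exists (r / 8) => // w wd.
have key n : cmod (f w) <= 2 * M * 3^-1 ^+ n.
  have [S [sS uS wS HS]] := many_accumulating w n r8 acc.
  have inU z : cmod (z - z0) < r / 8 -> cmod (z - z0) < rh.
    by move=> h; apply: lt_trans h _; rewrite /r; move: rh0; clear; lra.
  have [g [fg cg dg]] := @divide_zeros f [set z | cmod (z - z0) < rh] S df uS
    (fun s h => conj (inU s (proj2 (HS s h))) (proj1 (HS s h))).
  have sqU z : in_square w r z -> cmod (z - z0) < rh.
    move=> [h1 h2]; have := ler_cmodD (z - w) (w - z0); rewrite addrA subrK.
    by have := cmod_le (z - w); move: h1 h2 wd rh0; rewrite /r; clear; lra.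
  have B := @square_bound R g w r (M / (3 * (r / 4)) ^+ n) S r0
    (fun z h => cg z (sqU z h)) (fun z h => dg z (sqU z h)) wS.
  have {}B : cmod (g w) <= 2 * (M / (3 * (r / 4)) ^+ n).
    apply: B => z oz; have Uz := sqU _ (proj1 oz).
    have pz : (3 * (r / 4)) ^+ n <= cmod (\prod_(s <- S) (z - s)).
      rewrite -sS; have : forall s, s \in S -> 3 * (r / 4) <= cmod (z - s).
        move=> s /HS[_ sd]; have rz : r <= cmod (z - w).
          by case: oz => _ [<-|<-]; [exact: Re_cmod|exact: Im_cmod].
        have := ler_cmodD (z - s) (s - w); rewrite addrA subrK => h.
        have := ler_cmodD (s - z0) (z0 - w); rewrite addrA subrK (cmodB z0) => h2.
        by move: rz h h2 sd wd r0; clear; lra.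
      elim: (S) => [_|s S' IH h]; first by rewrite big_nil expr0 cmod1.
      rewrite big_cons cmodM exprS; apply: ler_pM.
      - by move: r0; clear; lra.
      - by rewrite exprn_ge0//; move: r0; clear; lra.
      - by apply: h; rewrite mem_head.
      - by apply: IH => t tS; apply: h; rewrite inE tS orbT.
    have p0 : 0 < (3 * (r / 4)) ^+ n by rewrite exprn_gt0//; move: r0; clear; lra.
    rewrite ler_pdivlMr//; apply: le_trans (bf _ Uz).
    by rewrite fg cmodM ler_wpM2l// cmod_ge0.
  have pw : cmod (\prod_(s <- S) (w - s)) <= (r / 4) ^+ n.
    rewrite -sS; have : forall s, s \in S -> cmod (w - s) <= r / 4.
      move=> s /HS[_ sd]; have := ler_cmodD (w - z0) (z0 - s); rewrite addrA subrK (cmodB z0) => h2.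
      by move: h2 sd wd; clear; lra.
    elim: (S) => [_|s S' IH h]; first by rewrite big_nil expr0 cmod1.
    rewrite big_cons cmodM exprS; apply: ler_pM; rewrite ?cmod_ge0//.
    - by apply: h; rewrite mem_head.
    - by apply: IH => t tS; apply: h; rewrite inE tS orbT.
  rewrite fg cmodM.
  apply: le_trans (ler_pM (cmod_ge0 _) (cmod_ge0 _) B pw) _.
  have alg (q : R) : q != 0 -> 2 * (M / (3 * q) ^+ n) * q ^+ n = 2 * M * 3^-1 ^+ n.
    move=> q0; rewrite exprMn exprVn; field; rewrite expf_neq0//=.
    by rewrite expf_neq0// pnatr_eq0.
  by rewrite alg// gt_eqF// divr_gt0.
apply/eqP; rewrite -cmod_eq0 eq_le cmod_ge0 andbT; apply/ler_addgt0Pr => e e0; rewrite add0r.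
have M0 : 0 < 2 * M by rewrite /M mulr_gt0// ltr_wpDl// cmod_ge0.
have [n hn] : exists n, 2 * M / e < n%:R.
  by exists (Num.bound (2 * M / e)); apply: archi_boundP; rewrite divr_ge0// ltW.
apply: le_trans (key n) _; rewrite exprVn ler_pdivrMr ?exprn_gt0//.
rewrite -ler_pdivrMl// mulrC; apply: le_trans (ltW hn) _.
by rewrite -natrX ler_nat ltnW// ltn_expl.
Qed.

(** Injectivity keeps |f - f z0| above some m > 0 on a square about z0, and the Cauchy estimate for
    1 / (f - w) shows that no value near f z0 is omitted. *)
Lemma injective_open (f : C -> C) (z0 : C) (rho : R) : 0 < rho ->
  (forall z, cmod (z - z0) < rho -> cdiff f z) ->
  (forall z w, cmod (z - z0) < rho -> cmod (w - z0) < rho -> f z = f w -> z = w) ->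
  exists2 d : R, 0 < d & forall w, cmod (w - f z0) < d ->
    exists2 z, cmod (z - z0) < rho & f z = w.
Proof.
move=> rho0 df fi; pose r := rho / 4; have r0 : 0 < r by rewrite divr_gt0.
have z0in : cmod (z0 - z0) < rho by rewrite subrr cmod0.
have sqU z : in_square z0 r z -> cmod (z - z0) < rho.
  move=> [h1 h2]; have := cmod_le (z - z0); move: h1 h2 rho0; rewrite /r; clear; lra.
have [m m0 Hm] : exists2 m : R, 0 < m & forall z, on_square z0 r z -> m <= cmod (f z - f z0).
  pose K : set C := [set z | r <= cmod (z - z0) <= 2 * r].
  have KU z : K z -> cmod (z - z0) < rho.
    by move=> /andP[_ h]; apply: le_lt_trans h _; rewrite /r; move: rho0; clear; lra.
  have [||||z Kz Hz] := @EVT_max_C R K (cmod z0 + 2 * r) (fun z => - cmod (f z - f z0)).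
  - exists (z0 + r%:C); rewrite /K /= addrAC subrr add0r cmod_real (gtr0_norm r0) lexx /=.
    by rewrite ler_peMl ?ler1n// ltW.
  - move=> z /closure_cmodP cz; apply/andP; split; rewrite leNgt; apply/negP => h.
      have [|w /andP[h1 h2] h3] := cz (r - cmod (z - z0)); first by rewrite subr_gt0.
      have := ler_cmodD (w - z) (z - z0); rewrite addrA subrK; move: h1 h3; clear; lra.
    have [|w /andP[h1 h2] h3] := cz (cmod (z - z0) - 2 * r); first by rewrite subr_gt0.
    have := ler_cmodD (z - w) (w - z0); rewrite addrA subrK (cmodB z w).
    by move: h2 h3; clear; lra.
  - move=> z /andP[_ h]; have := ler_cmodD (z - z0) z0; rewrite subrK.
    by move: h; clear; lra.
  - move=> z /KU sz e e0; have [d d0 Hd] := cdiff_ccont (df z sz) e0.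
    exists d => // w /Hd; apply: le_lt_trans; rewrite opprK addrC.
    rewrite ler_norml; have h1 := ler_cmodD (f w - f z) (f z - f z0).
    have h2 := ler_cmodD (f z - f w) (f w - f z0).
    rewrite addrA subrK in h1; rewrite addrA subrK (cmodB (f z) (f w)) in h2.
    by move: h1 h2; clear; lra.
  exists (cmod (f z - f z0)).
    rewrite cmod_gt0 subr_eq0; apply/eqP => /(fi _ _ (KU _ Kz) z0in) zz.
    by move: Kz; rewrite /K/= zz subrr cmod0 leNgt r0.
  move=> w [[h1 h2] h3]; have := Hz w; rewrite lerN2; apply.
  apply/andP; split; first by case: h3 => <-; [exact: Re_cmod|exact: Im_cmod].
  by apply: le_trans (cmod_le _) _; move: h1 h2; clear; lra.
(* Then |f - w| is at least 3m/4 on the square and less than m/4 at its centre: the ratio 3 exceeds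
   the factor 2 of [square_bound]. *)
exists (m / 4); first by rewrite divr_gt0.
move=> w wd; apply/not_exists2P => H.
have fw z : cmod (z - z0) < rho -> f z - w != 0.
  by move=> zr; rewrite subr_eq0; apply/eqP => fzw; have [] := H z.
have dg z : in_square z0 r z -> cdiff (fun z => (f z - w)^-1) z.
  move=> /sqU zr; have d1 : cdiff (fun z => f z - w) z by apply: cdiffD; [exact: df|exact: cdiff_cst].
  exact: (cdiff_comp d1 (cdiffV (fw z zr))).
(* If w were omitted, 1 / (f - w) would be too large at z0. *)
have B := @square_bound R (fun z => (f z - w)^-1) z0 r (m * 3 / 4)^-1 [::] r0
  (fun z h => cdiff_ccont (dg z h)) (fun z h _ => dg z h) isT.
have {}B : cmod (f z0 - w)^-1 <= 2 * (m * 3 / 4)^-1.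
  apply: B => z oz; rewrite cmodV lef_pV2 ?posrE ?cmod_gt0 ?fw//; last 2 first.
  - exact: sqU (proj1 oz).
  - by rewrite divr_gt0// mulr_gt0.
  have := ler_cmodD (f z - w) (w - f z0); rewrite addrA subrK => h.
  have := Hm z oz; move: h wd; clear; lra.
have c0 : 0 < cmod (f z0 - w) by rewrite cmod_gt0 fw.
move: B; rewrite cmodV -[2 * _]invrK invfM invrK lef_pV2 ?posrE//; last by rewrite mulr_gt0// divr_gt0// mulr_gt0.
by rewrite cmodB; move: wd m0; clear; lra.
Qed.
End Holomorphic.

(** * Analytic curves and lines *)

Section Connected.
Context {R : realType}.
Local Notation C := (R[i]^o).

Lemma connected_propagate (K P : set C) : connected K -> K `&` P !=set0 ->
  (forall z, K z -> P z -> exists2 r : R, 0 < r & forall w, K w -> cmod (w - z) < r -> P w) ->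
  (forall z, K z -> ~ P z -> exists2 r : R, 0 < r & forall w, K w -> cmod (w - z) < r -> ~ P w) ->
  K `<=` P.
Proof.
move=> conK KP0 Pop Pcl.
have op (Q : set C) : open [set w | exists2 r : R, 0 < r & forall v, K v -> cmod (v - w) < r -> Q v].
  apply/open_cmodP => z [r r0 Hr]; exists (r / 2); first by rewrite divr_gt0.
  move=> w wz; exists (r / 2); first by rewrite divr_gt0.
  move=> v Kv vw; apply: Hr => //.
  have := ler_cmodD (v - w) (w - z); rewrite addrA subrK; move: vw wz; clear; lra.
suff <- : K `&` P = K by move=> z [].
apply: conK => //.
  exists [set w | exists2 r : R, 0 < r & forall v, K v -> cmod (v - w) < r -> P v]; first exact: op.
  apply/seteqP; split=> z [Kz Pz]; split=> //; first exact: Pop.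
  by case: Pz => r r0; apply=> //; rewrite subrr cmod0.
exists (~` [set w | exists2 r : R, 0 < r & forall v, K v -> cmod (v - w) < r -> ~ P v]).
  by apply: open_closedC; exact: op.
apply/seteqP; split=> z [Kz Pz]; split=> //=.
  by move=> [r r0 /(_ z Kz)]; apply=> //; rewrite subrr cmod0.
by apply: contrapT => /(Pcl z Kz).
Qed.

Definition cis (t : R) : C := cos t +i* sin t.

Lemma cmod_cis t : cmod (cis t) = 1.
Proof. by rewrite cmodE /= cos2Dsin2 sqrtr1. Qed.

Lemma cis_surj (z : C) : cmod z = 1 -> exists t, z = cis t.
Proof.
case: z => x y z1; have x1 : -1 <= x <= 1.
  by rewrite -ler_norml -z1; exact: (Re_cmod (x +i* y)).
have xy : x ^+ 2 + y ^+ 2 = 1.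
  by move: z1 => /(congr1 (fun t => t ^+ 2)); rewrite cmodE /= expr1n sqr_sqrtr// addr_ge0// sqr_ge0.
have [_ ca] := acos_def x1; have sa := sin_acos x1.
have y2 : Num.sqrt (1 - x ^+ 2) = `|y| by rewrite -sqrtr_sqr -xy addrAC subrr add0r.
rewrite y2 in sa; have [y0|y0] := leP 0 y.
  by exists (acos x); rewrite /cis ca sa ger0_norm.
by exists (- acos x); rewrite /cis cosN sinN ca sa ltr0_norm// opprK.
Qed.

Lemma connected_circle : connected [set z : C | cmod z = 1].
Proof.
have -> : [set z : C | cmod z = 1] = cis @` setT.
  apply/seteqP; split=> z /=; first by move=> /cis_surj[t ->]; exists t.
  by move=> [t _ <-]; exact: cmod_cis.
apply: connected_continuous_connected; first by apply/connected_intervalP.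
apply: continuous_subspaceT => t A /nbhs_cmodP[r r0 HA].
have r2 : 0 < r / 2 by rewrite divr_gt0.
have cc : nbhs (cos t) (ball (cos t) (r / 2)) by exact: nbhsx_ballx.
have cs : nbhs (sin t) (ball (sin t) (r / 2)) by exact: nbhsx_ballx.
have hc : \forall s \near t, ball (cos t) (r / 2) (cos s) := continuous_cos cc.
have hs : \forall s \near t, ball (sin t) (r / 2) (sin s) := continuous_sin cs.
apply: filterS2 hc hs => s h1 h2; apply: HA; apply: le_lt_trans (cmod_le _) _ => /=.
by rewrite [ltRHS](splitr r) distrC (distrC (sin s)) ltrD.
Qed.

Lemma ccont_conj (z : C) : ccont (fun w => (w^*)%C) z.
Proof.
by move=> e e0; exists e => // w; rewrite -(rmorphB (@conjc R)) cmod_conj.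
Qed.

(** Schwarz reflection in the real axis; the slope is reflected as well. *)
Lemma cdiff_conj (h : C -> C) (z : C) : cdiff h (z^*)%C -> cdiff (fun w => ((h (w^*)%C)^*)%C) z.
Proof.
move=> [q [cq hE]]; exists (fun w => ((q (w^*)%C)^*)%C); split.
  apply: (@ccont_comp _ (fun w => q (w^*)%C) (fun w => (w^*)%C)); last exact: ccont_conj.
  by apply: (@ccont_comp _ (fun w => (w^*)%C) q); first exact: ccont_conj.
by move=> w; rewrite hE (rmorphD (@conjc R)) (rmorphM (@conjc R)) (rmorphB (@conjc R)) /= !conjcK.
Qed.

Lemma conj_inv_circle (z : C) : cmod z = 1 -> ((z^-1)^*)%C = z.
Proof.
move=> z1; have z0 : z != 0 by rewrite -cmod_gt0 z1.
have zz : z * (z^*)%C = 1 by rewrite -sqr_normc normcmod z1 expr1n.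
apply: (mulfI (_ : (z^*)%C != 0)); first by rewrite conjc_eq0.
by rewrite -(rmorphM (@conjc R)) mulfV// (rmorph1 (@conjc R)) mulrC zz.
Qed.

(** The equation of the line, read on the circle, becomes the vanishing of a holomorphic function.
    If it has infinitely many zeros on the compact circle, they accumulate; the function then
    vanishes near a point of the circle, and the set of such points is both open and closed in the
    circle. *)
Lemma curve_meets_line (V : set C) (phi : C -> C) (al : C) (c : R) :
  open V -> [set z | cmod z = 1] `<=` V -> (forall z, V z -> cdiff phi z) ->
  (exists s : seq C, forall z, cmod z = 1 -> Re (al * phi z) = c -> z \in s) \/
  (forall z, cmod z = 1 -> Re (al * phi z) = c).
Proof.
move=> oV circV dphi.
(* On the unit circle 1 / conj z = z, so that G = 2 (Re (al phi) - c); and G is holomorphic. *)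
pose psi z := al * phi z - c%:C.
pose G z := psi z + ((psi (((z^-1)^*)%C))^*)%C.
have dpsi z : V z -> cdiff psi z.
  move=> Vz; apply: cdiffD; last exact: cdiff_cst.
  by apply: cdiffM; [exact: cdiff_cst|exact: dphi].
have G0 z : cmod z = 1 -> (Re (al * phi z) = c <-> G z = 0).
  move=> z1; rewrite /G conj_inv_circle// addcJ ReD ReN /=; split=> [->|/eqP].
    by rewrite subrr mulr0.
  by rewrite mulf_eq0 pnatr_eq0 /= => /eqP[/eqP]; rewrite subr_eq0 => /eqP.
have dG z : cmod z = 1 -> exists2 rho : R, 0 < rho & forall w, cmod (w - z) < rho -> cdiff G w.
  move=> z1; have z0 : z != 0 by rewrite -cmod_gt0 z1.
  have Vz := circV z z1.
  have [r1 r10 H1] := (open_cmodP V).1 oV z Vz.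
  have ci : ccont (fun w => ((w^-1)^*)%C) z.
    apply: (@ccont_comp _ (fun w : C => w^-1) (fun w => (w^*)%C)); last exact: ccont_conj.
    by apply: ccontV => //; exact: ccont_id.
  have [r2 r20 H2] := ci _ r10.
  exists (Num.min 1 (Num.min r1 r2)); first by rewrite !lt_min r10 r20 ltr01.
  move=> w; rewrite !lt_min => /and3P[w1 w2 w3].
  have w0 : w != 0 by apply: contraTneq w1 => ->; rewrite sub0r cmodN z1 ltxx.
  apply: cdiffD; first by apply/dpsi/H1.
  apply: (@cdiff_comp _ (fun w : C => w^-1) (fun v => ((psi (v^*)%C)^*)%C)); first exact: cdiffV.
  by apply/cdiff_conj/dpsi/H1; have := H2 w w3; rewrite (conj_inv_circle z1).
pose Z := [set z : C | cmod z = 1 /\ G z = 0].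
have cpt : compact [set z : C | cmod z = 1].
  apply: (@compact_cmod R _ 1) => [z|z /= ->//].
  move=> /closure_cmodP cz; apply/eqP; rewrite /= eq_le; apply/andP; split; apply/ler_addgt0Pr => e e0.
    have [w /= w1 wz] := cz e e0; have := ler_cmodD (z - w) w; rewrite subrK cmodB w1.
    by move: wz; clear; lra.
  have [w /= w1 wz] := cz e e0; have := ler_cmodD (w - z) z; rewrite subrK w1.
  by move: wz; clear; lra.
have [|[s Hs]|[z0 /= z01 acc]] := @finite_or_all R _ Z cpt; first by move=> z [].
  by left; exists s => z z1 /(G0 z z1).1 Gz; exact: Hs.
right; pose P := [set z : C | exists2 r : R, 0 < r & forall w, cmod (w - z) < r -> G w = 0].
suff KP : [set z : C | cmod z = 1] `<=` P.
  move=> z z1; apply/(G0 z z1).2; have [r r0 Hr] := KP z z1.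
  by apply: Hr; rewrite subrr cmod0.
have propag z : cmod z = 1 -> (forall r : R, 0 < r -> exists w, [/\ G w = 0, w != z & cmod (w - z) < r]) -> P z.
  by move=> z1 h; have [rho rho0 dg] := dG z z1; exact: (isolated_zeros rho0 dg h).
apply: connected_propagate.
- exact: connected_circle.
- exists z0; split=> //; apply: propag => // r r0.
  by have [w [[_ Gw] wz wr]] := acc r r0; exists w.
- move=> z z1 [r r0 Hr]; exists (r / 2); first by rewrite divr_gt0.
  move=> w _ wz; exists (r / 2); first by rewrite divr_gt0.
  move=> v vw; apply: Hr.
  have := ler_cmodD (v - w) (w - z); rewrite addrA subrK; move: vw wz; clear; lra.
move=> z z1 nPz; apply: contrapT => H; apply: nPz; apply: propag => // r r0.
apply: contrapT => H2; apply: H; exists r => // w w1 wz [d d0 Hd].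
have Gw := Hd w; rewrite subrr cmod0 in Gw.
have [wz0|wz0] := eqVneq w z; last by apply: H2; exists w; split=> //; exact: Gw.
rewrite wz0 in Hd wz.
(* If the point near which [G] vanishes is z itself, a small translate of z is a zero distinct from
   z. *)
apply: H2; exists (z + (Num.min d r / 2)%:C).
have m0 : 0 < Num.min d r / 2 by rewrite divr_gt0// lt_min d0.
have md : Num.min d r / 2 < Num.min d r by move: m0; clear; lra.
move: (md); rewrite lt_min => /andP[md1 md2].
have E : cmod (z + (Num.min d r / 2)%:C - z) = Num.min d r / 2.
  by rewrite addrAC subrr add0r cmod_real gtr0_norm.
split; [by apply: Hd; rewrite E| |by rewrite E].
by rewrite -subr_eq0 -cmod_gt0 E.
Qed.
End Connected.

(** * The maximum principle *)

Section Derivatives.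
Context {R : realType}.
Implicit Types (f g : R -> R).

Definition der f (x a : R) : Prop := is_derive x (1 : R) f a.

Lemma der_eq f x a b : der f x a -> a = b -> der f x b.
Proof. by move=> h <-. Qed.

Lemma der_cst (c x : R) : der (fun=> c) x 0.
Proof. exact: is_derive_cst. Qed.

Lemma der_id (x : R) : der (fun t => t) x 1.
Proof. exact: is_derive_id. Qed.

Lemma derD f g x a b : der f x a -> der g x b -> der (fun t => f t + g t) x (a + b).
Proof. exact: is_deriveD. Qed.

Lemma derM f g x a b : der f x a -> der g x b ->
  der (fun t => f t * g t) x (a * g x + f x * b).
Proof.
move=> df dg; apply: (der_eq (@is_deriveM R R f g x 1 a b df dg)).
by rewrite addrC /GRing.scale/= (mulrC (g x)).
Qed.

Lemma derN f x a : der f x a -> der (fun t => - f t) x (- a).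
Proof. exact: is_deriveN. Qed.

Lemma der_comp f g x a b : der f (g x) a -> der g x b -> der (fun t => f (g t)) x (a * b).
Proof. exact: is_derive1_comp. Qed.

Lemma derV x : x != 0 -> der (fun t => t^-1) x (- (x^-1 * x^-1)).
Proof.
move=> x0; apply: (der_eq (@is_deriveV R id x 1 1 x0 (is_derive_id _ _))).
by rewrite /GRing.scale/= mulr1 expr2 invfM.
Qed.

Lemma der_continuous f x a : der f x a -> {for x, continuous f}.
Proof. by move=> [df _]; apply/differentiable_continuous/derivable1_diffP. Qed.

Lemma der_cont f x a (e : R) : der f x a -> 0 < e ->
  exists2 d : R, 0 < d & forall t, `|t - x| < d -> `|f t - f x| < e.
Proof.
move=> /der_continuous cf e0.
have /nbhs_ballP[d /= d0 Hd] := cf _ (nbhsx_ballx (f x) e e0).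
by exists d => // t tx; rewrite distrC; apply: Hd; rewrite /ball/= distrC.
Qed.

(* [d2 f x a b]: near x, f is differentiable; f' x = a, and f'' x = b. *)
Definition d2 f (x a b : R) : Prop := exists f' : R -> R,
  [/\ exists2 d : R, 0 < d & forall t, `|t - x| < d -> der f t (f' t),
      f' x = a & der f' x b].

Lemma d2_eq f x a b c d : d2 f x a b -> a = c -> b = d -> d2 f x c d.
Proof. by move=> h <- <-. Qed.

Lemma d2_cst (c x : R) : d2 (fun=> c) x 0 0.
Proof.
by exists (fun=> 0); split; [exists 1 => // t _; exact: der_cst| |exact: der_cst].
Qed.

Lemma d2_id (x : R) : d2 (fun t => t) x 1 0.
Proof.
by exists (fun=> 1); split; [exists 1 => // t _; exact: der_id| |exact: der_cst].
Qed.

Lemma d2D f g x a b c d : d2 f x a b -> d2 g x c d ->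
  d2 (fun t => f t + g t) x (a + c) (b + d).
Proof.
move=> [f' [[r r0 Hr] <- df]] [g' [[s s0 Hs] <- dg]].
exists (fun t => f' t + g' t); split => //; last exact: derD.
exists (Num.min r s); first by rewrite lt_min r0.
by move=> t; rewrite lt_min => /andP[tr ts]; apply: derD; [exact: Hr|exact: Hs].
Qed.

Lemma d2M f g x a b c d : d2 f x a b -> d2 g x c d ->
  d2 (fun t => f t * g t) x (a * g x + f x * c) (b * g x + 2 * (a * c) + f x * d).
Proof.
move=> [f' [[r r0 Hr] <- df]] [g' [[s s0 Hs] <- dg]].
exists (fun t => f' t * g t + f t * g' t); split => //.
  exists (Num.min r s); first by rewrite lt_min r0.
  by move=> t; rewrite lt_min => /andP[tr ts]; apply: derM; [exact: Hr|exact: Hs].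
have dfx : der f x (f' x) by apply: Hr; rewrite subrr normr0.
have dgx : der g x (g' x) by apply: Hs; rewrite subrr normr0.
by apply: (der_eq (derD (derM df dgx) (derM dfx dg))); ring.
Qed.

Lemma d2_comp f f' g x b c d (r : R) : 0 < r ->
  (forall y, `|y - g x| < r -> der f y (f' y)) -> der f' (g x) b -> d2 g x c d ->
  d2 (fun t => f (g t)) x (f' (g x) * c) (b * c ^+ 2 + f' (g x) * d).
Proof.
move=> r0 Hf df' [g' [[s s0 Hs] <- dg']].
have dgx : der g x (g' x) by apply: Hs; rewrite subrr normr0.
have [e e0 He] := der_cont dgx r0.
exists (fun t => f' (g t) * g' t); split => //.
  exists (Num.min e s); first by rewrite lt_min e0.
  by move=> t; rewrite lt_min => /andP[te ts]; apply: der_comp; [exact/Hf/He|exact: Hs].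
by apply: (der_eq (derM (der_comp df' dgx) dg')); ring.
Qed.

Lemma d2Z f x a b (k : R) : d2 f x a b -> d2 (fun t => k * f t) x (k * a) (k * b).
Proof. by move=> h; apply: (d2_eq (d2M (d2_cst k x) h)); ring. Qed.

Lemma d2N f x a b : d2 f x a b -> d2 (fun t => - f t) x (- a) (- b).
Proof.
move=> h; have -> : (fun t => - f t) = (fun t => -1 * f t) by apply/funext => t; rewrite mulN1r.
by apply: (d2_eq (d2Z (-1) h)); rewrite mulN1r.
Qed.

Lemma d2_affine (p q x : R) : d2 (fun t => p + t * q) x q 0.
Proof. by apply: (d2_eq (d2D (d2_cst p x) (d2M (d2_id x) (d2_cst q x)))); ring. Qed.

Lemma d2_ln f x a b : 0 < f x -> d2 f x a b ->
  d2 (fun t => ln (f t)) x ((f x)^-1 * a) (- ((f x)^-1 * (f x)^-1) * a ^+ 2 + (f x)^-1 * b).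
Proof.
move=> fx h.
have H := @d2_comp (@ln R) (fun y => y^-1) f x (- ((f x)^-1 * (f x)^-1)) a b (f x) fx.
apply: (d2_eq (H _ _ h)) => //.
  by move=> y yf; apply: is_derive1_ln; move: yf; rewrite ltr_norml; lra.
by apply: derV; rewrite gt_eqF.
Qed.

Lemma d2_inv f x a b : 0 < f x -> d2 f x a b ->
  d2 (fun t => (f t)^-1) x (- ((f x)^-1 * (f x)^-1) * a)
    (2 * (f x)^-1 ^+ 3 * a ^+ 2 - (f x)^-1 * (f x)^-1 * b).
Proof.
move=> fx h; have f0 : f x != 0 by rewrite gt_eqF.
have := @d2_comp (fun y => y^-1) (fun y => - (y^-1 * y^-1)) f x (2 * (f x)^-1 ^+ 3) a b (f x) fx.
move=> H; apply: (d2_eq (H _ _ h)) => //.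
- move=> y yf; apply: derV; rewrite gt_eqF//; move: yf; rewrite ltr_norml; lra.
- apply: (der_eq (derN (derM (derV f0) (derV f0)))) => /=.
  by rewrite [in RHS]exprS expr2; ring.
- by rewrite mulNr.
Qed.

Lemma d2_entire F F' F'' f x a b : (forall y, der F y (F' y)) -> (forall y, der F' y (F'' y)) ->
  d2 f x a b -> d2 (fun t => F (f t)) x (F' (f x) * a) (F'' (f x) * a ^+ 2 + F' (f x) * b).
Proof. by move=> h1 h2 h; exact: (@d2_comp F F' f x (F'' (f x)) a b 1 ltr01 (fun y _ => h1 y) (h2 _) h). Qed.

(** At the maximum f' vanishes; if f'' were positive there, f' would be positive just to the right
    of x and f would increase. *)
Lemma d2_max f x a b : d2 f x a b ->
  (exists2 d : R, 0 < d & forall t, `|t - x| < d -> f t <= f x) -> b <= 0.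
Proof.
move=> [f' [[r r0 Hr] _ df]] [d d0 Hd].
pose m := Num.min r d; have m0 : 0 < m by rewrite lt_min r0.
have Hm t : t \in `]x - m, x + m[ -> der f t (f' t) /\ f t <= f x.
  rewrite in_itv/= => /andP[h1 h2].
  have : `|t - x| < m by rewrite ltr_norml; move: h1 h2; clear; lra.
  by rewrite lt_min => /andP[/Hr ? /Hd].
have xx : x \in `]x - m, x + m[ by rewrite in_itv/=; move: m0; clear; lra.
have f'0 : f' x = 0.
  have [|||_ dx0] := @derive1_at_max R f (x - m) (x + m) x _ _ xx.
  - by move: m0; clear; lra.
  - by move=> t /Hm[[]].
  - by move=> t /Hm[].
  by have [[_ <-] _] := Hm x xx; rewrite dx0.
rewrite leNgt; apply/negP => b0.
have /is_derive1_caratheodory[q [qE cq qx]] := df.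
have : nbhs (q x) (ball (q x) b) by exact: nbhsx_ballx.
move=> /cq/nbhs_ballP[e /= e0 He].
pose n := Num.min m e / 2.
have mn0 : 0 < Num.min m e by rewrite lt_min m0.
have n0 : 0 < n by rewrite divr_gt0.
have nm : n < Num.min m e by rewrite /n; move: mn0; clear; lra.
move: (nm); rewrite lt_min => /andP[nm1 nm2].
have inm t : x <= t <= x + n -> t \in `]x - m, x + m[.
  by move=> ?; rewrite in_itv/=; move: nm1 m0; lra.
have [|||c] := @MVT R f f' x (x + n).
- by rewrite ltrDl.
- by move=> t; rewrite in_itv/= => ?; apply: (Hm t _).1; apply: inm; lra.
- apply: derivable_within_continuous => t; rewrite in_itv/= => /inm/Hm[[]//].
rewrite in_itv/= => /andP[xc cn] fE.
have qc : 0 < q c.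
  have := He c; rewrite /ball/= qx => h; have {}h : `|b - q c| < b.
    by apply: h; rewrite ltr_norml; move: xc cn nm2; clear; lra.
  by move: h; rewrite ltr_norml; clear; lra.
have := qE c; rewrite f'0 subr0 => f'c.
have : 0 < f (x + n) - f x.
  by rewrite fE f'c addrAC subrr add0r !mulr_gt0// subr_gt0.
have xn : x <= x + n <= x + n by rewrite lexx andbT lerDl ltW.
by have [_ h] := Hm (x + n) (inm _ xn); rewrite subr_gt0 ltNge h.
Qed.
End Derivatives.

(** * The Laplacian and comparison with a barrier *)

Section Laplacian.
Context {R : realType}.
Local Notation C := (R[i]^o).
Implicit Types (v h : C -> R).

Definition has_lap v (z : C) (l : R) : Prop := exists a1 a2 b1 b2 : R,
  [/\ d2 (fun s : R => v (z + s%:C)) 0 a1 a2, d2 (fun s : R => v (z + s%:C * 'i)) 0 b1 b2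
   & l = a2 + b2].

Lemma has_lap_eq v z l l' : has_lap v z l -> l = l' -> has_lap v z l'.
Proof. by move=> h <-. Qed.

Lemma has_lapD v h z l m : has_lap v z l -> has_lap h z m -> has_lap (fun w => v w + h w) z (l + m).
Proof.
move=> [a1 [a2 [b1 [b2 [A B ->]]]]] [c1 [c2 [e1 [e2 [D E ->]]]]].
exists (a1 + c1), (a2 + c2), (b1 + e1), (b2 + e2).
split; [exact: (d2D A D)|exact: (d2D B E)|by ring].
Qed.

Lemma has_lapZ v z l (k : R) : has_lap v z l -> has_lap (fun w => k * v w) z (k * l).
Proof.
move=> [a1 [a2 [b1 [b2 [A B ->]]]]].
exists (k * a1), (k * a2), (k * b1), (k * b2).
split; [exact: (d2Z k A)|exact: (d2Z k B)|by ring].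
Qed.

Lemma has_lap_cst (c : R) z : has_lap (fun=> c) z 0.
Proof. by exists 0, 0, 0, 0; split; [exact: d2_cst|exact: d2_cst|rewrite addr0]. Qed.

Lemma has_lapB v h z l m : has_lap v z l -> has_lap h z m -> has_lap (fun w => v w - h w) z (l - m).
Proof.
move=> A B; have := has_lapD A (has_lapZ (-1) B).
have -> : (fun w => v w + -1 * h w) = (fun w => v w - h w) by apply/funext => w; rewrite mulN1r.
by rewrite mulN1r.
Qed.

Lemma has_lap_max v z l : has_lap v z l ->
  (exists2 d : R, 0 < d & forall w, cmod (w - z) < d -> v w <= v z) -> l <= 0.
Proof.
move=> [a1 [a2 [b1 [b2 [A B ->]]]]] [d d0 Hd]; rewrite -[leRHS]addr0 lerD//.
  apply: (d2_max A); exists d => // t; rewrite subr0 addr0 => td.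
  by apply: Hd; rewrite addrAC subrr add0r cmod_real.
apply: (d2_max B); exists d => // t; rewrite subr0 mul0r addr0 => td.
apply: Hd; rewrite addrAC subrr add0r cmodM cmod_real.
by rewrite [cmod _](_ : _ = 1) ?mulr1// cmodE /= expr0n expr1n add0r sqrtr1.
Qed.

Lemma rcontD v h z : rcont v z -> rcont h z -> rcont (fun w => v w + h w) z.
Proof.
by move=> /rcontP cv /rcontP ch; apply/rcontP; exact: (@continuousD _ _ _ v h z cv ch).
Qed.

Lemma rcontM v h z : rcont v z -> rcont h z -> rcont (fun w => v w * h w) z.
Proof.
by move=> /rcontP cv /rcontP ch; apply/rcontP; exact: (@continuousM _ _ v h z cv ch).
Qed.

Lemma rcont_cst (c : R) z : rcont (fun=> c) z.
Proof. by move=> e e0; exists 1 => // w _; rewrite subrr normr0. Qed.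

Lemma rcontN v z : rcont v z -> rcont (fun w => - v w) z.
Proof. by move=> /rcontP cv; apply/rcontP; exact: (@continuousN _ _ _ v z cv). Qed.

Lemma rcont_comp (F : R -> R) v z : rcont v z -> {for v z, continuous F} -> rcont (fun w => F (v w)) z.
Proof. by move=> /rcontP cv cF; apply/rcontP; exact: (@continuous_comp _ _ _ v F). Qed.

Definition limsup_le0 (U : set C) v (zeta : C) : Prop := forall e : R, 0 < e ->
  exists2 d : R, 0 < d & forall w, U w -> cmod (w - zeta) < d -> v w <= e.

(** If v z0 > 0, then v - e h is positive at z0 for a small e > 0. Its upper level set is compact,
    since h is large at infinity and near [X], and v has limsup at most 0 at the other boundary
    points. At a maximum the Laplacian is at most 0; but here it is - e l > 0. *)
Lemma maximum_principle (U : set C) v h (X : seq C) (M : R) :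
  (forall z, U z -> exists2 r : R, 0 < r & forall w, cmod (w - z) < r -> U w) ->
  (forall z, U z -> rcont v z /\ has_lap v z 0) ->
  (forall z, U z -> [/\ rcont h z, 0 <= h z & exists2 l : R, l < 0 & has_lap h z l]) ->
  (forall K : R, exists B : R, forall z, U z -> B < cmod z -> K < h z) ->
  (forall zeta, zeta \in X -> forall K : R, exists2 d : R, 0 < d &
     forall z, U z -> cmod (z - zeta) < d -> K < h z) ->
  (forall z, U z -> v z <= M) ->
  (forall zeta, closure U zeta -> ~ U zeta -> zeta \notin X -> limsup_le0 U v zeta) ->
  forall z, U z -> v z <= 0.
Proof.
move=> oU Hv Hh hinf hX vM hb z0 Uz0; rewrite leNgt; apply/negP => vz0.
have h1 : 0 < h z0 + 1 by have [_ ? _] := Hh z0 Uz0; rewrite ltr_wpDl.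
(* So e h(z0) < v(z0) / 2, which leaves c > 0. *)
pose e := v z0 / (h z0 + 1) / 2.
have e0 : 0 < e by rewrite !divr_gt0.
pose c := v z0 - e * h z0.
have c0 : 0 < c.
  rewrite /c subr_gt0 /e -mulrA -mulrA gtr_pMr//.
  have [_ h0 _] := Hh z0 Uz0.
  rewrite mulrCA mulrC -mulrA ltr_pdivrMl// mulr1; move: h0; clear; lra.
pose g w := v w - e * h w.
have cg z : U z -> rcont g z.
  move=> Uz; have [cv _] := Hv z Uz; have [ch _ _] := Hh z Uz.
  by apply: rcontD => //; apply: rcontN; apply: rcontM => //; exact: rcont_cst.
pose K := [set z | U z /\ c <= g z].
pose L := (M - c) / e.
have gL z : U z -> L < h z -> g z < c.
  move=> Uz; rewrite /L ltr_pdivrMr// /g => hz; have := vM z Uz; move: hz; clear; lra.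
have [B HB] := hinf L.
have [||||z1 [Uz1 gz1] Hz1] := @EVT_max_C R K B g.
- by exists z0; split=> //=; rewrite /c /g.
- move=> z cK; have cUz : closure U z by apply: closureS cK => w [].
  move/closure_cmodP in cK.
  have [Uz|nUz] := pselect (U z).
    split=> //; apply/ler_addgt0Pr => eps eps0.
    have [d d0 Hd] := cg z Uz eps eps0; have [w [Uw gw] wz] := cK d d0.
    have := Hd w wz; rewrite ltr_norml; move: gw; clear; lra.
  exfalso; have [zX|zX] := boolP (z \in X).
    have [d d0 Hd] := hX z zX L; have [w [Uw gw] wz] := cK d d0.
    by have := gL w Uw (Hd w Uw wz); rewrite ltNge gw.
  have c2 : 0 < c / 2 by rewrite divr_gt0.
  have [d d0 Hd] := hb z cUz nUz zX _ c2; have [w [Uw gw] wz] := cK d d0.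
  have := Hd w Uw wz; move: gw; rewrite /g; have [_ hw _] := Hh w Uw.
  have := mulr_ge0 (ltW e0) hw; move: c0; clear; lra.
- move=> z [Uz gz]; rewrite leNgt; apply/negP => zB.
  by have := gL z Uz (HB z Uz zB); rewrite ltNge gz.
- by move=> z [Uz _]; exact: cg.
have [_ lv] := Hv z1 Uz1; have [_ _ [l l0 lh]] := Hh z1 Uz1.
have := has_lap_max (has_lapB lv (has_lapZ e lh)).
have [r r0 Hr] := oU z1 Uz1.
have : e * l < 0 by rewrite pmulr_rlt0.
move=> el; rewrite sub0r oppr_le0 => H.
suff : 0 <= e * l by rewrite leNgt el.
apply: H; exists r => // w wz; have Uw := Hr w wz.
have [gw|/ltW gw] := leP c (g w); first exact: Hz1.
exact: le_trans gw gz1.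
Qed.
End Laplacian.

(** * Harmonic functions and logarithmic barriers *)

Section Harmonic.
Context {R : realType}.
Local Notation C := (R[i]^o).

Lemma mean_value_bound (g g' : R -> R) (a B : R) :
  (forall t, `|t| <= `|a| -> der g t (g' t) /\ `|g' t| <= B) -> `|g a - g 0| <= B * `|a|.
Proof.
move=> H; have cont x y : (forall t, t \in `[x, y] -> `|t| <= `|a|) -> {within `[x, y], continuous g}.
  by move=> xy; apply: derivable_within_continuous => t /xy /H[[]].
have [a0|a0|<-] := ltgtP 0 a; last by rewrite subrr !normr0 mulr0.
- have ia t : t \in `[0, a] -> `|t| <= `|a|.
    by rewrite in_itv/= (gtr0_norm a0) => /andP[t0 ta]; rewrite ger0_norm.
  have ia' t : t \in `]0, a[ -> t \in `[0, a] by exact: subset_itv_oo_cc.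
  have [c /ia'/ia/H[_ cB] ->] := MVT a0 (fun t h => (H t (ia t (ia' t h))).1) (cont _ _ ia).
  by rewrite subr0 normrM ler_wpM2r.
- have ia t : t \in `[a, 0] -> `|t| <= `|a|.
    by rewrite in_itv/= (ltr0_norm a0) => /andP[ta t0]; rewrite ler0_norm// lerN2.
  have ia' t : t \in `]a, 0[ -> t \in `[a, 0] by exact: subset_itv_oo_cc.
  have [c /ia'/ia/H[_ cB]] := MVT a0 (fun t h => (H t (ia t (ia' t h))).1) (cont _ _ ia).
  by rewrite sub0r distrC => ->; rewrite normrM normrN ler_wpM2r.
Qed.

Lemma der_partial (v : C) (F : C -> R) (z : C) (t : R) : has_partial v F (z + t%:C * v) ->
  der (directional v F z) t (partial v F (z + t%:C * v)).
Proof.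
move=> /derivableP; rewrite -derive1E => h.
have h' : der (directional v F (z + t%:C * v)) (t - t) (partial v F (z + t%:C * v)).
  by rewrite subrr.
have sh : der (fun s => s - t) t 1.
  by apply: (der_eq (derD (der_id t) (der_cst (- t) t))); rewrite addr0.
have := @der_comp R _ (fun s => s - t) t _ _ h' sh; rewrite mulr1.
congr der; apply/funext => s; rewrite /directional; congr F.
by have -> : (s - t)%:C = s%:C - t%:C :> R[i]; [rewrite rmorphB|ring].
Qed.

(** The mean value theorem is applied along a horizontal and then a vertical leg from z to w; the
    radius r/2 keeps both legs in the disk. *)
Lemma bounded_partials_rcont (F : C -> R) (z : C) (r B : R) : 0 < r ->
  (forall v, [set 1; 'i] v -> forall w, cmod (w - z) < r ->
    has_partial v F w /\ `|partial v F w| <= B) -> rcont F z.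
Proof.
move=> r0 H; have B0 : 0 <= B.
  have [|_] := H 1 (or_introl erefl) z; first by rewrite subrr cmod0.
  by apply: le_trans.
move=> e e0; exists (Num.min (r / 2) (e / (2 * B + 1))).
  by rewrite lt_min !divr_gt0// ltr_wpDl// mulr_ge0.
move=> w; rewrite lt_min => /andP[wr we].
pose a := Re (w - z); pose b := Im (w - z).
have ar : `|a| <= cmod (w - z) by exact: Re_cmod.
have br : `|b| <= cmod (w - z) by exact: Im_cmod.
have wE : w = z + a%:C * 1 + b%:C * 'i.
  by rewrite -addrA mulr1 [_ * 'i]mulrC -complexE addrC subrK.
have i1 : cmod 'i = 1 :> R by rewrite cmodE /= expr0n expr1n add0r sqrtr1.
have S1 : `|F (z + a%:C * 1) - F z| <= B * `|a|.
  have := @mean_value_bound (directional 1 F z) (fun t => partial 1 F (z + t%:C * 1)) a B.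
  rewrite /directional mul0r addr0; apply=> t ta.
  have tr : cmod (z + t%:C * 1 - z) < r.
    rewrite addrAC subrr add0r mulr1 cmod_real; move: ta ar wr r0; clear; lra.
  have [h1 h2] := H 1 (or_introl erefl) _ tr.
  by split; [exact: der_partial h1|exact: h2].
have S2 : `|F w - F (z + a%:C * 1)| <= B * `|b|.
  rewrite [in F w]wE.
  have := @mean_value_bound (directional 'i F (z + a%:C * 1)) (fun t => partial 'i F (z + a%:C * 1 + t%:C * 'i)) b B.
  rewrite /directional mul0r addr0; apply=> t ta.
  have tr : cmod (z + a%:C * 1 + t%:C * 'i - z) < r.
    rewrite addrAC (addrAC z) subrr add0r mulr1; apply: le_lt_trans (ler_cmodD _ _) _.
    rewrite cmodM i1 mulr1 !cmod_real; move: ta ar br wr r0; clear; lra.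
  have [h1 h2] := H 'i (or_intror erefl) _ tr.
  by split; [exact: der_partial h1|exact: h2].
have : (2 * B + 1) * cmod (w - z) < e.
  by rewrite mulrC -ltr_pdivlMr// ltr_wpDl// mulr_ge0.
have : `|F w - F z| <= B * `|b| + B * `|a|.
  apply: le_trans (_ : `|F w - F (z + a%:C * 1)| + `|F (z + a%:C * 1) - F z| <= _).
    by apply: le_trans (ler_normD _ _); rewrite addrA subrK.
  exact: lerD.
have h1 : B * `|b| <= B * cmod (w - z) by exact: ler_wpM2l.
have h2 : B * `|a| <= B * cmod (w - z) by exact: ler_wpM2l.
have := cmod_ge0 (w - z); move: h1 h2; clear; lra.
Qed.

Lemma rcont_bounded (v : C -> R) (z : C) : rcont v z ->
  exists2 r : R, 0 < r & forall w, cmod (w - z) < r -> `|v w| <= `|v z| + 1.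
Proof.
move=> cv; have [r r0 Hr] := cv 1 ltr01; exists r => // w /Hr h.
have := ler_normD (v w - v z) (v z); rewrite subrK; move: h; clear; lra.
Qed.

(** [harmonic_on] asserts continuity of the second partial derivatives. Being locally bounded, they
    make the first ones continuous, and these in turn make u continuous. *)
Lemma harmonic_lap (Omega : set C) (u : C -> R) : open Omega -> harmonic_on Omega u ->
  forall z, Omega z -> rcont u z /\ has_lap u z 0.
Proof.
move=> /open_cmodP oO [H1 H2] z Oz.
have I1 : [set 1; 'i] (1 : C) by left. have Ii : [set 1; 'i] ('i : C) by right.
have bnd (F : C -> R) y : Omega y -> (forall v, [set 1; 'i] v -> forall w, Omega w -> has_partial v F w) ->
    (forall v, [set 1; 'i] v -> rcont (partial v F) y) -> rcont F y.
  move=> Oy hp hc; have [r0 r00 Hr0] := oO y Oy.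
  have [r1 r10 Hr1] := rcont_bounded (hc 1 I1).
  have [r2 r20 Hr2] := rcont_bounded (hc 'i Ii).
  apply: (@bounded_partials_rcont F y (Num.min r0 (Num.min r1 r2))
    (Num.max (`|partial 1 F y| + 1) (`|partial 'i F y| + 1))).
    by rewrite !lt_min r00 r10.
  move=> v Iv w; rewrite !lt_min => /and3P[w0 w1 w2]; split; first exact/hp/Hr0.
  by rewrite le_max; case: Iv => ->; [rewrite Hr1|rewrite Hr2 ?orbT].
have cp v : [set 1; 'i] v -> forall y, Omega y -> rcont (partial v u) y.
  move=> Iv y Oy; apply: bnd => // [w Iw x Ox|w Iw]; first by have [] := H1 v w Iv Iw x Ox.
  by apply/rcontP; have [] := H1 v w Iv Iw y Oy.
split.
  by apply: bnd => // [v Iv x Ox|v Iv]; [have [] := H1 v v Iv Iv x Ox|exact: cp].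
have dd v : [set 1; 'i] v -> cmod v = 1 ->
    d2 (fun s : R => u (z + s%:C * v)) 0 (partial v u z) (partial v (partial v u) z).
  move=> Iv v1; exists (fun s => partial v u (z + s%:C * v)); split.
  - have [r r0 Hr] := oO z Oz; exists r => // t; rewrite subr0 => tr.
    apply: der_partial; have [] // := H1 v v Iv Iv (z + t%:C * v).
    by apply: Hr; rewrite addrAC subrr add0r cmodM v1 mulr1 cmod_real.
  - by rewrite mul0r addr0.
  - have [_ h _] := H1 v v Iv Iv z Oz.
    have h0 : has_partial v (partial v u) (z + 0%:C * v) by rewrite mul0r addr0.
    by have := der_partial h0; rewrite mul0r addr0.
have i1 : cmod 'i = 1 :> R by rewrite cmodE /= expr0n expr1n add0r sqrtr1.
exists (partial 1 u z), (partial 1 (partial 1 u) z), (partial 'i u z), (partial 'i (partial 'i u) z).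
split; last by rewrite H2.
- by have := dd 1 I1 cmod1; under eq_fun do rewrite mulr1.
- exact: dd.
Qed.
End Harmonic.

Section Barrier.
Context {R : realType}.
Local Notation C := (R[i]^o).

Lemma cmod_sqr (z : C) : cmod z ^+ 2 = Re z ^+ 2 + Im z ^+ 2.
Proof. by rewrite cmodE sqr_sqrtr// addr_ge0// sqr_ge0. Qed.

Lemma cmod_sqr_gt0 (b z : C) : z != b -> 0 < cmod (z - b) ^+ 2.
Proof. by move=> zb; rewrite exprn_gt0// cmod_gt0 subr_eq0. Qed.

Lemma d2_cmod_sqr_re (b z : C) :
  d2 (fun s : R => cmod (z + s%:C - b) ^+ 2) 0 (2 * Re (z - b)) 2.
Proof.
have -> : (fun s : R => cmod (z + s%:C - b) ^+ 2) =
    (fun s => (Re (z - b) + s * 1) * (Re (z - b) + s * 1) + Im (z - b) ^+ 2).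
  apply/funext => s; rewrite addrAC cmod_sqr ReD ImD /= addr0 mulr1 !expr2; by [].
have A := d2_affine (Re (z - b)) 1 0.
by apply: (d2_eq (d2D (d2M A A) (d2_cst _ _))) => /=; ring.
Qed.

Lemma d2_cmod_sqr_im (b z : C) :
  d2 (fun s : R => cmod (z + s%:C * 'i - b) ^+ 2) 0 (2 * Im (z - b)) 2.
Proof.
have -> : (fun s : R => cmod (z + s%:C * 'i - b) ^+ 2) =
    (fun s => (Im (z - b) + s * 1) * (Im (z - b) + s * 1) + Re (z - b) ^+ 2).
  apply/funext => s; rewrite addrAC cmod_sqr ReD ImD ReM ImM /=.
  by ring.
have A := d2_affine (Im (z - b)) 1 0.
by apply: (d2_eq (d2D (d2M A A) (d2_cst _ _))) => /=; ring.
Qed.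

Lemma has_lap_ln (b z : C) : z != b -> has_lap (fun w => ln (cmod (w - b) ^+ 2)) z 0.
Proof.
move=> zb; have n0 := cmod_sqr_gt0 zb.
have fx : 0 < (fun s : R => cmod (z + s%:C - b) ^+ 2) 0 by rewrite /= addr0.
have fy : 0 < (fun s : R => cmod (z + s%:C * 'i - b) ^+ 2) 0 by rewrite /= mul0r addr0.
have A := @d2_ln R (fun s : R => cmod (z + s%:C - b) ^+ 2) 0 _ _ fx (d2_cmod_sqr_re b z).
have B := @d2_ln R (fun s : R => cmod (z + s%:C * 'i - b) ^+ 2) 0 _ _ fy (d2_cmod_sqr_im b z).
do 4 eexists; split; [exact: A|exact: B|].
rewrite /= mul0r addr0; have := cmod_sqr (z - b); set n := cmod _ ^+ 2 in n0 *.
move=> nE; rewrite !exprMn (_ : Re _ ^+ 2 = n - Im (z - b) ^+ 2); last by rewrite nE addrK.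
by field; rewrite gt_eqF.
Qed.

Lemma has_lap_inv (b z : C) : z != b ->
  has_lap (fun w => (cmod (w - b) ^+ 2)^-1) z (4 * (cmod (z - b) ^+ 2)^-1 ^+ 2).
Proof.
move=> zb; have n0 := cmod_sqr_gt0 zb.
have fx : 0 < (fun s : R => cmod (z + s%:C - b) ^+ 2) 0 by rewrite /= addr0.
have fy : 0 < (fun s : R => cmod (z + s%:C * 'i - b) ^+ 2) 0 by rewrite /= mul0r addr0.
have A := @d2_inv R (fun s : R => cmod (z + s%:C - b) ^+ 2) 0 _ _ fx (d2_cmod_sqr_re b z).
have B := @d2_inv R (fun s : R => cmod (z + s%:C * 'i - b) ^+ 2) 0 _ _ fy (d2_cmod_sqr_im b z).
do 4 eexists; split; [exact: A|exact: B|].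
rewrite /= mul0r addr0; have := cmod_sqr (z - b); set n := cmod _ ^+ 2 in n0 *.
move=> nE; rewrite !exprMn (_ : Re _ ^+ 2 = n - Im (z - b) ^+ 2); last by rewrite nE addrK.
by field; rewrite gt_eqF.
Qed.

Lemma rcont_cmod (b z : C) : rcont (fun w => cmod (w - b)) z.
Proof.
move=> e e0; exists e => // w; apply: le_lt_trans.
rewrite ler_norml; have h1 := ler_cmodD (w - z) (z - b).
have h2 := ler_cmodD (z - w) (w - b).
rewrite addrA subrK in h1; rewrite addrA subrK (cmodB z w) in h2.
by move: h1 h2; clear; lra.
Qed.

Lemma rcont_cmod_sqr (b z : C) : rcont (fun w => cmod (w - b) ^+ 2) z.
Proof. by have := rcontM (rcont_cmod b z) (rcont_cmod b z). Qed.

Lemma rcont_ln (b z : C) : z != b -> rcont (fun w => ln (cmod (w - b) ^+ 2)) z.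
Proof.
move=> zb; apply: (@rcont_comp R (@ln R)); first exact: rcont_cmod_sqr.
exact/continuous_ln/cmod_sqr_gt0.
Qed.

Lemma rcont_inv (v : C -> R) (z : C) : v z != 0 -> rcont v z -> rcont (fun w => (v w)^-1) z.
Proof.
by move=> vz /rcontP cv; apply/rcontP; exact: (@continuousV _ _ v z vz cv).
Qed.

(* A positive strictly superharmonic function on Omega that blows up at the
   points of X and at infinity: exceptional boundary points become harmless. *)
Lemma exists_barrier (Omega : set C) (q : C) (rho : R) (X : seq C) : 0 < rho ->
  (forall z, Omega z -> rho <= cmod (z - q)) -> (forall zeta, zeta \in X -> ~ Omega zeta) ->
  exists h : C -> R, [/\
    forall z, Omega z -> [/\ rcont h z, 0 <= h z & exists2 l : R, l < 0 & has_lap h z l],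
    forall K : R, exists B : R, forall z, Omega z -> B < cmod z -> K < h z &
    forall zeta, zeta \in X -> forall K : R, exists2 d : R, 0 < d &
      forall z, Omega z -> cmod (z - zeta) < d -> K < h z].
Proof.
move=> rho0 Hq; have qN z : Omega z -> z != q.
  by move=> /Hq h; rewrite -subr_eq0 -cmod_gt0; exact: lt_le_trans h.
have N0 z : Omega z -> rho ^+ 2 <= cmod (z - q) ^+ 2.
  by move=> /Hq h; rewrite ler_pXn2r// nnegrE ?cmod_ge0// ltW.
have r2 : 0 < rho ^+ 2 by rewrite exprn_gt0.
have NP z : Omega z -> 0 < cmod (z - q) ^+ 2 by move=> /N0; exact: lt_le_trans.
elim: X => [_|zeta X IH HX].
  (* The logarithm is harmonic and unbounded at infinity. The Laplacian of |z - q|^-2 is 4 |z -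
     q|^-4 > 0, so the second term makes the sum strictly superharmonic. The constants make both
     terms nonnegative where |z - q| >= rho. *)
  exists (fun w => (ln (cmod (w - q) ^+ 2) - ln (rho ^+ 2)) + ((rho ^+ 2)^-1 - (cmod (w - q) ^+ 2)^-1)).
  have p1 z : Omega z -> ln (rho ^+ 2) <= ln (cmod (z - q) ^+ 2).
    by move=> Oz; rewrite ler_ln ?posrE ?N0 ?NP.
  have p2 z : Omega z -> (cmod (z - q) ^+ 2)^-1 <= (rho ^+ 2)^-1.
    by move=> Oz; rewrite lef_pV2 ?posrE ?N0 ?NP.
  split=> //.
  - move=> z Oz; split.
    + apply: rcontD; apply: rcontD; try exact: rcont_cst.
        by apply: rcont_ln; exact: qN.
      by apply: rcontN; apply: rcont_inv; [rewrite gt_eqF// NP|exact: rcont_cmod_sqr].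
    + by rewrite addr_ge0// subr_ge0; [exact: p1|exact: p2].
    + exists (0 - 0 + (0 - 4 * (cmod (z - q) ^+ 2)^-1 ^+ 2)).
        rewrite subrr add0r sub0r oppr_lt0 mulr_gt0// exprn_gt0// invr_gt0; exact: NP.
      apply: has_lapD; apply: has_lapB; try exact: has_lap_cst.
        exact/has_lap_ln/qN.
      exact/has_lap_inv/qN.
  - move=> K; pose E := expR (K + ln (rho ^+ 2)).
    exists (cmod q + 1 + E) => z Oz zB; have E0 : 0 < E by exact: expR_gt0.
    have h1 : 1 + E < cmod (z - q).
      have := ler_cmodD (z - q) q; rewrite subrK; move: zB; clear; lra.
    have h2 : E < cmod (z - q) ^+ 2.
      rewrite expr2; apply: lt_trans (_ : 1 + E < _); first by rewrite ltrDr.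
      apply: (lt_trans h1); rewrite ltr_pMr//; first by move: h1 E0; clear; lra.
      by move: h1 E0; clear; lra.
    have h3 : K + ln (rho ^+ 2) < ln (cmod (z - q) ^+ 2).
      by rewrite -(expRK (K + _)) ltr_ln ?posrE// NP.
    have := p2 z Oz; move: h3; clear; lra.
have [|h [Hh hinf hX]] := IH; first by move=> t tX; apply: HX; rewrite inE tX orbT.
have nz : ~ Omega zeta by apply: HX; rewrite mem_head.
have zN z : Omega z -> z != zeta by move=> Oz; apply/eqP => zz; apply: nz; rewrite -zz.
(* As |z - q| >= rho on Omega, this k satisfies |z - zeta| <= k |z - q| there. So [T], the logarithm
   of the squared quotient, is nonnegative and harmonic with pole zeta. *)
pose k := 1 + cmod (q - zeta) / rho.
have k1 : 1 <= k by rewrite lerDl divr_ge0 ?cmod_ge0// ltW.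
have k2 : 1 <= k ^+ 2 by rewrite exprn_ege1.
have kp : 0 < k ^+ 2 by exact: lt_le_trans k2.
pose T w := ln (cmod (w - q) ^+ 2) - ln (cmod (w - zeta) ^+ 2) + ln (k ^+ 2).
have T0 z : Omega z -> 0 <= T z.
  move=> Oz; have Nq := NP z Oz; have Nz := cmod_sqr_gt0 (zN z Oz).
  suff : ln (cmod (z - zeta) ^+ 2) <= ln (k ^+ 2 * cmod (z - q) ^+ 2).
    by rewrite lnM ?posrE// /T; clear; lra.
  rewrite ler_ln; [|by rewrite posrE|by rewrite posrE mulr_gt0].
  rewrite -exprMn.
  have kc : 0 <= k * cmod (z - q) by rewrite mulr_ge0 ?cmod_ge0// (le_trans ler01).
  rewrite ler_pXn2r ?nnegrE ?cmod_ge0//.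
  have := ler_cmodD (z - q) (q - zeta); rewrite addrA subrK => /le_trans; apply.
  rewrite /k mulrDl mul1r lerD2l mulrAC -mulrA ler_peMr ?cmod_ge0//.
  by rewrite ler_pdivlMr// mul1r; exact: Hq.
have Tlap z : Omega z -> has_lap T z (0 - 0 + 0).
  move=> Oz; apply: has_lapD; last exact: has_lap_cst.
  by apply: has_lapB; apply: has_lap_ln; [exact: qN|exact: zN].
have Tc z : Omega z -> rcont T z.
  move=> Oz; apply: rcontD; last exact: rcont_cst.
  by apply: rcontD; [exact/rcont_ln/qN|exact/rcontN/rcont_ln/zN].
exists (fun w => h w + T w); split.
- move=> z Oz; have [hc h0 [l l0 hl]] := Hh z Oz; split.
  + exact: rcontD (Tc z Oz).
  + by rewrite addr_ge0// T0.
  + exists (l + (0 - 0 + 0)); first by rewrite subrr !addr0.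
    exact: has_lapD (Tlap z Oz).
- move=> K; have [B HB] := hinf K; exists B => z Oz /(HB z Oz) h1.
  by have := T0 z Oz; move: h1; clear; lra.
- move=> t; rewrite inE => /predU1P[->|tX] K; last first.
    have [d d0 Hd] := hX t tX K; exists d => // z Oz /(Hd z Oz) h1.
    by have := T0 z Oz; move: h1; clear; lra.
  pose E := expR (ln (rho ^+ 2) - K); have E0 : 0 < E by exact: expR_gt0.
  exists (Num.min 1 E); first by rewrite lt_min ltr01.
  move=> z Oz; rewrite lt_min => /andP[z1 zE].
  have h1 : cmod (z - zeta) ^+ 2 < E.
    by apply: le_lt_trans zE; rewrite expr2 ler_piMl ?cmod_ge0// ltW.
  have h2 : ln (cmod (z - zeta) ^+ 2) < ln (rho ^+ 2) - K.
    by rewrite -(expRK (_ - K)) ltr_ln ?posrE// cmod_sqr_gt0// zN.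
  have h3 : ln (rho ^+ 2) <= ln (cmod (z - q) ^+ 2) by rewrite ler_ln ?posrE ?N0 ?NP.
  have h4 : 0 <= ln (k ^+ 2) by rewrite ln_ge0.
  have [_ h5 _] := Hh z Oz; rewrite /T; move: h2 h3 h4 h5; clear; lra.
Qed.
End Barrier.

(** * Channel coordinates *)

Section Coordinates.
Context {R : realType}.
Local Notation C := (R[i]^o).
Variables (p e : C).

(** For |e| = 1, multiplication by the conjugate of e undoes the rotation, so [cx] and [cy] invert
    [chan_pt]. *)
Definition cx (z : C) : R := Re ((z - p) * (e^*)%C).
Definition cy (z : C) : R := Im ((z - p) * (e^*)%C).

Hypothesis e1 : cmod e = 1.

Lemma mul_conj_unit : e * (e^*)%C = 1.
Proof. by rewrite -sqr_normc normcmod e1 expr1n. Qed.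

Lemma cx_chan (x y : R) : cx (chan_pt p e x y) = x.
Proof. by rewrite /cx /chan_pt addrAC subrr add0r mulrAC mul_conj_unit mul1r. Qed.

Lemma cy_chan (x y : R) : cy (chan_pt p e x y) = y.
Proof. by rewrite /cy /chan_pt addrAC subrr add0r mulrAC mul_conj_unit mul1r. Qed.

Lemma chan_cxcy (z : C) : chan_pt p e (cx z) (cy z) = z.
Proof.
rewrite /chan_pt /cx /cy; set w := (z - p) * _.
have -> : Re w +i* Im w = w by case: w.
by rewrite /w mulrCA mul_conj_unit mulr1 addrC subrK.
Qed.

Lemma cmod_coord (z w : C) : cmod ((z - w) * (e^*)%C) = cmod (z - w).
Proof. by rewrite cmodM cmod_conj e1 mulr1. Qed.

Lemma cxB (z w : C) : cx z - cx w = Re ((z - w) * (e^*)%C).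
Proof. by rewrite /cx -ReN -ReD -mulrBl opprB addrA subrK. Qed.

Lemma cyB (z w : C) : cy z - cy w = Im ((z - w) * (e^*)%C).
Proof. by rewrite /cy -ImN -ImD -mulrBl opprB addrA subrK. Qed.

Lemma cx_lip (z w : C) : `|cx z - cx w| <= cmod (z - w).
Proof. by rewrite cxB -cmod_coord; exact: Re_cmod. Qed.

Lemma cy_lip (z w : C) : `|cy z - cy w| <= cmod (z - w).
Proof. by rewrite cyB -cmod_coord; exact: Im_cmod. Qed.

Lemma coord_dist (z w : C) : cmod (z - w) <= `|cx z - cx w| + `|cy z - cy w|.
Proof. by rewrite cxB cyB -cmod_coord; exact: cmod_le. Qed.

Lemma rcont_cx (z : C) : rcont cx z.
Proof. by move=> r r0; exists r => // w; apply: le_lt_trans; exact: cx_lip. Qed.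

Lemma rcont_cy (z : C) : rcont cy z.
Proof. by move=> r r0; exists r => // w; apply: le_lt_trans; exact: cy_lip. Qed.

(* The second derivatives in all directions are prescribed, so that B stays
   harmonic after the rotation to the coordinates of the channel. *)
Definition rharmonic (B : R -> R -> R) (x y : R) : Prop := exists bxx bxy : R,
  forall al be : R, exists c : R,
    d2 (fun s => B (x + s * al) (y + s * be)) 0 c
       (al ^+ 2 * bxx + 2 * (al * be) * bxy - be ^+ 2 * bxx).

Lemma has_lap_rot (B : R -> R -> R) (z : C) : rharmonic B (cx z) (cy z) ->
  has_lap (fun w => B (cx w) (cy w)) z 0.
Proof.
(* In channel coordinates the directions 1 and 'i are (Re e, - Im e) and (Im e, Re e). The two
   second derivatives add up to 0. *)
move=> [bxx [bxy H]]; have [c1 H1] := H (Re e) (- Im e); have [c2 H2] := H (Im e) (Re e).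
exists c1; eexists; exists c2; eexists; split.
- have -> : (fun s : R => B (cx (z + s%:C)) (cy (z + s%:C))) =
     (fun s => B (cx z + s * Re e) (cy z + s * (- Im e))).
    apply/funext => s; rewrite /cx /cy addrAC mulrDl ReD ImD ReM ImM.
    by case: (e) => a b /=; congr B; rewrite !mul0r ?subr0 ?addr0.
  exact: H1.
- have -> : (fun s : R => B (cx (z + s%:C * 'i)) (cy (z + s%:C * 'i))) =
     (fun s => B (cx z + s * Im e) (cy z + s * Re e)).
    apply/funext => s; rewrite /cx /cy addrAC mulrDl ReD ImD !ReM !ImM.
    by case: (e) => a b /=; congr B; congr (_ + _); ring.
  exact: H2.
- by ring.
Qed.

Lemma rharmonicD (B D : R -> R -> R) (x y : R) : rharmonic B x y -> rharmonic D x y ->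
  rharmonic (fun s t => B s t + D s t) x y.
Proof.
move=> [b1 [b2 HB]] [d1 [d2' HD]]; exists (b1 + d1), (b2 + d2') => al be.
have [c1 h1] := HB al be; have [c2 h2] := HD al be; exists (c1 + c2).
by apply: (d2_eq (d2D h1 h2)) => //; ring.
Qed.

Lemma rharmonicZ (k : R) (B : R -> R -> R) (x y : R) : rharmonic B x y ->
  rharmonic (fun s t => k * B s t) x y.
Proof.
move=> [b1 [b2 HB]]; exists (k * b1), (k * b2) => al be.
have [c1 h1] := HB al be; exists (k * c1).
by apply: (d2_eq (d2Z k h1)) => //; ring.
Qed.

Lemma d2_exp (f : R -> R) (x a b : R) : d2 f x a b ->
  d2 (fun t => expR (f t)) x (expR (f x) * a) (expR (f x) * a ^+ 2 + expR (f x) * b).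
Proof. by apply: d2_entire => y; exact: is_derive_expR. Qed.

Lemma d2_cos (f : R -> R) (x a b : R) : d2 f x a b ->
  d2 (fun t => cos (f t)) x (- sin (f x) * a) (- cos (f x) * a ^+ 2 + - sin (f x) * b).
Proof.
apply: (@d2_entire R (@cos R) (fun y => - sin y) (fun y => - cos y)) => y.
  exact: is_derive_cos.
by apply: derN; exact: is_derive_sin.
Qed.

Lemma d2_sin (f : R -> R) (x a b : R) : d2 f x a b ->
  d2 (fun t => sin (f t)) x (cos (f x) * a) (- sin (f x) * a ^+ 2 + cos (f x) * b).
Proof.
apply: (@d2_entire R (@sin R) (@cos R) (fun y => - sin y)) => y.
  exact: is_derive_sin.
exact: is_derive_cos.
Qed.

Lemma d2_atan (f : R -> R) (x a b : R) : d2 f x a b ->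
  d2 (fun t => atan (f t)) x ((1 + f x ^+ 2)^-1 * a)
   (- (2 * f x) * ((1 + f x ^+ 2)^-1 * (1 + f x ^+ 2)^-1) * a ^+ 2 + (1 + f x ^+ 2)^-1 * b).
Proof.
apply: (@d2_entire R (@atan R) (fun y => (1 + y ^+ 2)^-1)
  (fun y => - (2 * y) * ((1 + y ^+ 2)^-1 * (1 + y ^+ 2)^-1))) => y.
  exact: is_derive1_atan.
have y0 : 1 + y ^+ 2 != 0 by rewrite gt_eqF// ltr_pwDl// sqr_ge0.
have sq : der (fun t : R => 1 + t ^+ 2) y (2 * y).
  have := derD (der_cst 1 y) (derM (der_id y) (der_id y)).
  by move=> h; apply: (der_eq h); ring.
have := @der_comp R (fun t => t^-1) (fun t => 1 + t ^+ 2) y _ _ (derV y0) sq.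
by move=> h; apply: (der_eq h); ring.
Qed.

Lemma rharmonic_cst (k x y : R) : rharmonic (fun _ _ => k) x y.
Proof. by exists 0, 0 => al be; exists 0; apply: (d2_eq (d2_cst k 0)) => //; ring. Qed.

Lemma rharmonic_expcos (x y : R) : rharmonic (fun s t => expR (- s) * cos (t - 2^-1)) x y.
Proof.
exists (expR (- x) * cos (y - 2^-1)), (expR (- x) * sin (y - 2^-1)) => al be; eexists.
have A := d2_exp (d2N (d2_affine x al 0)).
have B := d2_cos (d2D (d2_affine y be 0) (d2_cst (- 2^-1) 0)).
apply: (d2_eq (d2M A B)); first exact: erefl.
by rewrite /= !mul0r !addr0; ring.
Qed.

Lemma rharmonic_expsin (x0 x y : R) :
  rharmonic (fun s t => expR (pi * (s - x0)) * sin (pi * t)) x y.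
Proof.
exists (pi ^+ 2 * (expR (pi * (x - x0)) * sin (pi * y))), (pi ^+ 2 * (expR (pi * (x - x0)) * cos (pi * y))) => al be; eexists.
have A := d2_exp (d2Z pi (d2D (d2_affine x al 0) (d2_cst (- x0) 0))).
have B := d2_sin (d2Z pi (d2_affine y be 0)).
apply: (d2_eq (d2M A B)); first exact: erefl.
by rewrite /= !mul0r !addr0; ring.
Qed.

Lemma rharmonic_quad (x0 x y : R) :
  rharmonic (fun s t => t * (1 - t) + (s - x0) * (s - x0)) x y.
Proof.
exists 2, 0 => al be; eexists.
have A := d2D (d2_affine x al 0) (d2_cst (- x0) 0).
have B := d2_affine y be 0.
apply: (d2_eq (d2D (d2M B (d2D (d2_cst 1 0) (d2N B))) (d2M A A))); first exact: erefl.
by rewrite /=; ring.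
Qed.

(** The angle of elevation at which the point (L, c) is seen from (s, t). [F1] and [F2] are the
    first two derivatives of [atan] at w / r. *)
Lemma rharmonic_atan (L c x y : R) : x < L ->
  rharmonic (fun s t => atan ((c - t) / (L - s))) x y.
Proof.
move=> xL; have r0 : L - x != 0 by rewrite gt_eqF// subr_gt0.
pose w := c - y; pose r := L - x.
pose F1 := (1 + (w / r) ^+ 2)^-1.
pose F2 := - (2 * (w / r)) * (F1 * F1).
exists (F2 * w ^+ 2 / r ^+ 4 + F1 * (2 * w) / r ^+ 3), (- F2 * w / r ^+ 3 - F1 / r ^+ 2) => al be; eexists.
have A := d2D (d2_cst c 0) (d2N (d2_affine y be 0)).
have fx : 0 < (fun s => L + - (x + s * al)) 0 by rewrite /= mul0r addr0 subr_gt0.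
have B := @d2_inv R (fun s => L + - (x + s * al)) 0 _ _ fx (d2D (d2_cst L 0) (d2N (d2_affine x al 0))).
apply: (d2_eq (d2_atan (d2M A B))); first exact: erefl.
rewrite /= !mul0r !addr0 -/w -/r -/F1.
have r0' : r != 0 by [].
have F1E : F1 = r ^+ 2 / (r ^+ 2 + w ^+ 2).
  have rp : 0 < r by rewrite subr_gt0.
  have n0 : 0 < r ^+ 2 + w ^+ 2 by rewrite ltr_pwDl ?exprn_gt0// sqr_ge0.
  have n1 : 0 < 1 + (w / r) ^+ 2 by rewrite ltr_pwDl ?sqr_ge0.
  apply: (mulIf (lt0r_neq0 n1)); rewrite /F1 mulVf ?lt0r_neq0//.
  by field; rewrite r0' lt0r_neq0.
have n0 : r ^+ 2 + w ^+ 2 != 0.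
  have rp : 0 < r by rewrite subr_gt0.
  by rewrite gt_eqF// ltr_pwDl ?exprn_gt0// sqr_ge0.
rewrite /F2 F1E; field.
by rewrite r0' n0.
Qed.
End Coordinates.

(** * Harmonic measure of a part of a line *)

Section Elementary.
Context {R : realType}.

Lemma atan_lip (u v : R) : u <= v -> atan v - atan u <= v - u.
Proof.
rewrite le_eqVlt => /predU1P[->|uv]; first by rewrite !subrr.
have dt t : t \in `]u, v[ -> is_derive t (1 : R) (@atan R) ((1 + t ^+ 2)^-1).
  by move=> _; exact: is_derive1_atan.
have [|c _ ->] := MVT uv dt.
  by apply: continuous_subspaceT => t; exact: continuous_atan.
apply: ler_piMl; first by rewrite subr_ge0 ltW.
rewrite invf_le1 ?lerDl ?sqr_ge0//.
by rewrite ltr_pwDl// sqr_ge0.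
Qed.

Lemma atan_big (eps : R) : 0 < eps ->
  exists2 M : R, 0 < M & forall t, M <= t -> pi / 2 - eps <= atan t.
Proof.
move=> e0; have := @cvgy_atan R _ (nbhsx_ballx (pi / 2) eps e0).
move=> /pinfty_ex_gt0[M M0]; rewrite /ball/= => h; exists M => // t Mt.
apply: le_trans (le_atan Mt); move: h; rewrite ltr_norml; lra.
Qed.

(** From cos 1 > 0 one gets cos^2(1/2) > 1/2, which exceeds 4/9. *)
Lemma cos_half_gt : 2 / 3 < cos (2^-1 : R).
Proof.
have c0 : 0 < cos (2^-1 : R).
  apply: cos_gt0_pihalf; have := pi_ge2 R; lra.
have c1 : 0 < cos (2^-1 : R) ^+ 2 - sin (2^-1 : R) ^+ 2.
  have := cos1_gt0 R; rewrite [in X in X -> _](_ : 1 = 2^-1 + 2^-1); last by field.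
  by rewrite cosD !expr2.
have := cos2Dsin2 (2^-1 : R) => h.
rewrite -(@ltr_pXn2r _ 2) ?nnegrE ?ltW//.
by move: c1 h; rewrite expr2; clear; lra.
Qed.

(** The value 2/3 separates the two numbers, because e^{1/2} >= 1 + 1/2. This is the contraction
    factor of the final estimate. *)
Lemma expR_half_lt : expR (- 2^-1 : R) / cos (2^-1 : R) < 1.
Proof.
have c0 := cos_half_gt; have cp : 0 < cos (2^-1 : R) by move: c0; lra.
rewrite ltr_pdivrMr// mul1r; apply: le_lt_trans c0.
rewrite expRN -[leRHS]invrK lef_pV2 ?posrE ?expR_gt0 ?invr_gt0 ?divr_gt0//.
have := @expR_ge1Dx R 2^-1; rewrite invf_div; lra.
Qed.

Lemma cos_nonincr (x y : R) : 0 <= x -> x <= y -> y <= pi -> cos y <= cos x.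
Proof.
move=> x0 xy ypi; have := xy; rewrite le_eqVlt => /predU1P[->//|h].
apply/ltW; rewrite ltr_cos// in_itv/=; first by rewrite x0 (le_trans xy).
by rewrite (le_trans x0)//.
Qed.

Lemma sin_ge_cos (t : R) : 0 <= t -> t <= pi -> t * cos t <= sin t.
Proof.
rewrite le_eqVlt => /predU1P[<-|t0] tpi; first by rewrite mul0r sin0.
have dt s : s \in `]0, t[ -> is_derive s (1 : R) (@sin R) (cos s).
  by move=> _; exact: is_derive_sin.
have [|c] := MVT t0 dt.
  by apply: continuous_subspaceT => s; exact: continuous_sin.
rewrite in_itv/= => /andP[c0 ct]; rewrite sin0 !subr0 => ->.
by rewrite mulrC; apply: ler_wpM2r; [exact: ltW|apply: cos_nonincr => //; exact: ltW].
Qed.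

(** The double angle formula and [sin_ge_cos] at t/2 give sin t >= t cos^2(t/2), and cos^2(t/2) >=
    1/2 since cos t >= 0. *)
Lemma sin_ge_half (t : R) : 0 <= t -> t <= pi / 2 -> t / 2 <= sin t.
Proof.
move=> t0 tpi; have p0 := pi_ge0 R.
have tE : t = t / 2 + t / 2 by field.
have h : t / 2 * cos (t / 2) <= sin (t / 2) by apply: sin_ge_cos; move: t0 tpi p0; lra.
have c0 : 0 <= cos (t / 2).
  apply/ltW/cos_gt0_pihalf; have := pi_ge2 R; move: t0 tpi; lra.
have ct : 0 <= cos t.
  by rewrite -(@cos_pihalf R) cos_nonincr//; move: p0; lra.
have c2 : cos (t / 2) ^+ 2 >= 2^-1.
  have := cos2Dsin2 (t / 2); move: ct; rewrite [in cos t]tE cosD -!expr2; lra.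
rewrite [in leRHS]tE sinD.
have h1 : t / 2 * cos (t / 2) * cos (t / 2) <= sin (t / 2) * cos (t / 2) by exact: ler_wpM2r.
have h2 : t / 2 * 2^-1 <= t / 2 * cos (t / 2) ^+ 2 by apply: ler_wpM2l => //; move: t0; lra.
by move: h1 h2; rewrite expr2; lra.
Qed.

(** Write sin(pi y) = 2 sin(pi y/2) cos(pi y/2). By [sin_ge_half] the factors are at least pi y/4
    and pi (1 - y)/4, and pi >= 2 suffices. *)
Lemma sin_pi_ge (y : R) : 0 <= y <= 1 -> y * (1 - y) <= 2 * sin (pi * y).
Proof.
move=> /andP[y0 y1]; have p0 := pi_ge0 R; have p2 := pi_ge2 R.
have h1 : pi * y / 2 / 2 <= sin (pi * y / 2).
  apply: sin_ge_half; first by rewrite divr_ge0// mulr_ge0.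
  by rewrite ler_pM2r ?invr_gt0// ler_piMr.
have y1' : 0 <= 1 - y by rewrite subr_ge0.
have h2 : pi * (1 - y) / 2 / 2 <= cos (pi * y / 2).
  have := @sin_ge_half (pi * (1 - y) / 2); rewrite divr_ge0 ?mulr_ge0//.
  rewrite ler_pM2r ?invr_gt0// ler_piMr//; last by rewrite lerBlDr lerDl.
  move=> /(_ isT isT); rewrite (_ : pi * (1 - y) / 2 = pi / 2 - pi * y / 2); last by field.
  by rewrite sinB sin_pihalf cos_pihalf mul1r mul0r subr0.
have a0 : 0 <= pi * y / 2 / 2 by rewrite !divr_ge0// mulr_ge0.
have b0 : 0 <= pi * (1 - y) / 2 / 2 by rewrite !divr_ge0// mulr_ge0.
have := ler_pM a0 b0 h1 h2.
have -> : sin (pi * y) = sin (pi * y / 2) * cos (pi * y / 2) + sin (pi * y / 2) * cos (pi * y / 2).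
  by rewrite [in LHS](_ : pi * y = pi * y / 2 + pi * y / 2) ?sinD; [ring|field].
have : 4 * (y * (1 - y)) <= pi * pi * (y * (1 - y)).
  apply: ler_wpM2r; first exact: mulr_ge0.
  have := ler_pM (ler0n _ 2) (ler0n _ 2) p2 p2; lra.
lra.
Qed.
End Elementary.

(** * Sums of visual angles as barriers *)

Section Theta.
Context {R : realType}.
Local Notation mu := (@lebesgue_measure R).

Definition width (E : set R) (al be : R) : R := fine (mu (E `&` `[al, be]%classic)).

Lemma width_fin (E : set R) (al be : R) : measurable E ->
  mu (E `&` `[al, be]%classic) \is a fin_num.
Proof.
move=> mE; rewrite ge0_fin_numE//.
apply: le_lt_trans (_ : (mu `[al, be]%classic < +oo)%E).
  by apply: le_measure; rewrite ?inE//; exact: measurableI.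
by rewrite lebesgue_measure_itv/=; case: ifP => _; rewrite ?ltry.
Qed.

Lemma width_ge0 (E : set R) (al be : R) : 0 <= width E al be.
Proof. by rewrite /width fine_ge0. Qed.

Lemma width_full (E : set R) (al be : R) : measurable E -> al <= be ->
  (forall y, al < y < be -> E y) -> be - al <= width E al be.
Proof.
move=> mE; rewrite le_eqVlt => /predU1P[->|ab] HE; first by rewrite subrr width_ge0.
rewrite -lee_fin /width fineK ?width_fin//.
have -> : (be - al)%:E = mu `]al, be[%classic by rewrite lebesgue_measure_itv/= lte_fin ab.
apply: le_measure; rewrite ?inE//; first exact: measurableI.
move=> y; rewrite /= !in_itv/= => /andP[h1 h2]; split; first by apply: HE; rewrite h1.
by rewrite !ltW.
Qed.

Lemma width_split (E : set R) (al c be : R) : measurable E -> ~ E c -> al <= c <= be ->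
  width E al c + width E c be <= width E al be.
Proof.
move=> mE nc /andP[ac cb]; rewrite -lee_fin /width EFinD !fineK ?width_fin//.
rewrite -measureU//; [|exact: measurableI|exact: measurableI|].
  apply: le_measure; rewrite ?inE//; [|exact: measurableI|].
    by apply: measurableU; exact: measurableI.
  move=> y [] [Ey]; rewrite /= !in_itv/= => /andP[h1 h2]; split=> //; apply/andP; split=> //.
    exact: le_trans cb.
  exact: le_trans h1.
rewrite -subset0 => y [[Ey]]; rewrite /= !in_itv/= => /andP[_ h1] [_ /andP[h2 _]].
by apply: nc; rewrite (_ : c = y)//; apply/eqP; rewrite eq_le h1 h2.
Qed.

(* [T] dominates the harmonic measure of the part [E] of the line x = L in the
   half-plane x < L, seen between the ordinates al and be. *)
Definition angle_barrier (L : R) (E : set R) (al be : R) (T : R -> R -> R) : Prop :=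
  [/\ forall x y, x < L -> rharmonic T x y,
      forall p e z, cmod e = 1 -> cx p e z < L -> rcont (fun w => T (cx p e w) (cy p e w)) z,
      forall x y, x < L -> 0 <= T x y <= width E al be / (pi * (L - x))
    & forall y0, E y0 -> al < y0 < be -> forall eps : R, 0 < eps -> exists2 d : R, 0 < d &
        forall x y, x < L -> L - x < d -> `|y - y0| < d -> 1 - eps <= T x y].

Lemma rcont_angle (L c : R) p e z : cmod e = 1 -> cx p e z < L ->
  rcont (fun w => atan ((c - cy p e w) / (L - cx p e w))) z.
Proof.
move=> e1 zL; apply: (@rcont_comp R (@atan R)); last exact: continuous_atan.
apply: rcontM.
  by apply: rcontD; [exact: rcont_cst|apply: rcontN; exact: rcont_cy].
apply: rcont_inv; first by rewrite gt_eqF// subr_gt0.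
by apply: rcontD; [exact: rcont_cst|apply: rcontN; exact: rcont_cx].
Qed.

(** [Y] contains the finitely many possible boundary points of E, and the interval is cut at them,
    one at a time. On a piece without such points E is either empty, and T = 0, or everything, and T
    is the visual angle of the piece divided by pi. The bounds add up because the cutting points lie
    outside E. *)
Lemma exists_angle_barrier (L : R) (E : set R) (Y : seq R) (al be : R) : open E -> al <= be ->
  (forall y, y \in Y -> ~ E y) ->
  (forall y, al < y < be -> closure E y -> ~ E y -> y \in Y) ->
  exists T, angle_barrier L E al be T.
Proof.
move=> oE; have mE : measurable E by exact: measurable_realfun.open_measurable.
have pi0 : 0 < pi :> R by exact: pi_gt0.
elim: Y al be => [|c Y IH] al be ab nY clY; last first.
  have nY' y : y \in Y -> ~ E y by move=> yY; apply: nY; rewrite inE yY orbT.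
  have [/andP[ac cb]|cn] := boolP (al < c < be); last first.
    apply: IH => // y hy cy' ny; have := clY y hy cy' ny; rewrite inE => /predU1P[yc|//].
    by rewrite yc (negPf cn) in hy.
  have [|T1 [h1 c1 b1 l1]] := IH al c (ltW ac) nY'.
    move=> y /andP[hy1 hy2] cy' ny; have := clY y; rewrite hy1 (lt_trans hy2 cb) => /(_ isT cy' ny).
    by rewrite inE => /predU1P[yc|//]; rewrite yc ltxx in hy2.
  have [|T2 [h2 c2 b2 l2]] := IH c be (ltW cb) nY'.
    move=> y /andP[hy1 hy2] cy' ny; have := clY y; rewrite hy2 (lt_trans ac hy1) => /(_ isT cy' ny).
    by rewrite inE => /predU1P[yc|//]; rewrite yc ltxx in hy1.
  exists (fun x y => T1 x y + T2 x y); split.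
  - by move=> x y xL; apply: rharmonicD; [exact: h1|exact: h2].
  - by move=> p e z e1 zL; apply: rcontD; [exact: c1|exact: c2].
  - move=> x y xL; have /andP[p1 q1] := b1 x y xL; have /andP[p2 q2] := b2 x y xL.
    rewrite addr_ge0//=; apply: le_trans (lerD q1 q2) _; rewrite -mulrDl.
    rewrite ler_pM2r ?invr_gt0 ?mulr_gt0 ?subr_gt0//.
    by apply: width_split => //; [apply: nY; rewrite mem_head|rewrite !ltW].
  - move=> y0 Ey0 /andP[ay yb] eps e0.
    have [yc|cy'|yc] := ltgtP y0 c; last by exfalso; apply: (nY c); rewrite ?mem_head// -yc.
      have [|d d0 Hd] := l1 y0 Ey0 _ eps e0; first by rewrite ay.
      exists d => // x y xL xd yd; have := Hd x y xL xd yd; have /andP[p2 _] := b2 x y xL.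
      by move: p2; clear; lra.
    have [|d d0 Hd] := l2 y0 Ey0 _ eps e0; first by rewrite cy'.
    exists d => // x y xL xd yd; have := Hd x y xL xd yd; have /andP[p2 _] := b1 x y xL.
    by move: p2; clear; lra.
have [[y1 [/= y1ab Ey1]]|none] := pselect (`]al, be[%classic `&` E !=set0); last first.
  exists (fun _ _ => 0); split.
  - by move=> x y _; exact: rharmonic_cst.
  - by move=> p e z _ _; exact: rcont_cst.
  - by move=> x y xL; rewrite lexx divr_ge0 ?width_ge0// mulr_ge0 ?subr_ge0// ltW.
  - move=> y0 Ey0 hy; exfalso; apply: none; exists y0; split=> //=.
(* The trace of E on the interval is relatively open and closed, and not empty. *)
have full : `]al, be[%classic `&` E = `]al, be[%classic.
  have : connected `]al, be[%classic by apply/connected_intervalP; exact: interval_is_interval.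
  apply; first by exists y1.
    by exists E.
  exists (closure E); first exact: closed_closure.
  apply/seteqP; split=> y [hy Ey]; split=> //; first exact: subset_closure.
  apply: contrapT => nEy; have := clY y _ Ey nEy; rewrite in_nil => H.
  by move: hy; rewrite /= in_itv/= => /H.
have fullE y : al < y < be -> E y.
  by move=> hy; have : `]al, be[%classic y by []; rewrite -full => -[].
exists (fun x y => pi^-1 * (atan ((be - y) / (L - x)) + -1 * atan ((al - y) / (L - x)))); split.
- move=> x y xL; apply: rharmonicZ; apply: rharmonicD; first exact: rharmonic_atan.
  by apply: rharmonicZ; exact: rharmonic_atan.
- move=> p e z e1 zL; apply: rcontM; first exact: rcont_cst.
  apply: rcontD; first exact: rcont_angle.
  by apply: rcontM; [exact: rcont_cst|exact: rcont_angle].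
- move=> x y xL; rewrite mulN1r; have Lx : 0 < L - x by rewrite subr_gt0.
  have le1 : (al - y) / (L - x) <= (be - y) / (L - x) by rewrite ler_pM2r ?invr_gt0// lerB.
  apply/andP; split.
    by apply: mulr_ge0; [rewrite invr_ge0 ltW|rewrite subr_ge0 le_atan].
  rewrite invfM mulrA [leRHS]mulrAC [leRHS]mulrC ler_pM2l ?invr_gt0//.
  apply: le_trans (atan_lip le1) _; rewrite -mulrBl ler_pM2r ?invr_gt0//.
  have := width_full mE ab fullE; lra.
- move=> y0 Ey0 /andP[ay yb] eps e0.
  have e1 : 0 < eps * pi / 2 by rewrite divr_gt0// mulr_gt0.
  have [M M0 HM] := atan_big e1.
  (* Both ends are at distance at least 2k from y0, hence at least k from y. Once L - x < k/M, both
     slopes exceed M in absolute value. *)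
  pose k := Num.min (be - y0) (y0 - al) / 2.
  have k0 : 0 < k by rewrite divr_gt0// lt_min !subr_gt0 yb.
  have [k1 k2] : k <= (be - y0) / 2 /\ k <= (y0 - al) / 2.
    by rewrite /k !ler_pM2r ?invr_gt0// ge_min lexx ge_min lexx orbT.
  exists (Num.min k (k / M)); first by rewrite lt_min k0 divr_gt0.
  move=> x y xL; rewrite !lt_min => /andP[_ xM] /andP[yk _].
  have Lx : 0 < L - x by rewrite subr_gt0.
  move: yk; rewrite ltr_norml => /andP[yk1 yk2].
  have kM : M * (L - x) < k by rewrite mulrC -ltr_pdivlMr.
  have A1 : pi / 2 - eps * pi / 2 <= atan ((be - y) / (L - x)).
    by apply: HM; rewrite ler_pdivlMr//; move: kM k1 yk2; clear; lra.
  have A2 : pi / 2 - eps * pi / 2 <= - atan ((al - y) / (L - x)).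
    by rewrite -atanN -[X in atan X]mulNr; apply: HM; rewrite ler_pdivlMr//; move: kM k2 yk1; clear; lra.
  rewrite ler_pdivlMl// mulN1r; move: A1 A2; clear; lra.
Qed.
End Theta.

(** * Paths *)

Section Paths.
Context {R : realType}.
Local Notation C := (R[i]^o).

Definition cpath (g : R -> C) : Prop := forall t (eps : R), 0 < eps ->
  exists2 d : R, 0 < d & forall s, `|s - t| < d -> cmod (g s - g t) < eps.

Lemma cpathP (g : R -> C) : cpath g <-> continuous g.
Proof.
split=> [cg t A /nbhs_cmodP[r r0 HA]|cg t eps e0].
  have [d d0 Hd] := cg t r r0; apply/nbhs_ballP; exists d => //= s; rewrite /ball/= distrC => /Hd.
  exact: HA.
have n : nbhs (g t) [set w | cmod (w - g t) < eps] by apply/nbhs_cmodP; exists eps.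
have /nbhs_ballP[d /= d0 Hd] := cg t _ n; exists d => // s st.
by apply: Hd; rewrite /ball/= distrC.
Qed.

Definition clamp01 (t : R) : R := clamp 2^-1 2^-1 t.

Lemma clamp01_itv t : 0 <= clamp01 t <= 1.
Proof. by have := @clamp_itv R 2^-1 2^-1 t; rewrite /clamp01 subrr -[X in X + X]div1r -splitr; apply; rewrite invr_gt0. Qed.

Lemma clamp01_id t : 0 <= t <= 1 -> clamp01 t = t.
Proof. by move=> t01; rewrite /clamp01 clamp_id// subrr -[X in X + X]div1r -splitr. Qed.

Lemma clamp01_lip s t : `|clamp01 s - clamp01 t| <= `|s - t|.
Proof. by apply: clamp_lip; rewrite invr_gt0. Qed.

Lemma clamp01_le0 t : t <= 0 -> clamp01 t = 0.
Proof. by move=> t0; rewrite /clamp01 /clamp subrr /Num.max /Num.min; case: ifP; case: ifP; lra. Qed.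

Lemma clamp01_ge1 t : 1 <= t -> clamp01 t = 1.
Proof. by move=> t0; rewrite /clamp01 /clamp subrr /Num.max /Num.min; case: ifP; case: ifP; lra. Qed.

Lemma cpath_clamp (g : R -> C) (k : R -> R) (m : R) : 0 < m ->
  (forall s t, `|k s - k t| <= m * `|s - t|) -> (forall t, 0 <= k t <= 1) ->
  {within [set t : R | 0 <= t <= 1], continuous g} -> cpath (fun t => g (k t)).
Proof.
move=> m0 klip k01 /subspace_continuousP cg t eps e0.
have n : nbhs (g (k t)) [set w | cmod (w - g (k t)) < eps] by apply/nbhs_cmodP; exists eps.
have := cg (k t) (k01 t) _ n; rewrite nbhs_simpl /= => /nbhs_ballP[d /= d0 Hd].
exists (d / m); first by rewrite divr_gt0.
move=> s; rewrite ltr_pdivlMr// mulrC => st; apply: Hd; last exact: k01.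
by rewrite /ball/= distrC; exact: le_lt_trans (klip _ _) st.
Qed.

Lemma cpathD (g h : R -> C) : cpath g -> cpath h -> cpath (fun t => g t + h t).
Proof.
move=> cg ch t e e0; have e2 : 0 < e / 2 by rewrite divr_gt0.
have [d d0 Hd] := cg t _ e2; have [d' d'0 Hd'] := ch t _ e2.
exists (Num.min d d'); first by rewrite lt_min d0.
move=> s; rewrite lt_min => /andP[/Hd h1 /Hd' h2].
rewrite opprD addrACA; apply: le_lt_trans (ler_cmodD _ _) _.
by rewrite [ltRHS]splitr ltrD.
Qed.

Lemma cpath_cst (c : C) : cpath (fun=> c).
Proof. by move=> t e e0; exists 1 => // s _; rewrite subrr cmod0. Qed.

(** The path is defined, continuous and in S on the whole line; [cpath_clamp] turns paths on [0, 1]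
    into such paths. *)
Definition joined (S : set C) (z w : C) : Prop :=
  exists g, [/\ cpath g, g 0 = z, g 1 = w & forall t, S (g t)].

(** At any time one of the two paths rests at the junction [g 1 = h 0], which is subtracted. Without
    a case distinction, continuity is that of a sum. *)
Definition glue (g h : R -> C) (t : R) : C := g (clamp01 (2 * t)) + h (clamp01 (2 * t - 1)) - g 1.

Lemma glue_left (g h : R -> C) t : g 1 = h 0 -> t <= 2^-1 -> glue g h t = g (clamp01 (2 * t)).
Proof. by move=> gh t2; rewrite /glue (@clamp01_le0 (2 * t - 1)) -?gh ?addrK//; lra. Qed.

Lemma glue_right (g h : R -> C) t : g 1 = h 0 -> 2^-1 <= t -> glue g h t = h (clamp01 (2 * t - 1)).
Proof. by move=> gh t2; rewrite /glue (@clamp01_ge1 (2 * t)) 1?addrAC ?subrr ?add0r//; lra. Qed.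

Lemma cpath_glue (g h : R -> C) : cpath g -> cpath h -> cpath (glue g h).
Proof.
move=> /cpathP cg /cpathP ch; apply: cpathD; last exact: cpath_cst.
have m0 : 0 < 2 :> R by [].
apply: cpathD; apply: (cpath_clamp m0).
- by move=> s t; apply: le_trans (clamp01_lip _ _) _; rewrite -mulrBr normrM ger0_norm.
- by move=> t; exact: clamp01_itv.
- exact: (continuous_subspaceT cg).
- move=> s t; apply: le_trans (clamp01_lip _ _) _.
  by rewrite opprB addrA subrK -mulrBr normrM ger0_norm.
- by move=> t; exact: clamp01_itv.
- exact: (continuous_subspaceT ch).
Qed.

Lemma joined_trans S z w v : joined S z w -> joined S w v -> joined S z v.
Proof.
move=> [g [cg g0 g1 Sg]] [h [ch h0 h1 Sh]]; have gh : g 1 = h 0 by rewrite g1 h0.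
exists (glue g h); split.
- exact: cpath_glue.
- by rewrite glue_left ?invr_ge0// mulr0 clamp01_id ?lexx ?ler01.
- rewrite glue_right//; last by rewrite invf_le1 ?ler1n.
  by rewrite mulr1 clamp01_ge1//; lra.
- move=> t; have [t2|/ltW t2] := leP t 2^-1; first by rewrite glue_left.
  by rewrite glue_right.
Qed.

Lemma joined_seg S (z w : C) : (forall t : R, 0 <= t <= 1 -> S (z + t%:C * (w - z))) -> joined S z w.
Proof.
move=> H; exists (fun t => z + (clamp01 t)%:C * (w - z)); split.
- move=> t e e0; exists (e / (cmod (w - z) + 1)); first by rewrite divr_gt0// ltr_wpDl// cmod_ge0.
  move=> s st; rewrite opprD addrACA subrr add0r -mulrBl -rmorphB cmodM cmod_real.
  apply: le_lt_trans (_ : `|s - t| * (cmod (w - z) + 1) < _); last first.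
    by rewrite -ltr_pdivlMr// ltr_wpDl// cmod_ge0.
  by apply: ler_pM; rewrite ?cmod_ge0 ?clamp01_lip// lerDl.
- by rewrite clamp01_id ?lexx ?ler01// mul0r addr0.
- by rewrite clamp01_id ?lexx ?ler01// mul1r addrC subrK.
- by move=> t; apply: H; exact: clamp01_itv.
Qed.

Lemma joined_sub (S S' : set C) z w : S `<=` S' -> joined S z w -> joined S' z w.
Proof. by move=> SS [g [cg g0 g1 Sg]]; exists g; split=> // t; exact: SS. Qed.

Lemma joined_image (S S' : set C) (f : C -> C) z w : (forall v, S v -> ccont f v) ->
  (forall v, S v -> S' (f v)) -> joined S z w -> joined S' (f z) (f w).
Proof.
move=> cf fS [g [cg g0 g1 Sg]]; exists (fun t => f (g t)); split; last 3 first.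
- by rewrite g0.
- by rewrite g1.
- by move=> t; exact: fS.
move=> t e e0; have [d d0 Hd] := cf _ (Sg t) e e0; have [d' d'0 Hd'] := cg t d d0.
by exists d' => // s /Hd'/Hd.
Qed.

Lemma convex_ball (c z w : C) (r t : R) : cmod (z - c) < r -> cmod (w - c) < r ->
  0 <= t <= 1 -> cmod (z + t%:C * (w - z) - c) < r.
Proof.
move=> zr wr /andP[t0 t1].
have -> : z + t%:C * (w - z) - c = (1 - t)%:C * (z - c) + t%:C * (w - c).
  by have -> : (1 - t)%:C = 1 - t%:C :> R[i]; [rewrite rmorphB|ring].
apply: le_lt_trans (ler_cmodD _ _) _; rewrite !cmodM !cmod_real.
rewrite (ger0_norm t0) ger0_norm ?subr_ge0//.
have [->|tn] := eqVneq t 0; first by rewrite subr0 mul1r mul0r addr0.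
have tp : 0 < t by rewrite lt_def tn.
have : t * cmod (w - c) < t * r by rewrite ltr_pM2l.
have : (1 - t) * cmod (z - c) <= (1 - t) * r by rewrite ler_wpM2l ?subr_ge0// ltW.
lra.
Qed.

Lemma joined_ball (c : C) (r : R) z w : cmod (z - c) < r -> cmod (w - c) < r ->
  joined [set v | cmod (v - c) < r] z w.
Proof. by move=> zr wr; apply: joined_seg => t /=; exact: convex_ball. Qed.

Lemma joined_propagate (S P : set C) z w : joined S z w -> P z ->
  (forall v, S v -> P v -> exists2 r : R, 0 < r & forall v', S v' -> cmod (v' - v) < r -> P v') ->
  (forall v, S v -> ~ P v -> exists2 r : R, 0 < r & forall v', S v' -> cmod (v' - v) < r -> ~ P v') ->
  P w.
Proof.
move=> [g [cg g0 g1 Sg]] Pz Pop Pcl.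
have gS v : (g @` setT) v -> S v by move=> [t _ <-].
suff KP : g @` setT `<=` P by apply: KP; exists 1.
apply: connected_propagate.
- apply: connected_continuous_connected; first by apply/connected_intervalP.
  by apply: continuous_subspaceT; apply/cpathP.
- by exists z; split=> //; exists 0.
- by move=> v /gS Sv /(Pop v Sv)[r r0 Hr]; exists r => // v' /gS; exact: Hr.
- by move=> v /gS Sv /(Pcl v Sv)[r r0 Hr]; exists r => // v' /gS; exact: Hr.
Qed.

(** S contains no boundary point of Omega, so a path in S cannot leave Omega. *)
Lemma joined_in_open (Omega S : set C) z w : open Omega ->
  (forall v, S v -> closure Omega v -> Omega v) -> Omega z -> joined S z w -> Omega w.
Proof.
move=> /open_cmodP oO SO Oz /joined_propagate; apply=> //.
  by move=> v _ /oO[r r0 Hr]; exists r => // v' _; exact: Hr.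
move=> v Sv nOv; apply: contrapT => H; apply: nOv; apply: SO => //.
apply/closure_cmodP => r r0; apply: contrapT => H2; apply: H; exists r => // v' Sv' vr Ov'.
by apply: H2; exists v'.
Qed.

(** The exterior of the disk is not convex. Both points are first pushed outwards by 2d in the
    direction c; the disk of radius d about c, shifted in this way, lies outside the unit circle,
    and there a segment joins them. *)
Lemma joined_outside (c z w : C) (d : R) : cmod c = 1 -> d <= 1 ->
  cmod (z - c) < d -> cmod (w - c) < d -> 1 < cmod z -> 1 < cmod w ->
  joined [set v | cmod (v - c) < 4 * d /\ 1 < cmod v] z w.
Proof.
move=> c1 d1 zd wd z1 w1.
have d0 : 0 < d by apply: le_lt_trans zd; exact: cmod_ge0.
have cc : c * (c^*)%C = 1 by rewrite -sqr_normc normcmod c1 expr1n.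
have ReP v : cmod (v - c) < d -> 1 - d < Re (v * (c^*)%C).
  move=> vd; have := Re_cmod ((v - c) * (c^*)%C).
  rewrite cmodM cmod_conj c1 mulr1 mulrBl cc ReD ReN /= ler_norml => /andP[h _].
  by move: h vd; clear; lra.
have out v (t : R) : cmod (v - c) < d -> 1 < cmod v -> 0 <= t <= 1 ->
    [set v | cmod (v - c) < 4 * d /\ 1 < cmod v] (v + t%:C * (v + (2 * d)%:C * c - v)).
  move=> vd v1 /andP[t0 t1]; rewrite /= [v + _ * c - v]addrAC subrr add0r mulrA -rmorphM.
  set s := t * (2 * d); have s0 : 0 <= s by rewrite /s !mulr_ge0// ltW.
  have s2 : s <= 2 * d by rewrite /s ler_piMl// mulr_ge0// ltW.
  split.
    have := ler_cmodD (v - c) (s%:C * c); rewrite cmodM cmod_real c1 mulr1 ger0_norm//.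
    by rewrite addrAC; move: vd s2 d0; clear; lra.
  rewrite -(@ltr_pXn2r _ 2) ?nnegrE ?cmod_ge0 ?ler01// expr1n.
  have E : cmod (v + s%:C * c) ^+ 2 = cmod v ^+ 2 + 2 * s * Re (v * (c^*)%C) + s ^+ 2.
    have := cmod_sqr c; rewrite c1 expr1n !cmod_sqr ReD ImD !ReM !ImM /=.
    case: (c) => x y; case: (v) => a b /= h.
    have : s ^+ 2 * 1 = s ^+ 2 * (x ^+ 2 + y ^+ 2) by rewrite -h.
    rewrite mulr1 => ->; ring.
  have vv : 1 < cmod v ^+ 2 by rewrite -(expr1n _ 2) ltr_pXn2r ?nnegrE ?cmod_ge0 ?ler01.
  have R0 : 0 <= Re (v * (c^*)%C) by have := ReP v vd; move: d1; clear; lra.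
  rewrite E; have := mulr_ge0 s0 R0; have := sqr_ge0 s; move: vv; clear; lra.
apply: joined_trans (_ : joined _ z (z + (2 * d)%:C * c)) _.
  by apply: joined_seg => t; exact: out.
apply: joined_trans (_ : joined _ (z + (2 * d)%:C * c) (w + (2 * d)%:C * c)) _; last first.
  have [g [cg g0 g1 Sg]] : joined [set v | cmod (v - c) < 4 * d /\ 1 < cmod v] w (w + (2 * d)%:C * c).
    by apply: joined_seg => t; exact: out.
  exists (fun t => g (clamp01 (1 - t))); split.
  - apply: (@cpath_clamp g (fun t => clamp01 (1 - t)) 1) => //.
    + move=> s t; apply: le_trans (clamp01_lip _ _) _.
      by rewrite mul1r (_ : 1 - s - (1 - t) = - (s - t)) ?normrN//; ring.
    + by move=> t; exact: clamp01_itv.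
    + by apply: continuous_subspaceT; apply/cpathP.
  - by rewrite subr0 clamp01_id ?lexx ?ler01.
  - by rewrite subrr clamp01_id ?lexx ?ler01.
  - by move=> t; exact: Sg.
have shift v : cmod (v - c) < d -> [set v | cmod (v - c) < 4 * d /\ 1 < cmod v] (v + (2 * d)%:C * c).
  move=> vd; split.
    rewrite addrAC; apply: le_lt_trans (ler_cmodD _ _) _.
    by rewrite cmodM cmod_real c1 mulr1 ger0_norm; move: vd d0; clear; lra.
  have := Re_cmod ((v + (2 * d)%:C * c) * (c^*)%C).
  rewrite cmodM cmod_conj c1 mulr1 mulrDl -mulrA cc mulr1 ReD /= ler_norml => /andP[_ h].
  by have := ReP v vd; move: h d0; clear; lra.
apply: (joined_image (f := fun v => v + (2 * d)%:C * c) _ shift (joined_ball zd wd)).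
by move=> v _; apply: ccontD; [exact: ccont_id|exact: ccont_cst].
Qed.
End Paths.

(** * The two sides of an analytic Jordan curve *)

Section CurveSides.
Context {R : realType}.
Local Notation C := (R[i]^o).
Variables (Omega V : set C) (phi : C -> C).
Hypothesis oO : open Omega.
Hypothesis oV : open V.
Hypothesis circV : forall z, cmod z = 1 -> V z.
Hypothesis dphi : forall z, V z -> cdiff phi z.
Hypothesis iphi : forall z w, V z -> V w -> phi z = phi w -> z = w.
Hypothesis bdO : forall zeta, (closure Omega zeta /\ ~ Omega zeta) <->
  exists2 c, cmod c = 1 & zeta = phi c.

Lemma phi_off_curve (z : C) : V z -> cmod z != 1 -> closure Omega (phi z) -> Omega (phi z).
Proof.
move=> Vz z1 cz; apply: contrapT => nO.
have [c c1 /(iphi Vz (circV c1)) zc] := (bdO (phi z)).1 (conj cz nO).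
by rewrite zc c1 eqxx in z1.
Qed.

(** By injectivity the image of a path off the circle avoids the boundary of Omega, so it cannot
    leave Omega. *)
Lemma phi_joined (S : set C) z w : (forall v, S v -> V v /\ cmod v != 1) ->
  joined S z w -> Omega (phi z) ->
  joined [set y | Omega y /\ exists2 v, S v & y = phi v] (phi z) (phi w).
Proof.
move=> SV jS Oz.
have cphi v : S v -> ccont phi v by move=> /SV[/dphi/cdiff_ccont].
have fwd t' : joined S z t' -> Omega (phi t').
  move=> jt; apply: (@joined_in_open R Omega [set y | exists2 v, S v & y = phi v] (phi z) (phi t') oO) => //.
    by move=> _ [v /SV[Vv v1] ->]; exact: phi_off_curve.
  by apply: joined_image jt => // v Sv; exists v.
move: jS => [g [cg g0 g1 Sg]].
(* The path stopped at time [clamp01 t] joins z within S to the point in question, so [fwd] applies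
   to it. *)
have gO t : Omega (phi (g (clamp01 t))).
  apply: fwd; exists (fun s => g (clamp01 t * clamp01 s)); split.
  - apply: (@cpath_clamp R g (fun s => clamp01 t * clamp01 s) 1) => //.
    + move=> s s'; rewrite -mulrBr normrM mul1r; apply: le_trans (clamp01_lip s s').
      by rewrite ler_piMl//; have /andP[h1 h2] := clamp01_itv t; rewrite ger0_norm.
    + move=> s; have /andP[h1 h2] := clamp01_itv t; have /andP[h3 h4] := clamp01_itv s.
      by rewrite mulr_ge0//= mulr_ile1.
    + exact: (continuous_subspaceT ((cpathP g).1 cg)).
  - by rewrite (clamp01_id (_ : 0 <= 0 <= 1)) ?lexx ?ler01// mulr0.
  - by rewrite (@clamp01_id _ 1) ?lexx ?ler01// mulr1.
  - by move=> s; exact: Sg.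
apply: (@joined_image R [set v | S v /\ Omega (phi v)]).
- by move=> v [/cphi].
- by move=> v [Sv Ov]; split=> //; exists v.
- exists (fun t => g (clamp01 t)); split.
  + apply: (@cpath_clamp R g clamp01 1) => //.
    * by move=> s t; rewrite mul1r; exact: clamp01_lip.
    * exact: clamp01_itv.
    * exact: (continuous_subspaceT ((cpathP g).1 cg)).
  + by rewrite clamp01_id ?lexx ?ler01.
  + by rewrite clamp01_id ?lexx ?ler01.
  + by move=> t; split=> //; exact: Sg.
Qed.

(* Each side of the circle near c is connected, so its image lies on one side of bd Omega. *)
Lemma same_side (c z w : C) (d : R) : cmod c = 1 -> 0 < d -> d <= 1 ->
  (forall v, cmod (v - c) < 4 * d -> V v) ->
  cmod (z - c) < d -> cmod (w - c) < d ->
  (cmod z < 1 /\ cmod w < 1) \/ (1 < cmod z /\ 1 < cmod w) -> Omega (phi z) ->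
  joined [set y | Omega y /\ exists2 v, cmod (v - c) < 4 * d & y = phi v] (phi z) (phi w).
Proof.
move=> c1 d0 d1 HV zd wd side Oz.
suff [S [HS1 HS2]] : exists S : set C, (forall v, S v -> cmod (v - c) < 4 * d /\ cmod v != 1) /\ joined S z w.
  apply: joined_sub (phi_joined _ HS2 Oz); last by move=> v /HS1[/HV].
  by move=> y [Oy [v /HS1[vd _] yE]]; exact: (conj Oy (ex_intro2 _ _ v vd yE)).
case: side => -[z1 w1].
  have [h [ch h0 h1 Sh]] : joined [set v | cmod (v - c) < d /\ cmod (v - 0) < 1] z w.
    apply: joined_seg => t t01; split.
      exact: convex_ball.
    by apply: convex_ball => //; rewrite subr0.
  exists [set v | cmod (v - c) < d /\ cmod (v - 0) < 1]; split; last by exists h.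
  by move=> v [vd]; rewrite subr0 => v1; split; [move: vd d0; lra|rewrite lt_eqF].
exists [set v | cmod (v - c) < 4 * d /\ 1 < cmod v]; split; last exact: joined_outside.
by move=> v [vd v1]; rewrite gt_eqF.
Qed.

Lemma room (c : C) : cmod c = 1 -> exists2 d : R, 0 < d <= 1 & forall v, cmod (v - c) < 4 * d -> V v.
Proof.
move=> c1; have [r r0 Hr] := (open_cmodP V).1 oV c (circV c1).
exists (Num.min 1 (r / 4)); first by rewrite lt_min ltr01 divr_gt0//= ge_min lexx.
move=> v vd; apply: Hr; apply: lt_le_trans vd _.
have : Num.min 1 (r / 4) <= r / 4 by rewrite ge_min lexx orbT.
lra.
Qed.

Lemma phi_onto (c : C) (d : R) : 0 < d -> (forall v, cmod (v - c) < d -> V v) ->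
  exists2 r : R, 0 < r & forall y, cmod (y - phi c) < r -> exists2 z, cmod (z - c) < d & phi z = y.
Proof.
move=> d0 HV; apply: injective_open => //.
  by move=> z /HV/dphi.
by move=> z w /HV Vz /HV Vw; exact: iphi.
Qed.

Definition two_sided (c : C) : Prop := exists2 r : R, 0 < r &
  forall z, cmod (z - c) < r -> cmod z != 1 -> V z /\ Omega (phi z).

Lemma two_sided_of_pair (c z w : C) (d : R) : cmod c = 1 -> 0 < d -> d <= 1 ->
  (forall v, cmod (v - c) < 4 * d -> V v) -> cmod (z - c) < d -> cmod (w - c) < d ->
  cmod z < 1 -> 1 < cmod w -> Omega (phi z) -> Omega (phi w) -> two_sided c.
Proof.
move=> c1 d0 d1 HV zd wd z1 w1 Oz Ow; exists d => // v vd v1.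
split; first by apply: HV; move: vd d0; lra.
have [h|h|h] := ltgtP (cmod v) 1; last by rewrite h eqxx in v1.
- have [g [_ _ <- Og]] := same_side c1 d0 d1 HV zd vd (or_introl (conj z1 h)) Oz.
  by have [] := Og 1.
- have [g [_ _ <- Og]] := same_side c1 d0 d1 HV wd vd (or_intror (conj w1 h)) Ow.
  by have [] := Og 1.
Qed.

Lemma radial_points (c : C) (d : R) : cmod c = 1 -> 0 < d -> d <= 1 ->
  exists z w, [/\ cmod (z - c) < d, cmod (w - c) < d, cmod z < 1 & 1 < cmod w].
Proof.
move=> c1 d0 d1; exists ((1 - d / 2)%:C * c), ((1 + d / 2)%:C * c).
have E1 : (1 - d / 2)%:C * c - c = (- (d / 2))%:C * c.
  by have -> : (1 - d / 2)%:C = 1 + (- (d / 2))%:C :> R[i]; [rewrite -rmorphD|ring].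
have E2 : (1 + d / 2)%:C * c - c = (d / 2)%:C * c.
  by have -> : (1 + d / 2)%:C = 1 + (d / 2)%:C :> R[i]; [rewrite -rmorphD|ring].
rewrite E1 E2 !cmodM !cmod_real c1 !mulr1 normrN.
rewrite !ger0_norm; [split; lra|lra|lra|lra].
Qed.

(** Two-sidedness is clearly open along the circle. It is also closed: a two-sided point close to c
    supplies points of both sides near c with images in Omega, and [two_sided_of_pair] applies at
    c. *)
Lemma two_sided_all : (exists2 c, cmod c = 1 & two_sided c) -> forall c, cmod c = 1 -> two_sided c.
Proof.
move=> [c0 c01 tc0].
apply: (@connected_propagate R [set z | cmod z = 1] two_sided); first exact: connected_circle.
- by exists c0.
- move=> c /= c1 [r r0 Hr]; exists (r / 2); first by rewrite divr_gt0.
  move=> c' c'1 cc'; exists (r / 2); first by rewrite divr_gt0.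
  move=> z zc'; apply: Hr; have := ler_cmodD (z - c') (c' - c); rewrite addrA subrK.
  by move: zc' cc'; lra.
move=> c /= c1 nc; have [d /andP[d0 d1] HV] := room c1.
exists (d / 2); first by rewrite divr_gt0.
move=> c' c'1 cc' [r r0 Hr]; apply: nc.
have m0 : 0 < Num.min (d / 2) r by rewrite lt_min divr_gt0.
have m1 : Num.min (d / 2) r <= 1 by rewrite ge_min; apply/orP; left; move: d1 d0; lra.
have [z [w [+ + z1 w1]]] := radial_points c'1 m0 m1.
rewrite !lt_min => /andP[zd zr] /andP[wd wr].
have [_ Oz] := Hr z zr (negbT (lt_eqF z1)); have [_ Ow] := Hr w wr (negbT (gt_eqF w1)).
apply: (two_sided_of_pair c1 d0 d1 HV (z := z) (w := w)) => //.
- have := ler_cmodD (z - c') (c' - c); rewrite addrA subrK; move: zd cc'; lra.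
- have := ler_cmodD (w - c') (c' - c); rewrite addrA subrK; move: wd cc'; lra.
Qed.

(** The union of Omega and the curve is closed, being the closure of Omega, and open, since [phi]
    maps onto a neighbourhood of each point of the curve. Hence it is the whole plane. *)
Lemma two_sided_everything : Omega !=set0 -> (forall c, cmod c = 1 -> two_sided c) ->
  forall z, Omega z \/ exists2 c, cmod c = 1 & z = phi c.
Proof.
move=> [z0 Oz0] H z.
apply: (@joined_propagate R setT (fun z => Omega z \/ exists2 c, cmod c = 1 & z = phi c) z0 z).
- by apply: joined_seg.
- by left.
- move=> v _ [Ov|[c c1 ->]].
    have [r r0 Hr] := (open_cmodP Omega).1 oO v Ov.
    by exists r => // v' _ /Hr; left.
  have [r r0 Hr] := H c c1; have [d /andP[d0 _] HV] := room c1.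
  have [||e e0 He] := @phi_onto c (Num.min r d); first by rewrite lt_min r0.
    by move=> v0; rewrite lt_min => /andP[_ h]; apply: HV; move: h d0; lra.
  exists e => // y _ /He[x]; rewrite lt_min => /andP[xr _] <-.
  have [x1|x1] := eqVneq (cmod x) 1; first by right; exists x.
  by left; have [] := Hr x xr x1.
- move=> v _ nv; have ncl : ~ closure Omega v.
    by move=> cv; apply: nv; have [Ov|nOv] := pselect (Omega v); [left|right; exact/bdO].
  have : \forall y \near v, (~` closure Omega) y.
    by apply: open_nbhs_nbhs; split=> //; apply: closed_openC; exact: closed_closure.
  move=> /nbhs_cmodP[r r0 Hr]; exists r => // y _ yr [Oy|[c c1 yc]]; apply: (Hr y yr).
    exact: (@subset_closure _ Omega y Oy).
  exact: ((bdO y).2 (ex_intro2 _ _ c c1 yc)).1.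
Qed.

Hypothesis one_sided : forall c, cmod c = 1 -> ~ two_sided c.

(** A point off the circle whose image is not in Omega has its image outside the closure of Omega as
    well. The point q serves as the centre of the logarithm in [exists_barrier]. *)
Lemma exterior_point : exists q (rho : R), 0 < rho /\ forall z, Omega z -> rho <= cmod (z - q).
Proof.
have c1 : cmod (1 : C) = 1 by exact: cmod1.
have [d /andP[d0 d1] HV] := room c1.
have [z [w [zd wd z1 w1]]] := radial_points c1 d0 d1.
have [v [Vv v1 nO]] : exists v, [/\ V v, cmod v != 1 & ~ Omega (phi v)].
  have [Oz|nOz] := pselect (Omega (phi z)); last first.
    by exists z; split=> //; [apply: HV; move: zd d0; lra|rewrite lt_eqF].
  have [Ow|nOw] := pselect (Omega (phi w)).
    by exfalso; apply: (one_sided c1); exact: (two_sided_of_pair c1 d0 d1 HV zd wd).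
  by exists w; split=> //; [apply: HV; move: wd d0; lra|rewrite gt_eqF].
have ncl : ~ closure Omega (phi v) by move=> /(phi_off_curve Vv v1).
have : \forall y \near phi v, (~` closure Omega) y.
  by apply: open_nbhs_nbhs; split=> //; apply: closed_openC; exact: closed_closure.
move=> /nbhs_cmodP[r r0 Hr]; exists (phi v), r; split=> // y Oy; rewrite leNgt; apply/negP => yr.
by apply: (Hr y yr); exact: subset_closure.
Qed.

(** As c is not two-sided, all points of Omega near zeta come from the same side of the circle.
    [same_side] joins them within the image of a disk about c, taken so small that its image misses
    B. *)
Lemma locally_connected (B : set C) (zeta : C) : closure Omega zeta -> ~ Omega zeta ->
  closed B -> ~ B zeta -> exists2 r : R, 0 < r & forall w w', Omega w -> Omega w' ->
    cmod (w - zeta) < r -> cmod (w' - zeta) < r -> joined (Omega `\` B) w w'.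
Proof.
move=> cz nz clB nB; have [c c1 zE] := (bdO zeta).1 (conj cz nz).
have [d0' /andP[d0'0 d0'1] HV0] := room c1.
have : \forall y \near zeta, (~` B) y by apply: open_nbhs_nbhs; split=> //; exact: closed_openC.
move=> /nbhs_cmodP[rB rB0 HB].
have [e e0 He] := cdiff_ccont (dphi (circV c1)) rB0.
pose d := Num.min d0' (e / 4).
have d0 : 0 < d by rewrite lt_min d0'0 divr_gt0.
have dd : d <= d0' by rewrite ge_min lexx.
have de : d <= e / 4 by rewrite ge_min lexx orbT.
have d1 : d <= 1 by exact: le_trans dd d0'1.
have HV v : cmod (v - c) < 4 * d -> V v by move=> h; apply: HV0; move: h dd; lra.
have [|r r0 Hr] := @phi_onto c d d0; first by move=> v h; apply: HV; move: h d0; lra.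
exists r => // w w' Ow Ow'; rewrite zE => /Hr[z zd zw] /Hr[z' z'd zw'].
have off x y : Omega y -> phi x = y -> cmod x != 1.
  move=> Oy xy; apply/eqP => x1; have [] := (bdO y).2; first by exists x.
  by [].
rewrite -zw -zw' in Ow Ow' *.
have z1 := off z _ Ow erefl; have z'1 := off z' _ Ow' erefl.
have side : (cmod z < 1 /\ cmod z' < 1) \/ (1 < cmod z /\ 1 < cmod z').
  move: z1 z'1; case: ltgtP => // h _; case: ltgtP => // h' _; [by left| | |by right].
    by exfalso; apply: (one_sided c1); exact: (two_sided_of_pair c1 d0 d1 HV zd z'd).
  by exfalso; apply: (one_sided c1); exact: (two_sided_of_pair c1 d0 d1 HV z'd zd).
apply: joined_sub (same_side c1 d0 d1 HV zd z'd side Ow) => y [Oy [v vd yv]]; split=> //.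
by apply: HB; rewrite yv zE; apply: He; move: vd de; lra.
Qed.
End CurveSides.

(** * The near side of the finger *)

Section Finger.
Context {R : realType}.
Local Notation C := (R[i]^o).
Variables (Omega : set C) (p e : C) (L : R) (a : C).
Hypothesis e1 : cmod e = 1.
Hypothesis L1 : 1 < L.
Hypothesis oO : open Omega.
Local Notation X := (cx p e).
Local Notation Y := (cy p e).

Lemma channelP (z : C) : channel p e L z <-> 0 <= X z <= L /\ 0 <= Y z <= 1.
Proof.
split=> [[x [y [hx hy ->]]]|[hx hy]]; first by rewrite cx_chan// cy_chan.
by exists (X z), (Y z); rewrite chan_cxcy.
Qed.

Lemma end_AP (z : C) : end_A p e z <-> X z = 0 /\ 0 <= Y z <= 1.
Proof.
split=> [[y hy <-]|[hx hy]]; first by rewrite cx_chan// cy_chan.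
by exists (Y z) => //; rewrite -hx chan_cxcy.
Qed.

Lemma end_BP (z : C) : end_B p e L z <-> X z = L /\ 0 <= Y z <= 1.
Proof.
split=> [[y hy <-]|[hx hy]]; first by rewrite cx_chan// cy_chan.
by exists (Y z) => //; rewrite -hx chan_cxcy.
Qed.

Lemma wallsP (z : C) : channel_walls p e L z <-> 0 <= X z <= L /\ (Y z = 0 \/ Y z = 1).
Proof.
split=> [[x [y [hx hy ->]]]|[hx hy]]; first by rewrite cx_chan// cy_chan.
by exists (X z), (Y z); rewrite chan_cxcy.
Qed.

Definition slice (x0 : R) : set C := [set z | X z = x0 /\ 0 <= Y z <= 1].

Lemma closed_slice (x0 : R) : closed (slice x0).
Proof.
move=> z /closure_cmodP cz.
have H (d : R) : 0 < d -> [/\ `|X z - x0| < d, - d < Y z & Y z < 1 + d].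
  move=> d0; have [w [wx /andP[w0 w1]] wz] := cz d d0; rewrite cmodB in wz.
  have := le_lt_trans (cx_lip p e1 z w) wz; have := le_lt_trans (cy_lip p e1 z w) wz.
  by rewrite wx ltr_norml => /andP[h1 h2]; split=> //; lra.
split.
  apply/eqP; rewrite -subr_eq0 -normr_le0; apply/ler_addgt0Pr => d d0; rewrite add0r.
  by have [/ltW] := H d d0.
apply/andP; split; apply/ler_addgt0Pr => d d0; have [_ h1 h2] := H d d0; [|exact: ltW].
by rewrite -lerBlDr sub0r ltW.
Qed.

Lemma end_B_slice : end_B p e L = slice L.
Proof. by apply/seteqP; split=> z; rewrite end_BP. Qed.

Lemma closed_end_B : closed (end_B p e L).
Proof. by rewrite end_B_slice; exact: closed_slice. Qed.

Lemma boundaryP (zeta : C) : boundary Omega zeta <-> closure Omega zeta /\ ~ Omega zeta.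
Proof.
rewrite /boundary (_ : Omega° = Omega); last exact/interior_id.
by split.
Qed.

Lemma ball_off (B : set C) (z : C) : closed B -> Omega z -> ~ B z ->
  exists2 r : R, 0 < r & forall w, cmod (w - z) < r -> (Omega `\` B) w.
Proof.
move=> cB Oz nB; have : \forall w \near z, (Omega `\` B) w.
  apply: open_nbhs_nbhs; split=> //; apply: openI => //; exact: closed_openC.
by move=> /nbhs_cmodP.
Qed.

(** The complement of [beyond_B] in Omega, by [beyond_BP], but with paths parametrized by the whole
    line. *)
Definition near_side (z : C) : Prop := exists g, [/\ cpath g, forall t, Omega (g t), g 0 = a
  & g 1 = z /\ ~ traverses p e L g].

Lemma near_side_sub : near_side `<=` Omega.
Proof. by move=> z [g [_ Og _ [<- _]]]. Qed.

Lemma beyond_BP (z : C) : Omega z -> (beyond_B Omega p e L a z <-> ~ near_side z).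
Proof.
move=> Oz; split.
  move=> [_ H] [g [cg Og g0 [g1 nt]]]; apply/nt/H => //.
  by split; [apply: continuous_subspaceT; apply/cpathP|move=> t _; exact: Og].
move=> nN; split=> // g [cg Og] g0 g1; apply: contrapT => nt; apply: nN.
exists (fun t => g (clamp01 t)); split.
- apply: (@cpath_clamp R g clamp01 1) => //; last exact: clamp01_itv.
  by move=> s t; rewrite mul1r; exact: clamp01_lip.
- by move=> t; apply: Og; exact: clamp01_itv.
- by rewrite clamp01_id ?lexx ?ler01.
- rewrite clamp01_id ?lexx ?ler01//; split=> // -[s [t [s0 st t1 [As Bt] H]]]; apply: nt.
  have E r : s <= r <= t -> clamp01 r = r.
    by move=> /andP[h1 h2]; rewrite clamp01_id// (le_trans s0 h1) (le_trans h2 t1).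
  exists s, t; split=> //.
    by move: As Bt; rewrite !E ?lexx ?st.
  by move=> r hr; have := H r hr; rewrite E.
Qed.

(** A traversal of the glued path ends on B, which the second path avoids. So it takes place within
    the first path. *)
Lemma near_side_extend (z w : C) : near_side z -> joined (Omega `\` end_B p e L) z w -> near_side w.
Proof.
move=> [g [cg Og g0 [g1 nt]]] [h [ch h0 h1 Sh]].
have gh : g 1 = h 0 by rewrite g1 h0.
exists (glue g h); split.
- exact: cpath_glue.
- move=> t; have [t2|/ltW t2] := leP t 2^-1; first by rewrite glue_left.
  by rewrite glue_right//; have [] := Sh (clamp01 (2 * t - 1)).
- by rewrite glue_left ?invr_ge0// mulr0 clamp01_id ?lexx ?ler01.
- split; first by rewrite glue_right ?invf_le1 ?ler1n// clamp01_ge1// mulr1; lra.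
  move=> [s [t [s0 st t1 [As Bt] H]]]; have [t2|/ltW t2] := leP t 2^-1; last first.
    by move: Bt; rewrite glue_right//; have [] := Sh (clamp01 (2 * t - 1)).
  have E r : s <= r <= t -> glue g h r = g (2 * r).
    move=> /andP[h1' h2']; rewrite glue_left//; last exact: le_trans h2' t2.
    by rewrite clamp01_id//; lra.
  apply: nt; exists (2 * s), (2 * t); split.
  - lra.
  - lra.
  - lra.
  - by move: As Bt; rewrite !E ?lexx ?st.
  - move=> r /andP[h1' h2']; have := H (r / 2); rewrite E; last by apply/andP; split; lra.
    rewrite (_ : 2 * (r / 2) = r); last by field.
    by apply; apply/andP; split; lra.
Qed.

Lemma near_side_closure (z : C) : closure near_side z -> Omega z -> ~ end_B p e L z -> near_side z.
Proof.
move=> /closure_cmodP cN Oz nB.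
have [r r0 Hr] := ball_off closed_end_B Oz nB.
have [w Nw wz] := cN r r0; apply: near_side_extend Nw _.
apply: joined_sub Hr _; apply: (joined_ball (c := z)) => //.
by rewrite subrr cmod0.
Qed.

Lemma near_side_open (z : C) : near_side z -> ~ end_B p e L z ->
  exists2 r : R, 0 < r & forall w, cmod (w - z) < r -> near_side w.
Proof.
move=> Nz nB; have Oz := near_side_sub Nz.
have [r r0 Hr] := ball_off closed_end_B Oz nB.
exists r => // w wz; apply: near_side_extend Nz _.
apply: joined_sub Hr _; apply: (joined_ball (c := z)) => //.
by rewrite subrr cmod0.
Qed.

Section Boundary.
Hypothesis locconn : forall zeta, closure Omega zeta -> ~ Omega zeta -> ~ end_B p e L zeta ->
  exists2 r : R, 0 < r & forall w w', Omega w -> Omega w' ->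
    cmod (w - zeta) < r -> cmod (w' - zeta) < r -> joined (Omega `\` end_B p e L) w w'.

(** Some near point is close to zeta, and every point of Omega close to zeta is joined to it off B,
    hence is near. A point of the exit arc close to zeta would be a limit of points beyond B. *)
Lemma boundary_near_side (zeta : C) : closure Omega zeta -> ~ Omega zeta -> ~ end_B p e L zeta ->
  closure near_side zeta -> ~ closure (boundary Omega `&` exit_arc Omega p e L a) zeta.
Proof.
move=> cz nz nB /closure_cmodP cN; have [r r0 Hr] := locconn cz nz nB.
have [w Nw wz] := cN r r0; have Ow := near_side_sub Nw.
have all_near w' : Omega w' -> cmod (w' - zeta) < r -> near_side w'.
  by move=> Ow' w'z; apply: near_side_extend Nw _; exact: Hr.
move=> /closure_cmodP cE; have r2 : 0 < r / 2 by rewrite divr_gt0.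
have [xi [_ [_ /closure_cmodP cb]] xz] := cE _ r2.
have [v bv vx] := cb _ r2; have Ov : Omega v by case: bv.
apply: ((beyond_BP Ov).1 bv); apply: all_near => //.
have := ler_cmodD (v - xi) (xi - zeta); rewrite addrA subrK; lra.
Qed.

(** If the near side stays away from zeta, the points of Omega around zeta are all beyond B, and the
    boundary points around zeta, being their limits, belong to the exit arc. *)
Lemma boundary_dichotomy (zeta : C) : closure Omega zeta -> ~ Omega zeta -> ~ end_B p e L zeta ->
  ~ closure (boundary Omega `&` exit_arc Omega p e L a) zeta \/
  ~ closure (boundary Omega `\` exit_arc Omega p e L a) zeta.
Proof.
move=> cz nz nB; have [cN|ncN] := pselect (closure near_side zeta).
  by left; exact: boundary_near_side.
right=> /closure_cmodP cE; apply: ncN; apply/closure_cmodP => r r0.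
have r2 : 0 < r / 2 by rewrite divr_gt0.
have [xi [bxi nE] xz] := cE _ r2.
apply: contrapT => none; apply: nE; split; first exact: bxi.
apply/closure_cmodP => s s0.
have [/closure_cmodP cxi _] := (boundaryP xi).1 bxi.
have [|v Ov vx] := cxi (Num.min s (r / 2)); first by rewrite lt_min s0.
move: vx; rewrite lt_min => /andP[vs vr]; exists v => //.
apply/(beyond_BP Ov) => Nv; apply: none; exists v => //.
have := ler_cmodD (v - xi) (xi - zeta); rewrite addrA subrK; lra.
Qed.
End Boundary.

(* The only boundary points of start_side inside Omega are on the slice x = 1/2,
   so that the maximum principle bounds u on start_side by its supremum there. *)
Definition start_side (z : C) : Prop := exists a0, [/\ near_side a0,
  end_A p e a0 \/ ~ channel p e L a0 & joined (Omega `\` slice 2^-1) a0 z].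

Lemma cross_slice (h : R -> C) (s t : R) : cpath h -> s <= t -> X (h s) = 0 -> X (h t) = L ->
  (forall r, s <= r <= t -> channel p e L (h r)) -> exists2 r, s <= r <= t & slice 2^-1 (h r).
Proof.
move=> ch st hs ht H.
have cX : continuous (fun r => X (h r)).
  move=> r; apply/cvgrPdist_lt => d d0; have [d' d'0 Hd'] := ch r d d0.
  apply: filterS (nbhsx_ballx r d' d'0) => r'; rewrite /ball/= distrC => /Hd'.
  by rewrite distrC; apply: le_lt_trans; exact: cx_lip.
have [||c] := @IVT R (fun r => X (h r)) s t 2^-1 st.
- exact: continuous_subspaceT.
- by rewrite hs ht ge_min le_max; apply/andP; split; [apply/orP; left|apply/orP; right]; move: L1; lra.
rewrite in_itv/= => hc Xc; exists c => //; split=> //.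
by have /channelP[_] := H c hc.
Qed.

(** A traversal of the glued path that ends in the second half would start or pass at the seed, or
    start later. From A to B it has to cross the slice, which the second path avoids; this excludes
    a late start and a seed on A. A seed outside the channel cannot lie on a traversal. *)
Lemma start_side_near : start_side `<=` near_side.
Proof.
move=> z [a0 [[g [cg Og g0 [g1 nt]]] seed [h [ch h0 h1 Sh]]]].
have gh : g 1 = h 0 by rewrite g1 h0.
exists (glue g h); split.
- exact: cpath_glue.
- move=> t; have [t2|/ltW t2] := leP t 2^-1; first by rewrite glue_left.
  by rewrite glue_right//; have [] := Sh (clamp01 (2 * t - 1)).
- by rewrite glue_left ?invr_ge0// mulr0 clamp01_id ?lexx ?ler01.
- split; first by rewrite glue_right ?invf_le1 ?ler1n// clamp01_ge1// mulr1; lra.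
  move=> [s [t [s0 st t1 [As Bt] H]]]; have [t2|/ltW t2] := leP t 2^-1.
    have E r : s <= r <= t -> glue g h r = g (2 * r).
      move=> /andP[h1' h2']; rewrite glue_left//; last exact: le_trans h2' t2.
      by rewrite clamp01_id//; lra.
    apply: nt; exists (2 * s), (2 * t); split.
    - lra.
    - lra.
    - lra.
    - by move: As Bt; rewrite !E ?lexx ?st.
    - move=> r /andP[h1' h2']; have := H (r / 2); rewrite E; last by apply/andP; split; lra.
      rewrite (_ : 2 * (r / 2) = r); last by field.
      by apply; apply/andP; split; lra.
  have E r : 2^-1 <= r -> r <= 1 -> glue g h r = h (2 * r - 1).
    move=> h1' h2'; rewrite glue_right// clamp01_id//; lra.
  have no (s' : R) : 2^-1 <= s' -> s <= s' -> s' <= t -> end_A p e (glue g h s') -> False.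
    move=> s'2 ss' s't A'.
    have [||||r /andP[r1 r2]] := @cross_slice h (2 * s' - 1) (2 * t - 1) ch.
    - lra.
    - by move: A'; rewrite E//; [move=> /end_AP[]|lra].
    - by move: Bt; rewrite E// => /end_BP[].
    - move=> r /andP[h1' h2']; have := H ((r + 1) / 2); rewrite E; [|lra|lra].
      rewrite (_ : 2 * ((r + 1) / 2) - 1 = r); last by field.
      by apply; apply/andP; split; lra.
    by have [_] := Sh r.
  have [s2|/ltW s2] := leP 2^-1 s; first exact: (no s s2).
  have mid : glue g h 2^-1 = a0.
    by rewrite E ?invf_le1 ?ler1n// mulfV// subrr h0.
  case: seed => [Aa0|nch]; first by apply: (no 2^-1) => //; rewrite mid.
  by apply: nch; rewrite -mid; apply: H; rewrite s2 t2.
Qed.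

Lemma start_side_open (z : C) : start_side z ->
  exists2 r : R, 0 < r & forall w, cmod (w - z) < r -> start_side w.
Proof.
move=> [a0 [Na0 seed jz]]; have [Oz nS] : (Omega `\` slice 2^-1) z.
  by case: jz => h [_ _ <- Sh].
have [r r0 Hr] := ball_off (@closed_slice 2^-1) Oz nS.
exists r => // w wz; exists a0; split=> //; apply: joined_trans jz _.
apply: joined_sub Hr _; apply: (joined_ball (c := z)) => //.
by rewrite subrr cmod0.
Qed.

Lemma start_side_boundary (z : C) : closure start_side z -> ~ start_side z -> Omega z ->
  slice 2^-1 z /\ near_side z.
Proof.
move=> cN nN Oz; have Sz : slice 2^-1 z.
  apply: contrapT => nS; apply: nN; have [r r0 Hr] := ball_off (@closed_slice 2^-1) Oz nS.
  have [w [a0 [Na0 seed jw]] wz] := (closure_cmodP _ _).1 cN r r0.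
  exists a0; split=> //; apply: joined_trans jw _.
  apply: joined_sub Hr _; apply: (joined_ball (c := z)) => //.
  by rewrite subrr cmod0.
split=> //; apply: near_side_closure => //.
  by apply: closureS cN; exact: start_side_near.
by move=> /end_BP[XL _]; case: Sz => X2 _; move: X2 L1; rewrite XL; lra.
Qed.

Lemma seed_start_side (z : C) : near_side z -> end_A p e z \/ ~ channel p e L z -> start_side z.
Proof.
move=> Nz seed; exists z; split=> //; exists (fun=> z); split=> //; first exact: cpath_cst.
move=> _; split; first exact: near_side_sub.
move=> [X2 Yz]; case: seed => [/end_AP[X0 _]|].
  by move: X2; rewrite X0; lra.
by apply; apply/channelP; split=> //; rewrite X2; move: L1; lra.
Qed.
End Finger.

(** * Estimates in the channel *)

Section Estimate.
Context {R : realType}.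
Local Notation C := (R[i]^o).
Variables (Omega : set C) (p e : C) (L : R) (a : C) (u h : C -> R) (Xs : seq C) (M : R).
Hypothesis e1 : cmod e = 1.
Hypothesis L1 : 1 < L.
Hypothesis oO : open Omega.
Hypothesis walls : forall z, channel_walls p e L z -> ~ Omega z.
Hypothesis Hu : forall z, Omega z -> rcont u z /\ has_lap u z 0.
Hypothesis uM : forall z, Omega z -> `|u z| <= M.
Hypothesis Hh : forall z, Omega z -> [/\ rcont h z, 0 <= h z & exists2 l : R, l < 0 & has_lap h z l].
Hypothesis h_infty : forall K : R, exists B : R, forall z, Omega z -> B < cmod z -> K < h z.
Hypothesis h_pole : forall zeta, zeta \in Xs -> forall K : R, exists2 d : R, 0 < d &
      forall z, Omega z -> cmod (z - zeta) < d -> K < h z.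
Hypothesis XsL : forall zeta, zeta \in Xs -> ~ Omega zeta /\ cx p e zeta = L.
Hypothesis LXs : forall zeta, closure Omega zeta -> ~ Omega zeta -> cx p e zeta = L -> zeta \in Xs.
Hypothesis locconn : forall zeta, closure Omega zeta -> ~ Omega zeta -> ~ end_B p e L zeta ->
  exists2 r : R, 0 < r & forall w w', Omega w -> Omega w' ->
    cmod (w - zeta) < r -> cmod (w' - zeta) < r -> joined (Omega `\` end_B p e L) w w'.
Hypothesis bd1 : forall zeta, boundary Omega zeta ->
  ~ closure (boundary Omega `\` exit_arc Omega p e L a) zeta ->
  forall eps : R, 0 < eps -> exists2 d : R, 0 < d & forall z, Omega z -> cmod (z - zeta) < d -> `|u z - 1| < eps.
Hypothesis bd0 : forall zeta, boundary Omega zeta ->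
  ~ closure (boundary Omega `&` exit_arc Omega p e L a) zeta ->
  forall eps : R, 0 < eps -> exists2 d : R, 0 < d & forall z, Omega z -> cmod (z - zeta) < d -> `|u z - 0| < eps.

Local Notation X := (cx p e).
Local Notation Y := (cy p e).
Local Notation near := (near_side Omega p e L a).
Local Notation start := (start_side Omega p e L a).

Lemma limsup_rcont (U : set C) (v F : C -> R) (zeta : C) : rcont F zeta -> F zeta <= 0 ->
  (forall w, U w -> v w <= F w) -> limsup_le0 U v zeta.
Proof.
move=> cF F0 vF eps e0; have [d d0 Hd] := cF eps e0; exists d => // w Uw /Hd.
by rewrite ltr_norml => /andP[_ h1]; apply: le_trans (vF w Uw) _; lra.
Qed.

Lemma compare (U : set C) (b : C -> R) : U `<=` Omega ->
  (forall z, U z -> exists2 r : R, 0 < r & forall w, cmod (w - z) < r -> U w) ->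
  (forall z, U z -> [/\ rcont b z, has_lap b z 0 & 0 <= b z]) ->
  (forall zeta, closure U zeta -> ~ U zeta -> zeta \notin Xs -> limsup_le0 U (fun w => u w - b w) zeta) ->
  forall z, U z -> u z <= b z.
Proof.
move=> UO oU Hb bdry z Uz; rewrite -subr_le0.
apply: (@maximum_principle R U (fun w => u w - b w) h Xs M oU) => //.
- move=> w Uw; have [cu lu] := Hu (UO w Uw); have [cb lb _] := Hb w Uw; split.
    by apply: rcontD => //; exact: rcontN.
  by apply: (has_lap_eq (has_lapB lu lb)); rewrite subrr.
- by move=> w Uw; apply: Hh; exact: UO.
- by move=> K; have [B HB] := h_infty K; exists B => w /UO; exact: HB.
- by move=> zeta /h_pole H K; have [d d0 Hd] := H K; exists d => // w /UO; exact: Hd.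
- move=> w Uw; have [_ _ b0] := Hb w Uw; have := uM (UO w Uw).
  by rewrite ler_norml => /andP[_ h1]; lra.
Qed.

Lemma not_end_B (zeta : C) : closure Omega zeta -> ~ Omega zeta -> zeta \notin Xs -> ~ end_B p e L zeta.
Proof.
by move=> cz nz zX /(end_BP p L e1)[XL _]; move: zX; rewrite (LXs cz nz XL).
Qed.

(** At every boundary point outside [Xs] the dichotomy provides a limit of u, either 0 or 1. *)
Lemma u_le1 (z : C) : Omega z -> u z <= 1.
Proof.
move=> Oz; apply: (@compare Omega (fun=> 1)) => //.
- by move=> w Ow; exact: (open_cmodP Omega).1.
- by move=> w _; split; [exact: rcont_cst|exact: has_lap_cst|].
move=> zeta cz nz zX eps e0; have nB := not_end_B cz nz zX.
have bz : boundary Omega zeta by apply/(boundaryP oO).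
have [n0|n1] := boundary_dichotomy a oO locconn cz nz nB.
  have [d d0 Hd] := bd0 bz n0 e0; exists d => // w Ow wz.
  by have := Hd w Ow wz; rewrite ltr_norml => /andP[_ ?]; lra.
have [d d0 Hd] := bd1 bz n1 e0; exists d => // w Ow wz.
by have := Hd w Ow wz; rewrite ltr_norml => /andP[_ ?]; lra.
Qed.

Lemma limsup_near (U : set C) (b : C -> R) (zeta : C) : U `<=` near -> (forall w, U w -> 0 <= b w) ->
  closure U zeta -> ~ Omega zeta -> zeta \notin Xs -> limsup_le0 U (fun w => u w - b w) zeta.
Proof.
move=> UN b0 cU nz zX.
have NO := @near_side_sub R Omega p e L a.
have cz : closure Omega zeta by apply: closureS cU => w /UN/NO.
have nB := not_end_B cz nz zX.
have bz : boundary Omega zeta by apply/(boundaryP oO).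
have cN : closure near zeta by exact: closureS cU.
move=> eps eps0; have [d d0 Hd] := bd0 bz (boundary_near_side locconn cz nz nB cN) eps0.
exists d => // w Uw wz; have := Hd w (NO _ (UN _ Uw)) wz; have := b0 w Uw.
by rewrite ltr_norml => ? /andP[_ ?]; lra.
Qed.

Variable m : R.
Hypothesis m0 : 0 <= m.
Hypothesis um : forall z, near z -> slice p e 2^-1 z -> u z <= m.

Lemma u_start (z : C) : start z -> u z <= m.
Proof.
have SN := start_side_near e1 L1 (a := a) (Omega := Omega).
have NO := @near_side_sub R Omega p e L a.
apply: (@compare start (fun=> m)).
- by move=> w /SN/NO.
- by move=> w; exact: start_side_open.
- by move=> w _; split; [exact: rcont_cst|exact: has_lap_cst|].
move=> zeta cz nz zX; have [Oz|nOz] := pselect (Omega zeta).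
  have [Sz Nz] := start_side_boundary e1 L1 oO cz nz Oz.
  apply: (@limsup_rcont _ _ (fun w => u w - m)) => //.
    by apply: rcontD; [have [] := Hu Oz|exact: rcont_cst].
  by rewrite subr_le0; exact: um.
by apply: (limsup_near (b := fun=> m)) => //; exact: SN.
Qed.

Definition strip (x1 x2 : R) : set C := [set z | near z /\ (x1 < X z < x2 /\ 0 < Y z < 1)].

Lemma wall_free (z : C) : Omega z -> 0 <= X z <= L -> 0 <= Y z <= 1 -> 0 < Y z < 1.
Proof.
move=> Oz hX /andP[y0 y1]; have nw : ~ (Y z = 0 \/ Y z = 1).
  by move=> hY; apply: (walls _ Oz); apply/(wallsP p L e1).
by rewrite !lt_def y0 y1 !andbT; apply/andP; split; apply/eqP => E; apply: nw; [left|right].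
Qed.

(** The horizontal sides take care of themselves: walls are outside Omega, and u tends to 0 at
    boundary points of Omega approached from the near side. On the right side only the closure of
    the near side is at hand, because for x2 = L these points lie on B. *)
Lemma compare_strip (x1 x2 : R) (b : R -> R -> R) : 0 <= x1 -> x2 <= L ->
  (forall x y, x1 < x < x2 -> 0 < y < 1 -> rharmonic b x y /\ 0 <= b x y) ->
  (forall z, x1 < X z < x2 -> 0 < Y z < 1 -> rcont (fun w => b (X w) (Y w)) z) ->
  (forall z, near z -> X z = x1 -> 0 < Y z < 1 ->
     limsup_le0 (strip x1 x2) (fun w => u w - b (X w) (Y w)) z) ->
  (forall z, Omega z -> closure near z -> X z = x2 -> 0 < Y z < 1 ->
     limsup_le0 (strip x1 x2) (fun w => u w - b (X w) (Y w)) z) ->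
  forall z, near z -> x1 < X z < x2 -> 0 < Y z < 1 -> u z <= b (X z) (Y z).
Proof.
move=> x10 x2L hb cb left right z Nz hX hY.
have NO := @near_side_sub R Omega p e L a.
apply: (@compare (strip x1 x2) (fun w => b (X w) (Y w))) => //.
- by move=> w [/NO].
- move=> w [Nw [/andP[w1 w2] /andP[w3 w4]]].
  have [|r r0 Hr] := near_side_open e1 oO Nw.
    by move=> /(end_BP p L e1)[XL _]; move: w2; rewrite XL; move: x2L; lra.
  pose s := Num.min r (Num.min (Num.min (X w - x1) (x2 - X w)) (Num.min (Y w) (1 - Y w))).
  exists s; first by rewrite !lt_min r0 !subr_gt0 w1 w2 w3 w4.
  move=> w'; rewrite !lt_min => /and3P[h1 /andP[h2 h3] /andP[h4 h5]].
  have := le_lt_trans (cx_lip p e1 w' w) h2; have := le_lt_trans (cx_lip p e1 w' w) h3.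
  have := le_lt_trans (cy_lip p e1 w' w) h4; have := le_lt_trans (cy_lip p e1 w' w) h5.
  rewrite !ltr_norml => /andP[a1 a2] /andP[a3 a4] /andP[a5 a6] /andP[a7 a8].
  split; first exact: Hr.
  by split; apply/andP; split; lra.
- move=> w [_ [w1 w2]]; have [hw bw] := hb _ _ w1 w2; split=> //; first exact: cb.
  exact: has_lap_rot.
move=> zeta cz nz zX; have [Oz|nOz] := pselect (Omega zeta); last first.
  apply: (limsup_near (b := fun w => b (X w) (Y w))) => // w [Nw [w1 w2]] //.
  by have [] := hb _ _ w1 w2.
have lim (d : R) : 0 < d -> [/\ x1 < X zeta + d, X zeta < x2 + d, 0 < Y zeta + d & Y zeta < 1 + d].
  move=> d0; have [w [_ [/andP[w1 w2] /andP[w3 w4]]] wz] := (closure_cmodP _ _).1 cz d d0.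
  have := le_lt_trans (cx_lip p e1 w zeta) wz; have := le_lt_trans (cy_lip p e1 w zeta) wz.
  by rewrite !ltr_norml => /andP[a1 a2] /andP[a3 a4]; split; lra.
have X1 : x1 <= X zeta by apply/ler_addgt0Pr => d /lim[/ltW].
have X2 : X zeta <= x2 by apply/ler_addgt0Pr => d /lim[_ /ltW].
have Y1 : 0 <= Y zeta by apply/ler_addgt0Pr => d /lim[_ _ /ltW].
have Y2 : Y zeta <= 1 by apply/ler_addgt0Pr => d /lim[_ _ _ /ltW].
have hYz : 0 < Y zeta < 1.
  apply: wall_free => //; last by rewrite Y1 Y2.
  by rewrite (le_trans x10 X1) (le_trans X2 x2L).
have cN : closure near zeta by apply: closureS cz => w [].
have [X2'|X2'] := eqVneq (X zeta) x2; first exact: right.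
have Xlt : X zeta < x2 by rewrite lt_neqAle X2'.
have Nz' : near zeta.
  apply: near_side_closure => // /(end_BP p L e1)[XL _]; move: Xlt; rewrite XL; move: x2L; lra.
have [X1'|X1'] := eqVneq (X zeta) x1; first exact: left.
by exfalso; apply: nz; split=> //; rewrite Xlt lt_neqAle eq_sym X1' X1.
Qed.

Definition exit_set : set R := [set y : R | 0 <= y <= 1 /\ Omega (chan_pt p e L y)].

Lemma exit_setE (y : R) : exit_set y -> 0 < y < 1.
Proof.
move=> [hy Oy]; have := @wall_free _ Oy; rewrite cx_chan// cy_chan//; apply=> //.
by move: L1; lra.
Qed.

Lemma open_exit_set : open exit_set.
Proof.
rewrite openE => y Ey; have hy := exit_setE Ey; move: Ey => [_ Oy].
have [r r0 Hr] := (open_cmodP Omega).1 oO _ Oy.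
pose s := Num.min r (Num.min y (1 - y)).
have s0 : 0 < s by move: hy => /andP[h1 h2]; rewrite !lt_min r0 h1 subr_gt0.
apply/nbhs_ballP; exists s => // y'; rewrite /ball/= !lt_min !ltr_norml.
move=> /and3P[/andP[a1 a2] /andP[a3 a4] /andP[a5 a6]]; split; first by apply/andP; split; lra.
apply: Hr; apply: le_lt_trans (coord_dist p e1 _ _) _.
rewrite !cx_chan// !cy_chan// subrr normr0 add0r distrC ltr_norml.
by apply/andP; split.
Qed.

Lemma exit_width_width : exit_width Omega p e L = width exit_set 0 1.
Proof.
rewrite /exit_width /width; congr fine; congr lebesgue_measure.
by apply/seteqP; split=> y; [move=> Ey; split=> //; case: Ey => hy _; rewrite /= in_itv|case].
Qed.

Lemma exists_exit_barrier : exists T, angle_barrier L exit_set 0 1 T.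
Proof.
apply: (@exists_angle_barrier R L exit_set [seq Y z | z <- Xs]) => //.
- exact: open_exit_set.
- move=> y /mapP[z zX ->] [_ Oy]; have [nO XL] := XsL zX; apply: nO.
  by move: Oy; rewrite -XL chan_cxcy.
move=> y hy cy ny; apply/mapP; exists (chan_pt p e L y); last by rewrite cy_chan.
apply: LXs; last by rewrite cx_chan.
  apply/closure_cmodP => r r0.
  have [y' [[_ Oy'] yy']] := cy _ (nbhsx_ballx y r r0).
  exists (chan_pt p e L y') => //; apply: le_lt_trans (coord_dist p e1 _ _) _.
  by rewrite !cx_chan// !cy_chan// subrr normr0 add0r distrC.
by move=> Oy; apply: ny; split=> //; move: hy => /andP[h1 h2]; rewrite !ltW.
Qed.

Local Notation d := (exit_width Omega p e L).
Local Notation k := ((cos (2^-1 : R))^-1).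
(** With frequency 1 instead of pi, the cosine is at least cos(1/2) up to the walls. This is needed
    on A, where u is bounded by m but not by a multiple of sin(pi y). *)
Let P (x y : R) : R := m * k * (expR (- x) * cos (y - 2^-1)).

Lemma k_gt0 : 0 < k.
Proof. by rewrite invr_gt0; have := @cos_half_gt R; lra. Qed.

Lemma cos_ge (y : R) : 0 <= y <= 1 -> cos (2^-1 : R) <= cos (y - 2^-1).
Proof.
move=> /andP[y0 y1]; have p2 := pi_ge2 R.
have [h1|h1] := leP 2^-1 y; first by apply: cos_nonincr; lra.
by rewrite -[leRHS]cosN; apply: cos_nonincr; lra.
Qed.

Lemma P_harm x y : rharmonic P x y.
Proof. by apply: rharmonicZ; exact: rharmonic_expcos. Qed.

Lemma P_ge0 x y : 0 <= y <= 1 -> 0 <= P x y.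
Proof.
move=> hy; rewrite /P; apply: mulr_ge0; first exact: mulr_ge0 m0 (ltW k_gt0).
apply: mulr_ge0; first exact: expR_ge0.
by apply: le_trans (cos_ge hy); have := @cos_half_gt R; lra.
Qed.

Lemma P_rcont z : rcont (fun w => P (X w) (Y w)) z.
Proof.
apply: rcontM; first exact: rcont_cst.
apply: rcontM.
  apply: (@rcont_comp R expR (fun w => - X w)); last exact: continuous_expR.
  by apply: rcontN; exact: rcont_cx.
apply: (@rcont_comp R cos (fun w => Y w - 2^-1)); last exact: continuous_cos.
by apply: rcontD; [exact: rcont_cy|exact: rcont_cst].
Qed.

Lemma P_left y : 0 <= y <= 1 -> m <= P 0 y.
Proof.
move=> hy; rewrite /P oppr0 expR0 mul1r -mulrA ler_peMr//.
rewrite ler_pdivlMl; last by rewrite -invr_gt0; exact: k_gt0.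
by rewrite mulr1; exact: cos_ge.
Qed.

Lemma left_limsup (x2 : R) (b : R -> R -> R) (z : C) :
  (forall w, strip 0 x2 w -> P (X w) (Y w) <= b (X w) (Y w)) ->
  near z -> X z = 0 -> 0 < Y z < 1 ->
  limsup_le0 (strip 0 x2) (fun w => u w - b (X w) (Y w)) z.
Proof.
move=> Pb Nz Xz /andP[y0 y1].
have Oz := near_side_sub Nz.
have Yz : 0 <= Y z <= 1 by rewrite !ltW.
apply: (@limsup_rcont _ _ (fun w => u w - P (X w) (Y w))).
- by apply: rcontD; [have [] := Hu Oz|apply: rcontN; exact: P_rcont].
- rewrite subr_le0 Xz; apply: le_trans (P_left Yz); apply: u_start.
  by apply: seed_start_side => //; left; apply/(end_AP p e1).
- by move=> w /Pb; lra.
Qed.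

(** At points of B inside Omega the angle barrier tends to 1, and u <= 1. The remaining boundary
    points on x = L belong to [Xs] and are left to the logarithmic barrier. *)
Lemma step1 : exists2 T : R -> R -> R,
  (forall x y, x < L -> T x y <= d / (pi * (L - x))) &
  forall z, near z -> 0 < X z < L -> 0 < Y z < 1 -> u z <= T (X z) (Y z) + P (X z) (Y z).
Proof.
have [T [T1 T2 T3 T4]] := exists_exit_barrier.
exists T; first by move=> x y xL; rewrite exit_width_width; have /andP[] := T3 x y xL.
apply: (@compare_strip 0 L (fun x y => T x y + P x y)) => //.
- move=> x y /andP[x0 xL] /andP[y0 y1]; split.
    by apply: rharmonicD; [exact: T1|exact: P_harm].
  have /andP[t0 _] := T3 x y xL; apply: addr_ge0 => //.
  by apply: P_ge0; rewrite !ltW.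
- by move=> z /andP[_ zL] _; apply: rcontD; [exact: T2|exact: P_rcont].
- move=> z Nz Xz Yz; apply: (left_limsup (b := fun x y => T x y + P x y)) => // w [_ [/andP[_ wL] _]].
  by have /andP[t0 _] := T3 (X w) (Y w) wL; lra.
move=> z Oz _ Xz Yz eps eps0.
have Ez : exit_set (Y z).
  split; first by move: Yz => /andP[? ?]; rewrite !ltW.
  by rewrite -Xz chan_cxcy.
have [dl dl0 Hd] := T4 (Y z) Ez Yz eps eps0.
exists dl => // w [Nw [/andP[_ wL] /andP[w0 w1]]] wz.
have h1 : L - X w < dl.
  have := le_lt_trans (cx_lip p e1 w z) wz; rewrite Xz ltr_norml => /andP[? ?]; lra.
have h2 := le_lt_trans (cy_lip p e1 w z) wz.
have := Hd _ _ wL h1 h2; have := u_le1 (near_side_sub Nw).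
have Pw : 0 <= P (X w) (Y w) by apply: P_ge0; rewrite !ltW.
lra.
Qed.

Lemma d_ge0 : 0 <= d.
Proof. by rewrite exit_width_width width_ge0. Qed.

(** At distance at least 1/8 from B the angle barrier is at most D = 8 d / pi. The comparison is
    made in the strip of half width 1/8 about x = L - 1/4; the factor 64 makes the quadratic term
    equal to D on its two ends. *)
Lemma step2 (z : C) : near z -> X z = L - 4^-1 -> 0 < Y z < 1 ->
  u z <= 64 * (8 / pi * d) * (Y z * (1 - Y z)) + P (X z) (Y z).
Proof.
move=> Nz Xz Yz; have [T TB S1] := step1.
have pi0 := pi_gt0 R; have dp := d_ge0.
set D := 8 / pi * d; have D0 : 0 <= D by rewrite mulr_ge0// divr_ge0// ltW.
pose Q (x y : R) := 64 * D * (y * (1 - y) + (x - (L - 4^-1)) * (x - (L - 4^-1))).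
suff : u z <= Q (X z) (Y z) + P (X z) (Y z) by rewrite /Q Xz subrr mulr0 addr0.
have yy (y : R) : 0 < y < 1 -> 0 <= y * (1 - y).
  by move=> /andP[h1 h2]; rewrite mulr_ge0 ?subr_ge0// ltW.
have Q0 (x y : R) : 0 < y < 1 -> 0 <= Q x y.
  move=> /yy hy; apply: mulr_ge0; first exact: mulr_ge0.
  by apply: addr_ge0 => //; rewrite -expr2 sqr_ge0.
have Qc w : rcont (fun w => Q (X w) (Y w) + P (X w) (Y w)) w.
  apply: rcontD; last exact: P_rcont.
  have cX : rcont (fun w => X w - (L - 4^-1)) w by apply: rcontD; [exact: rcont_cx|exact: rcont_cst].
  have cY := rcont_cy p e1 w.
  apply: rcontM; first exact: rcont_cst.
  apply: rcontD; last exact: rcontM.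
  apply: rcontM => //; apply: rcontD; [exact: rcont_cst|exact: rcontN].
have ends w : near w -> 0 < Y w < 1 -> X w = L - 4^-1 - 8^-1 \/ X w = L - 4^-1 + 8^-1 ->
    u w - (Q (X w) (Y w) + P (X w) (Y w)) <= 0.
  move=> Nw Yw hX; have wL : 0 < X w < L by case: hX => ->; move: L1; lra.
  have /andP[_ wL'] := wL.
  have := S1 w Nw wL Yw.
  have -> : Q (X w) (Y w) = 64 * D * (Y w * (1 - Y w)) + D.
    by rewrite /Q; case: hX => ->; field.
  have TD : T (X w) (Y w) <= D.
    apply: le_trans (TB _ _ wL') _; rewrite /D.
    have -> : 8 / pi * d = d / (pi * 8^-1) by rewrite invfM invrK; ring.
    have h8 : 8^-1 <= L - X w by case: hX => ->; lra.
    have p8 : 0 < pi * 8^-1 :> R by rewrite mulr_gt0.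
    apply: ler_wpM2l => //; rewrite lef_pV2 ?posrE//; first by rewrite ler_pM2l.
    by rewrite mulr_gt0// subr_gt0.
  have := mulr_ge0 (mulr_ge0 (ler0n R 64) D0) (yy _ Yw); lra.
have side w x1 x2 : near w -> 0 < Y w < 1 -> X w = L - 4^-1 - 8^-1 \/ X w = L - 4^-1 + 8^-1 ->
    limsup_le0 (strip x1 x2) (fun w => u w - (Q (X w) (Y w) + P (X w) (Y w))) w.
  move=> Nw Yw hX; apply: (@limsup_rcont _ _ (fun w => u w - (Q (X w) (Y w) + P (X w) (Y w)))) (ends w Nw Yw hX) _ => //.
  apply: rcontD; last by apply: rcontN; exact: Qc.
  by have [] := Hu (near_side_sub Nw).
apply: (@compare_strip (L - 4^-1 - 8^-1) (L - 4^-1 + 8^-1) (fun x y => Q x y + P x y)) => //.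
- by move: L1; lra.
- lra.
- move=> x y _ hy; split.
    apply: rharmonicD; last exact: P_harm.
    by apply: rharmonicZ; exact: rharmonic_quad.
  by apply: addr_ge0; [exact: Q0|apply: P_ge0; move: hy => /andP[? ?]; rewrite !ltW].
- by move=> w Nw hX hY; apply: side => //; left.
- move=> w Ow cN hX hY; apply: side => //; last by right.
  apply: near_side_closure => // /(end_BP p L e1)[]; rewrite hX; lra.
- rewrite Xz; lra.
Qed.

(** The factor 128 is 64 times the 2 of [sin_pi_ge], which turns y (1 - y) into the sine on the
    right end, where the exponential is 1. *)
Lemma step3 (z : C) : near z -> 0 < X z < L - 4^-1 -> 0 < Y z < 1 ->
  u z <= 128 * (8 / pi * d) * (expR (pi * (X z - (L - 4^-1))) * sin (pi * Y z)) + P (X z) (Y z).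
Proof.
have pi0 := pi_gt0 R; have dp := d_ge0.
set D := 8 / pi * d; have D0 : 0 <= D by rewrite mulr_ge0// divr_ge0// ltW.
pose Q (x y : R) := 128 * D * (expR (pi * (x - (L - 4^-1))) * sin (pi * y)).
have sin0 (y : R) : 0 < y < 1 -> 0 <= sin (pi * y).
  move=> /andP[h1 h2]; have y01 : 0 <= y <= 1 by rewrite !ltW.
  have := sin_pi_ge y01.
  have : 0 <= y * (1 - y) by rewrite mulr_ge0 ?subr_ge0// ltW.
  lra.
have Q0 (x y : R) : 0 < y < 1 -> 0 <= Q x y.
  move=> hy; apply: mulr_ge0; first exact: mulr_ge0.
  by apply: mulr_ge0; [exact: expR_ge0|exact: sin0].
have Qc w : rcont (fun w => Q (X w) (Y w) + P (X w) (Y w)) w.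
  apply: rcontD; last exact: P_rcont.
  apply: rcontM; first exact: rcont_cst.
  apply: rcontM.
    apply: (@rcont_comp R expR (fun w => pi * (X w - (L - 4^-1)))); last exact: continuous_expR.
    by apply: rcontM; [exact: rcont_cst|apply: rcontD; [exact: rcont_cx|exact: rcont_cst]].
  apply: (@rcont_comp R sin (fun w => pi * Y w)); last exact: continuous_sin.
  by apply: rcontM; [exact: rcont_cst|exact: rcont_cy].
apply: (@compare_strip 0 (L - 4^-1) (fun x y => Q x y + P x y)) => //.
- lra.
- move=> x y _ hy; split.
    apply: rharmonicD; last exact: P_harm.
    by apply: rharmonicZ; exact: rharmonic_expsin.
  by apply: addr_ge0; [exact: Q0|apply: P_ge0; move: hy => /andP[? ?]; rewrite !ltW].
- move=> w Nw Xw Yw; apply: (left_limsup (b := fun x y => Q x y + P x y)) => // v [_ [_ hv]].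
  by have := Q0 (X v) (Y v) hv; lra.
move=> w Ow cN Xw Yw.
have Nw : near w by apply: near_side_closure => // /(end_BP p L e1)[]; rewrite Xw; lra.
apply: (@limsup_rcont _ _ (fun w => u w - (Q (X w) (Y w) + P (X w) (Y w)))) => //.
  apply: rcontD; last by apply: rcontN; exact: Qc.
  by have [] := Hu Ow.
have := step2 Nw Xw Yw; rewrite -/D /Q Xw subrr mulr0 expR0 mul1r.
have : 64 * D * (Y w * (1 - Y w)) <= 64 * D * (2 * sin (pi * Y w)).
  apply: ler_wpM2l; first exact: mulr_ge0.
  by apply: sin_pi_ge; move: Yw => /andP[? ?]; rewrite !ltW.
lra.
Qed.

Lemma slice_bound (z : C) : near z -> slice p e 2^-1 z ->
  u z <= 128 * (8 / pi) * expR (pi * (3 / 4)) * d * expR (- (pi * L)) + m * (expR (- 2^-1) * k).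
Proof.
move=> Nz [Xz hY]; have Oz := near_side_sub Nz.
have Yz : 0 < Y z < 1 by apply: wall_free => //; rewrite Xz; move: L1; lra.
have pi0 := pi_gt0 R; have dp := d_ge0.
have hX : 0 < X z < L - 4^-1 by rewrite Xz; move: L1; lra.
apply: le_trans (step3 Nz hX Yz) _; apply: lerD.
  (* The factor e^{3 pi/4} is the price of the two layers cut off, 1/2 at A and 1/4 at B. *)
  rewrite Xz (_ : pi * (2^-1 - (L - 4^-1)) = pi * (3 / 4) + - (pi * L)); last by field.
  rewrite expRD.
  have -> : 128 * (8 / pi) * expR (pi * (3 / 4)) * d * expR (- (pi * L)) =
    128 * (8 / pi * d) * (expR (pi * (3 / 4)) * expR (- (pi * L))) by ring.
  apply: ler_wpM2l; first by rewrite mulr_ge0// mulr_ge0// divr_ge0// ltW.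
  by rewrite ler_piMr ?sin_le1// mulr_ge0// expR_ge0.
have -> : P (X z) (Y z) = m * (expR (- 2^-1) * k) * cos (Y z - 2^-1) by rewrite /P Xz; ring.
apply: ler_piMr; last exact: cos_le1.
apply: mulr_ge0 => //; apply: mulr_ge0; [exact: expR_ge0|exact: ltW k_gt0].
Qed.
End Estimate.

(** * The curve against the lines of the walls and of the end B *)

Section CurveAndLines.
Context {R : realType}.
Local Notation C := (R[i]^o).
Variables (Omega V : set C) (phi : C -> C) (p e : C) (L : R).
Hypothesis oO : open Omega.
Hypothesis oV : open V.
Hypothesis circV : forall z, cmod z = 1 -> V z.
Hypothesis dphi : forall z, V z -> cdiff phi z.
Hypothesis iphi : forall z w, V z -> V w -> phi z = phi w -> z = w.
Hypothesis bdO : forall zeta, (closure Omega zeta /\ ~ Omega zeta) <->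
  exists2 c, cmod c = 1 & zeta = phi c.
Hypothesis e1 : cmod e = 1.
Hypothesis L1 : 1 < L.
Hypothesis walls : forall z, channel_walls p e L z -> ~ Omega z.
Variable zA : C.
Hypothesis OzA : Omega zA.
Hypothesis zAA : end_A p e zA.
Local Notation X := (cx p e).
Local Notation Y := (cy p e).

(* If Omega lay on both sides of Gamma, it would be the complement of Gamma, and
   Gamma would contain both walls; but an analytic curve containing one wall is
   contained in its line. *)
Lemma curve_one_sided (c : C) : cmod c = 1 -> ~ two_sided Omega V phi c.
Proof.
move=> c1 tc.
have all := two_sided_all oO oV circV dphi iphi bdO (ex_intro2 _ _ c c1 tc).
have full := two_sided_everything oO oV circV dphi iphi bdO (ex_intro _ zA OzA) all.
have wallG (x y : R) : 0 <= x <= L -> y = 0 \/ y = 1 ->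
    exists2 c, cmod c = 1 & chan_pt p e x y = phi c.
  move=> hx hy; have [Oz|//] := full (chan_pt p e x y).
  exfalso; apply: (walls _ Oz); apply/(wallsP p L e1).
  by rewrite cx_chan// cy_chan.
(* The line y = 0 in the form required by [curve_meets_line]: multiplication by - 'i turns an
   imaginary part into a real part. *)
have YE z : Re (- 'i * (e^*)%C * phi z) = Im (p * (e^*)%C) <-> Y (phi z) = 0.
  have -> : Re (- 'i * (e^*)%C * phi z) = Im (phi z * (e^*)%C).
    by case: (e) => a b; case: (phi z) => x y /=; ring.
  by rewrite /cy mulrBl ImD ImN; split=> [->|/eqP]; [rewrite subrr|rewrite subr_eq0 => /eqP].
have [[s Hs]|H] := curve_meets_line (- 'i * (e^*)%C) (Im (p * (e^*)%C)) oV circV dphi; last first.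
  have [|c' c'1 cE] := @wallG 0 1 _ (or_intror erefl); first by rewrite lexx; move: L1; lra.
  by have := (YE c').1 (H c' c'1); rewrite -cE cy_chan// => /eqP; rewrite oner_eq0.
have pre (x : R) : exists c' : C, 0 <= x <= L -> cmod c' = 1 /\ chan_pt p e x 0 = phi c'.
  have [hx|hx] := boolP (0 <= x <= L); last by exists 0.
  by have [c' c'1 cE] := wallG x 0 hx (or_introl erefl); exists c'.
have [f Hf] := choice pre.
(* The wall y = 0 has n + 1 distinct points with abscissas in [0, 1), and their preimages on the
   circle are one too many for [s]. *)
pose n := size s; pose pts := [seq f (i%:R / n.+1%:R) | i <- iota 0 n.+1].
have hi i : (i < n.+1)%N -> 0 <= (i%:R / n.+1%:R : R) <= L.
  move=> lin; rewrite divr_ge0//= (@le_trans _ _ 1)//; last by move: L1; lra.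
  by rewrite ler_pdivrMr ?ltr0n// mul1r ler_nat ltnW.
have up : uniq pts.
  rewrite map_inj_in_uniq ?iota_uniq// => i j; rewrite !mem_iota !add0n /= => li lj fij.
  have [_ E1] := Hf _ (hi i li); have [_ E2] := Hf _ (hi j lj).
  have : X (chan_pt p e (i%:R / n.+1%:R) 0) = X (chan_pt p e (j%:R / n.+1%:R) 0) by rewrite E1 E2 fij.
  rewrite !cx_chan// => /(mulIf _)/eqP; rewrite invr_eq0 pnatr_eq0 eqr_nat => /(_ isT)/eqP//.
have : (size pts <= size s)%N.
  apply: uniq_leq_size up _ => z zp; have [i li ->] := mapP zp.
  move: li; rewrite mem_iota add0n /= => li.
  have [f1 fE] := Hf _ (hi i li); apply: Hs => //; apply/YE.
  by rewrite -fE cy_chan.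
by rewrite size_map size_iota ltnn.
Qed.

(** If the whole curve lay on x = L, the line x = 0 would miss it. Then Omega, which meets A, would
    contain the corner of a wall. *)
Lemma curve_meets_end_B : exists Xs : seq C,
  (forall zeta, zeta \in Xs -> ~ Omega zeta /\ X zeta = L) /\
  (forall zeta, closure Omega zeta -> ~ Omega zeta -> X zeta = L -> zeta \in Xs).
Proof.
have XE z : Re ((e^*)%C * phi z) = L + Re (p * (e^*)%C) <-> X (phi z) = L.
  rewrite mulrC /cx mulrBl ReD ReN; split=> [->|]; first by rewrite addrK.
  by move=> <-; rewrite subrK.
have [[s Hs]|H] := curve_meets_line (e^*)%C (L + Re (p * (e^*)%C)) oV circV dphi.
  (* [s] may contain further points; the filter ensures that the images are boundary points on x =
     L. *)
  exists [seq phi z | z <- s & (cmod z == 1) && (X (phi z) == L)]; split.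
    move=> zeta /mapP[z]; rewrite mem_filter => /andP[/andP[/eqP z1 /eqP zL] _] ->.
    by split=> //; have [] := (bdO (phi z)).2 (ex_intro2 _ _ z z1 erefl).
  move=> zeta cz nz XL; have [c c1 cE] := (bdO zeta).1 (conj cz nz).
  apply/mapP; exists c => //; rewrite mem_filter c1 eqxx -cE XL eqxx /=.
  by apply: Hs => //; apply/XE; rewrite -cE.
exfalso.
have [XA hA] := (end_AP p e1 zA).1 zAA.
pose w0 := chan_pt p e 0 0.
have Xw0 : X w0 = 0 by rewrite cx_chan.
apply: (walls (z := w0)).
  apply/(wallsP p L e1); rewrite Xw0 cy_chan// lexx; split; last by left.
  by move: L1; lra.
apply: (@joined_in_open R Omega [set z | X z = 0] zA w0 oO) => //.
  move=> v /= Xv cv; apply: contrapT => nv.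
  have [c c1 cE] := (bdO v).1 (conj cv nv).
  by have := (XE c).1 (H c c1); rewrite -cE Xv; move: L1; lra.
apply: joined_seg => t _ /=.
have -> : X (zA + t%:C * (w0 - zA)) = X zA + t * (X w0 - X zA).
  rewrite [X w0 - _]cxB /cx addrAC mulrDl ReD; congr (_ + _).
  by rewrite -mulrA ReM /= mul0r subr0.
by rewrite XA Xw0 subrr mulr0 addr0.
Qed.
End CurveAndLines.

(** * Boundary limits and positivity of the exit width *)

Section ExitWidth.
Context {R : realType}.
Local Notation C := (R[i]^o).

Lemma within_cvg_cmod (Omega : set C) (u : C -> R) (zeta : C) (l : R) :
  (u z @[z --> within Omega (nbhs zeta)] --> l) ->
  forall eps : R, 0 < eps -> exists2 d : R, 0 < d &
    forall z, Omega z -> cmod (z - zeta) < d -> `|u z - l| < eps.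
Proof.
move=> cu eps e0; have := cu _ (nbhsx_ballx l eps e0); rewrite nbhs_simpl /= => /nbhs_cmodP[d d0 Hd].
exists d => // z Oz zd; have := Hd z zd Oz.
by rewrite /ball/= distrC.
Qed.

Lemma exit_width_gt0 (Omega : set C) (p e : C) (L : R) (z : C) : cmod e = 1 -> open Omega ->
  1 < L -> (forall w, channel_walls p e L w -> ~ Omega w) -> Omega z -> end_B p e L z ->
  0 < exit_width Omega p e L.
Proof.
move=> e1 oO L1 walls Oz Bz.
rewrite exit_width_width.
have oE := open_exit_set e1 L1 oO walls.
have [XL hY] := (end_BP p L e1 z).1 Bz.
have Ez : exit_set Omega p e L (cy p e z) by split=> //; rewrite -XL chan_cxcy.
have := exit_setE e1 L1 walls Ez => /andP[y0 y1].
have /nbhs_ballP[r /= r0 Hr] : nbhs (cy p e z) (exit_set Omega p e L) by exact: open_nbhs_nbhs.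
have mE : measurable (exit_set Omega p e L) by exact: measurable_realfun.open_measurable.
set y := cy p e z in Hr y0 y1 *.
have r2 : 0 < r / 2 by rewrite divr_gt0.
apply: lt_le_trans (_ : (y + r / 2) - (y - r / 2) <= _); first by lra.
apply: le_trans (width_full mE _ _) _.
- lra.
- by move=> t /andP[h1 h2]; apply: Hr; rewrite /ball/= ltr_norml; apply/andP; split; lra.
rewrite /width; apply: fine_le; rewrite ?width_fin//.
apply: le_measure; rewrite ?inE; [exact: measurableI|exact: measurableI|].
by move=> t [Et _]; split=> //; have := exit_setE e1 L1 walls Et; rewrite /= in_itv/= => /andP[? ?]; rewrite !ltW.
Qed.

End ExitWidth.

(** * The constant and the absorption of m *)

Theorem theorem2 (R : realType) :
  exists C : R,
    forall (Omega : set (R[i]^o)) (p e : R[i]^o) (L : R) (a : R[i]^o) (w : R),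
      open Omega -> connected Omega ->
      conformal_image_of_disk Omega ->
      analytic_Jordan_curve (boundary Omega) ->
      1 < L ->
      contains_finger Omega p e L ->
      outside_at_A Omega p e L a ->
      is_harmonic_measure Omega (exit_arc Omega p e L a) a w ->
      w < C / (2 * pi) * exit_width Omega p e L * expR (- (pi * L)).
Proof.
pose K : R := 128 * (8 / pi) * expR (pi * (3 / 4)).
pose kap : R := expR (- 2^-1) / cos (2^-1).
have kap1 : kap < 1 := @expR_half_lt R.
(* The factor 2 pi cancels the one in the statement, and the summand 1 makes the inequality strict,
   since d > 0. *)
exists (2 * pi * (K / (1 - kap) + 1)).
move=> Omega p e L a w oO _ _ [V [phi [oV circ [hphi iphi0] GE]]] L1.
move=> [ne _ wallsO [g [_ Og] [s [t [s0 st t1 [As Bt] _]]]]] [Oa nca _].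
move=> [u [harm [M uM] lim1 lim0 ->]].
have pi0 := pi_gt0 R.
have e1 : cmod e = 1 by apply: (@complexI R); rewrite -normcmod ne.
have walls z : channel_walls p e L z -> ~ Omega z.
  by move=> wz Oz; have : (channel_walls p e L `&` Omega) z by []; rewrite wallsO.
have circV z : cmod z = 1 -> V z by move=> z1; apply: circ; rewrite /unit_circle/= normcmod z1.
have dphi z : V z -> cdiff phi z by move=> Vz; exact/derivable_cdiff/hphi.
have iphi z v : V z -> V v -> phi z = phi v -> z = v.
  by move=> Vz Vv; apply: iphi0; rewrite inE.
have bdO zeta : (closure Omega zeta /\ ~ Omega zeta) <-> exists2 c, cmod c = 1 & zeta = phi c.
  rewrite -boundaryP// GE; split=> [[c]|[c c1 ->]].
    by rewrite /unit_circle/= normcmod => c1 <-; exists c => //; apply: (@complexI R).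
  by exists c => //; rewrite /unit_circle/= normcmod c1.
have OA : Omega (g s) by apply: Og; rewrite s0 (le_trans st).
have OB : Omega (g t) by apply: Og; rewrite t1 (le_trans s0).
have onesided := curve_one_sided oO oV circV dphi iphi bdO e1 L1 walls OA.
have [Xs [XsL LXs]] := curve_meets_end_B oO oV circV dphi bdO e1 L1 walls OA As.
have [q [rho [rho0 Hq]]] := exterior_point oO oV circV dphi iphi bdO onesided.
have [h [Hh hinf hpole]] := exists_barrier rho0 Hq (fun z zX => (XsL z zX).1).
have lc zeta : closure Omega zeta -> ~ Omega zeta -> ~ end_B p e L zeta ->
    exists2 r : R, 0 < r & forall z z', Omega z -> Omega z' ->
      cmod (z - zeta) < r -> cmod (z' - zeta) < r -> joined (Omega `\` end_B p e L) z z'.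
  move=> cz nz nB; have cB : closed (end_B p e L) by exact: closed_end_B.
  exact (locally_connected oO oV circV dphi iphi bdO onesided cz nz cB nB).
have Hu := harmonic_lap oO harm.
have bd1 zeta bz nz := within_cvg_cmod (lim1 zeta bz nz).
have bd0 zeta bz nz := within_cvg_cmod (lim0 zeta bz nz).
have ule := u_le1 e1 oO Hu uM Hh hinf hpole LXs lc bd1 bd0.
pose N := near_side Omega p e L a.
(* The value 0 is included so that the set is nonempty and m >= 0. *)
pose S : set R := [set x | x = 0 \/ exists2 z, N z /\ slice p e 2^-1 z & x = u z].
have S0 : S !=set0 by exists 0; left.
have Sub : has_ubound S.
  by exists 1 => x [->//|[z [/near_side_sub Oz _] ->]]; exact: ule.
pose m := sup S.
have m0 : 0 <= m by apply: ub_le_sup => //; left.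
have um z : N z -> slice p e 2^-1 z -> u z <= m.
  by move=> Nz sz; apply: ub_le_sup => //; right; exists z.
pose d := exit_width Omega p e L.
have d0 : 0 < d := exit_width_gt0 e1 oO L1 walls OB Bt.
have sb := slice_bound e1 L1 oO walls Hu uM Hh hinf hpole XsL LXs lc bd1 bd0 m0 um.
have E0 : 0 < expR (- (pi * L)) :> R by exact: expR_gt0.
have K0 : 0 <= K by rewrite /K !mulr_ge0// ?expR_ge0// invr_ge0 ltW.
have dE : 0 < d * expR (- (pi * L)) by rewrite mulr_gt0.
have kap0 : 0 <= kap.
  by rewrite /kap divr_ge0 ?expR_ge0//; have := @cos_half_gt R; lra.
have mb : m <= K * (d * expR (- (pi * L))) + m * kap.
  apply: ge_sup => // x [->|[z [Nz sz] ->]].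
    by rewrite addr_ge0// mulr_ge0// ltW.
  by rewrite [K * _]mulrA; exact: sb.
have um' : u a <= m.
  apply: (u_start e1 L1 oO Hu uM Hh hinf hpole LXs lc bd0 m0 um).
  (* The point a lies outside the channel, so it is a seed, and the constant path at a traverses
     nothing. *)
  apply: seed_start_side => //; last by right.
  exists (fun=> a); split=> //; first exact: cpath_cst.
  split=> // -[s' [t' [_ st' _ _ H]]].
  by apply: nca; apply: (H s'); rewrite lexx.
have k1 : 0 < 1 - kap by rewrite subr_gt0.
have mK : m <= K / (1 - kap) * (d * expR (- (pi * L))).
  (* The term m kap is moved to the left, which is where kap < 1 is used. *)
  rewrite mulrAC ler_pdivlMr//; move: mb; lra.
have -> : 2 * pi * (K / (1 - kap) + 1) / (2 * pi) = K / (1 - kap) + 1.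
  by rewrite mulrAC divff ?mul1r// mulf_neq0// gt_eqF.
rewrite -mulrA mulrDl mul1r; apply: le_lt_trans um' _; apply: le_lt_trans mK _.
by rewrite ltrDl.
Qed.
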